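(* Let $\phi(z)=bz+cz^2+\int_{(0,\infty)}(e^{-zu}-1+zu)\,m(du)$ be a branching mechanism with $\delta:=\phi'(\infty)<\infty$. Let $z>0$ and let $N_z=\sum_{i=1}^\infty\delta_{(s_i,w_i)}$ be a Poisson random measure on $(0,\infty)\times D[0,\infty)$ with intensity $z e^{-\delta s}\,ds\,\mathbf{N}_m(dw)$, where $$\mathbf{N}_m(dw)=\int_{(0,\infty)}m(dx)\,\mathbf{Q}_x(dw).$$ For $t\ge 0$ let $$X_t^z=ze^{-\delta t}+\int_{(0,t]}\int_{D[0,\infty)}w(t-s)\,N_z(ds,dw)$$ and let $\mathcal{G}_t^z$ be the $\sigma$-algebra generated by the random variables $\{N_z((0,u]\times A):A\in\mathcal{A}_{t-u},\,0\le u\le t\}$. Then $\{(X_t^z,\mathcal{G}_t^z):t\ge 0\}$ is a CB-process with branching mechanism $\phi$.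
   Context: In a branching mechanism, $b\in\mathbb{R}$, $c\ge 0$ and $m$ is a $\sigma$-finite measure on $(0,\infty)$ with $\int_{(0,\infty)}(u\wedge u^2)\,m(du)<\infty$; $\phi'(\infty)=\lim_{z\to\infty}\phi'(z)=b+2c\cdot\infty+\int_{(0,\infty)}u\,m(du)$ with $0\cdot\infty=0$. For $\lambda\ge 0$, $t\mapsto v_t(\lambda)$ is the unique nonnegative solution of $v_t(\lambda)=\lambda-\int_0^t\phi(v_s(\lambda))\,ds$. $(Q_t)_{t\ge 0}$ is the (Feller) transition semigroup on $[0,\infty)$ given by $\int_{[0,\infty)}e^{-\lambda y}Q_t(x,dy)=e^{-xv_t(\lambda)}$. A pair $\{(X_t,\mathcal{G}_t):t\ge 0\}$ is a CB-process with branching mechanism $\phi$ if $X$ is a $[0,\infty)$-valued Markov process relative to $(\mathcal{G}_t)$ with transition semigroup $(Q_t)_{t\ge 0}$. $D[0,\infty)$ is the space of nonnegative càdlàg paths $w$ on $[0,\infty)$; $\mathcal{A}=\sigma(\{w(s):0\le s<\infty\})$, $\mathcal{A}_t=\sigma(\{w(s):0\le s\le t\})$. $\mathbf{Q}_x$ is the law on $(D[0,\infty),\mathcal{A})$ of the CB-process started from $x$.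
   Formalization: The filtration 𝒢_t^z is augmented by the P-null events, since X_t^z need not be strictly 𝒢_t^z-measurable (a path may jump at time t−s_i), and X_t^z, which may be infinite on a null event, is shown to be a.s. finite and set to 0 there. *)

(* Defs.v *)
From HB Require Import structures.
From mathcomp Require Import all_boot all_order all_algebra.
From mathcomp Require Import all_classical all_reals all_analysis.
From mathcomp Require Import measurable_realfun.

Set Implicit Arguments.
Unset Strict Implicit.
Unset Printing Implicit Defensive.

Import Order.TTheory GRing.Theory Num.Def Num.Theory.
Import numFieldNormedType.Exports.

Local Open Scope classical_set_scope.
Local Open Scope ring_scope.
Local Open Scope ereal_scope.

(* A measure on (0, oo) is represented by a measure on R of which only the
   restriction to (0, oo) is ever used. *)
Definition branching_parameters (R : realType) (b c : R)
    (m : {measure set (measurableTypeR R) -> \bar R}) : Prop :=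
  [/\ (0 <= c)%R,
      sigma_finite (`]0%R, +oo[%classic : set (measurableTypeR R)) m &
      \int[m]_(u in `]0%R, +oo[) (minr u (u ^+ 2))%:E < +oo].

Definition branching_mechanism (R : realType) (b c : R)
    (m : {measure set (measurableTypeR R) -> \bar R}) (z : R) : R :=
  (b * z + c * z ^+ 2
   + \int[m]_(u in `]0%R, +oo[) (expR (- (z * u)) - 1 + z * u))%R.

(* [v t l] stands for v_t(lambda).  Integrability of s |-> phi (v_s(lambda)) is
   required because the integral below is a total operator. *)
Definition cumulant_semigroup (R : realType) (phi : R -> R) (v : R -> R -> R)
    : Prop :=
  forall t l : R, (0 <= t)%R -> (0 <= l)%R ->
    [/\ (0 <= v t l)%R,
        (@lebesgue_measure R).-integrable `[0%R, t]
          (fun s => (phi (v s l))%:E) &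
        (v t l = l - \int[@lebesgue_measure R]_(s in `[0%R, t]) phi (v s l))%R].

(* Kernels on the state space [0, oo) are kernels on R of which only the values
   at nonnegative times and nonnegative starting points matter. *)
Definition transition_semigroup (R : realType)
    (Q : R -> R.-pker (measurableTypeR R) ~> (measurableTypeR R)) : Prop :=
  [/\ forall t x : R, (0 <= t)%R -> (0 <= x)%R -> Q t x `[0%R, +oo[%classic = 1,
      forall (x : R) (B : set (measurableTypeR R)),
        (0 <= x)%R -> measurable B -> Q 0%R x B = \d_x B &
      forall (s t x : R) (B : set (measurableTypeR R)),
        (0 <= s)%R -> (0 <= t)%R -> (0 <= x)%R -> measurable B ->
        Q (s + t)%R x B = \int[Q s x]_(y in `[0%R, +oo[) Q t y B].

Definition CB_semigroup (R : realType) (v : R -> R -> R)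
    (Q : R -> R.-pker (measurableTypeR R) ~> (measurableTypeR R)) : Prop :=
  transition_semigroup Q /\
  forall t x l : R, (0 <= t)%R -> (0 <= x)%R -> (0 <= l)%R ->
    \int[Q t x]_(y in `[0%R, +oo[) (expR (- (l * y)))%:E
    = (expR (- (x * v t l)))%:E.

(* Time runs over [0, oo); families indexed by R are only considered at
   nonnegative times. *)
Definition filtration (R : realType) (d : measure_display)
    (Omega : measurableType d) (G : R -> set (set Omega)) : Prop :=
  (forall t : R, (0 <= t)%R ->
    sigma_algebra [set: Omega] (G t) /\ G t `<=` measurable) /\
  (forall s t : R, (0 <= s)%R -> (s <= t)%R -> G s `<=` G t).

(* Y is a version of P(A | G) *)
Definition conditional_probability (R : realType) (d : measure_display)
    (Omega : measurableType d) (P : probability Omega R)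
    (G : set (set Omega)) (A : set Omega) (Y : Omega -> \bar R) : Prop :=
  (forall C : set (\bar R), measurable C -> G (Y @^-1` C)) /\
  (forall F, G F -> P (A `&` F) = \int[P]_(w in F) Y w).

Definition markov_process (R : realType) (d : measure_display)
    (Omega : measurableType d) (P : probability Omega R)
    (Q : R -> R.-pker (measurableTypeR R) ~> (measurableTypeR R))
    (G : R -> set (set Omega)) (X : R -> Omega -> R) : Prop :=
  [/\ filtration G,
      forall (t : R) (B : set (measurableTypeR R)), (0 <= t)%R -> measurable B ->
        G t (X t @^-1` B) &
      forall (s t : R) (B : set (measurableTypeR R)),
        (0 <= s)%R -> (0 <= t)%R -> measurable B ->
        conditional_probability P (G s) (X (s + t)%R @^-1` B)
          (fun w => Q t (X s w) B)].

(* {(X_t, G_t) : t >= 0} is a CB-process, for Q the transition semigroup of the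
   branching mechanism (see [CB_semigroup]). *)
Definition CB_process (R : realType) (d : measure_display)
    (Omega : measurableType d) (P : probability Omega R)
    (Q : R -> R.-pker (measurableTypeR R) ~> (measurableTypeR R))
    (G : R -> set (set Omega)) (X : R -> Omega -> R) : Prop :=
  (forall (t : R) (w : Omega), (0 <= t)%R -> (0 <= X t w)%R) /\
  markov_process P Q G X.

(* The usual augmentation of a sub-sigma-algebra by the P-null events.  It is
   needed for adaptedness: the immigration process at time t is determined by
   [immigration_filtration] only outside the null event that some atom (s, w)
   has a path w that jumps at time t - s. *)
Definition augmentation (R : realType) (d : measure_display)
    (Omega : measurableType d) (P : probability Omega R)
    (G : set (set Omega)) : set (set Omega) :=
  <<s G `|` [set A | measurable A /\ P A = 0] >>.

Definition cadlag (R : realType) (w : R -> R) : Prop :=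
  (forall t : R, (0 <= t)%R -> w s @[s --> t^'+] --> w t) /\
  (forall t : R, (0 < t)%R -> cvg (w s @[s --> t^'-])).

(* A path on [0, oo) is extended by 0 to the negative half-line, so that
   distinct elements of [cadlag_path R] are distinct paths. *)
Record cadlag_path (R : realType) := Path {
  path_fun :> R -> R ;
  path_ge0 : forall t : R, (0 <= path_fun t)%R ;
  path_neg : forall t : R, (t < 0)%R -> path_fun t = 0%R ;
  path_cadlag : cadlag path_fun }.

Definition coordinate (R : realType) (t : R) (w : cadlag_path R) : R := w t.

Lemma cadlag0 (R : realType) : cadlag (fun=> 0%R : R).
Proof.
by split=> t _; [exact: cvg_cst|apply/cvg_ex; exists 0%R; exact: cvg_cst].
Qed.

Definition path0 (R : realType) : cadlag_path R :=
  @Path R (fun=> 0%R) (fun=> lexx 0%R) (fun _ _ => erefl) (@cadlag0 R).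

HB.instance Definition _ (R : realType) := gen_eqMixin (cadlag_path R).
HB.instance Definition _ (R : realType) := gen_choiceMixin (cadlag_path R).
HB.instance Definition _ (R : realType) :=
  isPointed.Build (cadlag_path R) (@path0 R).

(* sigma({w(s) : s in I}) *)
Definition path_algebra (R : realType) (I : set R)
    : set (set (cadlag_path R)) :=
  <<s \bigcup_(s in I)
        preimage_set_system [set: cadlag_path R] (coordinate s)
          (@measurable _ (measurableTypeR R)) >>.

Definition path_display : measure_display.
Proof. by constructor. Qed.

HB.instance Definition _ (R : realType) :=
  @isMeasurable.Build path_display (cadlag_path R)
    (path_algebra `[0%R, +oo[%classic)
    (@sigma_algebra0 _ setT _) (@sigma_algebraC _ _)
    (@sigma_algebra_bigcup _ setT _).

Definition path_filtration (R : realType) (t : R)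
    : set (set (cadlag_path R)) :=
  path_algebra `[0%R, t]%classic.

(* P is the law on path space of the CB-process started from x. *)
Definition CB_law (R : realType)
    (Q : R -> R.-pker (measurableTypeR R) ~> (measurableTypeR R))
    (x : R) (P : probability (cadlag_path R) R) : Prop :=
  CB_process P Q (@path_filtration R) (@coordinate R) /\
  P [set w | coordinate 0%R w = x] = 1.

(* N_m(dw) = \int m(dx) Q_x(dw), for [Qx x] the law Q_x *)
Definition path_mixture (R : realType)
    (m : {measure set (measurableTypeR R) -> \bar R})
    (Qx : R -> probability (cadlag_path R) R) (A : set (cadlag_path R))
    : \bar R :=
  \int[m]_(x in `]0%R, +oo[) Qx x A.

(* z e^{-delta s} ds N(dw), evaluated by slicing at fixed s *)
Definition immigration_intensity (R : realType) (z delta : R)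
    (N : set (cadlag_path R) -> \bar R)
    (B : set (measurableTypeR R * cadlag_path R)) : \bar R :=
  \int[@lebesgue_measure R]_(s in `]0%R, +oo[)
    ((z * expR (- (delta * s)))%:E * N (xsection B s)).

(* A countable (possibly finite) sum of Dirac masses at points of S. *)
Definition point_measure (R : realType) (d : measure_display)
    (E : measurableType d) (S : set E) (mu : set E -> \bar R) : Prop :=
  exists (I : set nat) (p : nat -> E),
    (forall i, I i -> S (p i)) /\
    forall B, measurable B -> mu B = \esum_(i in I) \d_(p i) B.

(* N is a Poisson random measure on S with intensity mu, defined on the
   probability space (Omega, P).  As a kernel, N is a measurable family of
   measures.  The second argument of the library's [poisson_prob] is unused. *)
Definition poisson_random_measure (R : realType) (d d' : measure_display)
    (Omega : measurableType d) (P : probability Omega R)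
    (E : measurableType d') (S : set E) (mu : set E -> \bar R)
    (N : R.-ker Omega ~> E) : Prop :=
  [/\ forall w, point_measure S (N w),
      forall B, measurable B -> B `<=` S -> mu B < +oo ->
        forall k : nat,
          P [set w | N w B = k%:R%:E] = poisson_prob (fine (mu B)) 0 [set k],
      forall B, measurable B -> B `<=` S -> mu B = +oo ->
        P [set w | N w B = +oo] = 1 &
      forall (n : nat) (B : 'I_n -> set E) (C : 'I_n -> set (\bar R)),
        (forall i, measurable (B i) /\ B i `<=` S) ->
        trivIset [set: 'I_n] B ->
        (forall i, measurable (C i)) ->
        P (\bigcap_(i in [set: 'I_n]) [set w | C i (N w (B i))])
        = \prod_(i < n) P [set w | C i (N w (B i))]].

(* X_t^z; the integral may be infinite on a null event *)
Definition immigration_process (R : realType) (d : measure_display)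
    (Omega : measurableType d) (z delta : R)
    (N : R.-ker Omega ~> (measurableTypeR R * cadlag_path R)%type)
    (t : R) (w : Omega) : \bar R :=
  (z * expR (- (delta * t)))%:E
  + \int[N w]_(p in `]0%R, t]%classic `*` [set: cadlag_path R])
      (p.2 (t - p.1)%R)%:E.

(* G_t^z *)
Definition immigration_filtration (R : realType) (d : measure_display)
    (Omega : measurableType d)
    (N : R.-ker Omega ~> (measurableTypeR R * cadlag_path R)%type)
    (t : R) : set (set Omega) :=
  <<s [set F | exists (u : R) (A : set (cadlag_path R)) (C : set (\bar R)),
         [/\ (0 <= u <= t)%R, path_filtration (t - u)%R A, measurable C &
             F = (fun w => N w (`]0%R, u]%classic `*` A)) @^-1` C ] ] >>.

(* Main.v *)
(** The Laplace functional of [N] reduces everything to integrals over immigration times.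
    As [phi'(oo)] is finite, [c = 0] and [phi l = delta l - Psi l], where
    [Psi l = \int (1 - e^(-l u)) m(du)] is Lipschitz.  For [A_i] in [path_filtration (s - u_i)],
    the expectation of [\prod_i e^(- N((0, u_i] x A_i)) e^(- l X_(s+t))] is the exponential of
    an integral over the immigration time [r].  For [r <= s] the Markov property of [Q_x]
    replaces [(s + t, l)] by [(s, v_t(l))]; the times [r] in [(s, s + t]] contribute
    [\int z e^(-delta r) Psi(v_(s+t-r)(l)) dr = z e^(-delta s) v_t(l) - z e^(-delta (s+t)) l],
    because [e^(-delta r) v_(s+t-r)(l)] has derivative [- e^(-delta r) Psi(v_(s+t-r)(l))] in [r].
    Hence [e^(- l X_(s+t))] may be replaced by [e^(- v_t(l) X_s)] against such products, and so
    on the sigma-algebra that the counts generate; this is the Markov property.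

    For adaptedness up to null events, the path of every atom [(r, w)] is sampled, in place of
    [t - r], at the first point of a grid to the left of [t - r].  The resulting sum [Y] is
    measurable for the filtration at time [t], and since [v] is Lipschitz the same Laplace
    functionals bound [E (e^(-Y) - e^(-X))^2] by a multiple of the mesh, [X] being the sum of
    the masses [w (t - r)]. *)

From HB Require Import structures.
From mathcomp Require Import all_boot all_order all_algebra.
From mathcomp Require Import all_classical all_reals all_analysis.
From mathcomp Require Import measurable_realfun ring lra.
Require Import Defs.

Set Implicit Arguments.
Unset Strict Implicit.
Unset Printing Implicit Defensive.

Import Order.TTheory GRing.Theory Num.Def Num.Theory.
Import numFieldNormedType.Exports.

Local Open Scope classical_set_scope.
Local Open Scope ring_scope.
Local Open Scope ereal_scope.

(** * Mixtures of measures and uniqueness by moments *)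

(** At time [t] a clan that entered during [(a, u]] is visible up to age [t - u] only, strictly
    before the age [t - r] that [X_t] reads unless [r = u]. Adaptedness can therefore only come from
    left limits, whence a limit argument and a null event. The mesh is halved at each step so that
    the squared errors are summable and the samples converge almost surely. Uniqueness of measures
    is used twice, on [Omega] with the functions [e^-N((0, u] x A)] and on the half-line with
    [e^-y]. Both are instances of one statement about functions into [[0, 1]], so only natural
    numbers [l] enter the final identification of the transition law. As [X_t] may be infinite on a
    null event, Laplace transforms are taken of the extended process, where [e^-oo = 0] keeps every
    formula valid; the real-valued version appears at the end. Finiteness itself comes from letting
    [l] tend to 0. *)

Section probability_lemmas.
Context d (T : measurableType d) (R : realType) (P : probability T R).

Lemma probability_compl_null (A : set T) : measurable A -> P A = 1 -> P (~` A) = 0.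
Proof. by move=> mA PA; rewrite (probability_setC P mA) PA subee. Qed.

Lemma integral_cst_probability (k : \bar R) : \int[P]__ k = k.
Proof.
transitivity (k * P setT); first exact: integral_cst.
by rewrite (probability_setT P) mule1.
Qed.

Lemma le1_integrable (f : T -> R) : measurable_fun setT f ->
  (forall x, 0 <= f x <= 1)%R -> P.-integrable setT (EFin \o f).
Proof.
move=> mf f01; apply: measurable_bounded_integrable => //.
  exact: (le_lt_trans (probability_le1 P measurableT) (ltry _)).
exists 1%R; split => // M M1 x _ /=; have /andP[? ?] := f01 x.
by rewrite ger0_norm// (le_trans _ (ltW M1)).
Qed.

End probability_lemmas.

Section nonneg_measurable_induction.
Context d (T : measurableType d) (R : realType).
Import HBNNSimple.

(** Stated for an abstract measurable type so that it also serves sub-sigma-algebras: with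
    [g_sigma_algebraType] in place of [T], the induction runs over the functions measurable at a
    given time of a filtration. *)
Lemma ge0_measurable_ind (K : (T -> \bar R) -> Prop) :
  (forall A, measurable A -> K (fun x => (\1_A x)%:E)) ->
  (forall (k : R) (f : T -> \bar R), (0 <= k)%R -> measurable_fun setT f -> (forall x, 0 <= f x) ->
     K f -> K (fun x => k%:E * f x)) ->
  (forall f g : T -> \bar R, measurable_fun setT f -> (forall x, 0 <= f x) ->
     measurable_fun setT g -> (forall x, 0 <= g x) ->
     K f -> K g -> K (fun x => f x + g x)) ->
  (forall f : (T -> \bar R)^nat, (forall n, measurable_fun setT (f n)) ->
     (forall n x, 0 <= f n x) -> (forall x, nondecreasing_seq (f ^~ x)) ->
     (forall n, K (f n)) -> K (fun x => limn (f ^~ x))) ->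
  forall f, measurable_fun setT f -> (forall x, 0 <= f x) -> K f.
Proof.
move=> K1 KZ KD Klim f mf f0.
pose g := nnsfun_approx measurableT mf.
have -> : f = (fun x => limn (fun n => (g n x)%:E)).
  by apply/funext => x; apply/esym/cvg_lim => //; exact: cvg_nnsfun_approx.
apply: (Klim (fun n x => (g n x)%:E)).
- by move=> n; exact/measurable_EFinP.
- by move=> n x; rewrite lee_fin.
- by move=> x a b ab; rewrite lee_fin; exact/lefP/nd_nnsfun_approx.
move=> n; have mpre (r : R) : measurable (g n @^-1` [set r]) by [].
pose h (r : R) x : \bar R := (r * \1_(g n @^-1` [set r]) x)%:E.
pose S : seq R := finmap.enum_fset (fset_set (range (g n))).
have -> : (fun x => (g n x)%:E) =
    (fun x => \sum_(r <- S) h r x).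
  apply/funext => x; rewrite fimfunE -fsumEFin//.
  by rewrite fsbig_finite.
have : forall r, r \in S -> (0 <= r)%R.
  move=> r; rewrite in_fset_set// inE => -[x _ <-]; exact: fun_ge0.
elim: S => [|r s IH] rs0.
  (* The empty sum is presented as a multiple of an indicator, since [K] is given outright on
     indicators only. *)
  have -> : (fun x : T => \sum_(r <- [::]) h r x) =
      (fun x : T => 0%:E * (\1_(set0 : set T) x)%:E).
    by apply/funext => x; rewrite big_nil mul0e.
  apply: KZ; [by []|exact/measurable_EFinP/measurable_indic| |exact: K1].
  by move=> x; rewrite lee_fin.
have r0 : (0 <= r)%R by apply: rs0; rewrite inE eqxx.
have s0 : forall r, r \in s -> (0 <= r)%R.
  by move=> q qs; apply: rs0; rewrite inE qs orbT.
have -> : (fun x : T => \sum_(r <- r :: s) h r x) =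
    (fun x : T => r%:E * (\1_(g n @^-1` [set r]) x)%:E + \sum_(r <- s) h r x).
  by apply/funext => x; rewrite big_cons /h EFinM.
apply: KD.
- by apply: measurable_funeM; exact/measurable_EFinP/measurable_indic.
- by move=> x; rewrite mule_ge0// lee_fin.
- apply: emeasurable_sum => q; apply/measurable_EFinP/measurable_funM => //.
- move=> x; rewrite big_seq; apply: sume_ge0 => q qs; rewrite lee_fin mulr_ge0//.
  exact: s0.
- apply: KZ; [by []|exact/measurable_EFinP/measurable_indic| |exact: K1].
  by move=> x; rewrite lee_fin.
- exact: IH.
Qed.

End nonneg_measurable_induction.

Section mixture.
Context d d' (T : measurableType d) (T' : measurableType d') (R : realType).
Variables (mu : {measure set T -> \bar R}) (D : set T) (mD : measurable D).
Variable k : T -> {measure set T' -> \bar R}.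
Hypothesis mk : forall A, measurable A -> measurable_fun D (fun x => k x A).

Definition mixture (A : set T') := \int[mu]_(x in D) k x A.

Let mixture0 : mixture set0 = 0.
Proof. by rewrite /mixture integral0_eq// => x _; rewrite measure0. Qed.

Let mixture_ge0 A : 0 <= mixture A.
Proof. by apply: integral_ge0 => x _; exact: measure_ge0. Qed.

Let mixture_sigma_additive : semi_sigma_additive mixture.
Proof.
move=> F mF tF mUF; rewrite [X in _ --> X](_ : _ =
    \sum_(n <oo) \int[mu]_(x in D) k x (F n)); last first.
  rewrite -integral_nneseries//; last by move=> n; exact: mk.
  apply: eq_integral => x _.
  by apply/esym/cvg_lim => //; exact: measure_semi_sigma_additive.
apply: is_cvg_nneseries => n _ _; exact: mixture_ge0.
Qed.

HB.instance Definition _ := isMeasure.Build _ _ _ mixture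
  mixture0 mixture_ge0 mixture_sigma_additive.

(** The auxiliary measures below (laws of a process on an event, measures with a density, the path
    measure, the intensity) are all mixtures. Measurability of each [k x A] on [D] suffices, so
    families not packaged as kernels are covered; the existential form leaves just the integration
    formula. *)
Lemma mixture_exists : exists nu : {measure set T' -> \bar R},
  [/\ (forall A, nu A = \int[mu]_(x in D) k x A),
      (forall f, measurable_fun setT f -> (forall y, 0 <= f y) ->
        measurable_fun D (fun x => \int[k x]_y f y)) &
      (forall f, measurable_fun setT f -> (forall y, 0 <= f y) ->
        \int[nu]_y f y = \int[mu]_(x in D) \int[k x]_y f y)].
Proof.
exists mixture.
suff H : forall f : T' -> \bar R, measurable_fun setT f -> (forall y, 0 <= f y) ->
    measurable_fun D (fun x => \int[k x]_y f y) /\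
    \int[mixture]_y f y = \int[mu]_(x in D) \int[k x]_y f y.
  by split => // f mf f0; have [] := H f mf f0.
apply: ge0_measurable_ind.
- move=> A mA; split.
    apply: (eq_measurable_fun (fun x => k x A)); last exact: mk.
    by move=> x _; rewrite integral_indic// setIT.
  rewrite integral_indic// setIT; apply: eq_integral => x _.
  by rewrite integral_indic// setIT.
- move=> r f r0 mf f0 [mI eI]; split.
    apply: (eq_measurable_fun (fun x => r%:E * \int[k x]_y f y)).
      by move=> x _; rewrite ge0_integralZl_EFin.
    exact: measurable_funeM.
  transitivity (r%:E * \int[mu]_(x in D) \int[k x]_y f y).
    by rewrite ge0_integralZl_EFin// eI.
  rewrite -(@ge0_integralZl_EFin _ _ _ mu D mD (fun x => \int[k x]_y f y))//.
    by apply: eq_integral => x _; rewrite ge0_integralZl_EFin.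
  by move=> x _; exact: integral_ge0.
- move=> f g mf f0 mg g0 [mIf eIf] [mIg eIg]; split.
    apply: (eq_measurable_fun (fun x => \int[k x]_y f y + \int[k x]_y g y)).
      by move=> x _; rewrite ge0_integralD.
    exact: emeasurable_funD.
  transitivity (\int[mu]_(x in D) \int[k x]_y f y +
                \int[mu]_(x in D) \int[k x]_y g y).
    by rewrite ge0_integralD// eIf eIg.
  rewrite -(@ge0_integralD _ _ _ mu D mD (fun x => \int[k x]_y f y)
    (fun x => \int[k x]_y g y))//.
  + by apply: eq_integral => x _; rewrite ge0_integralD.
  + by move=> x _; exact: integral_ge0.
  + by move=> x _; exact: integral_ge0.
- move=> f mf f0 ndf If.
  have E (x : T) : \int[k x]_y limn (f ^~ y) = limn (fun n => \int[k x]_y f n y).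
    by rewrite monotone_convergence.
  have nd x : nondecreasing_seq (fun n => \int[k x]_y f n y).
    by move=> a b ab; apply: ge0_le_integral => // y _; exact: ndf.
  split.
    apply: (emeasurable_fun_cvg (fun n x => \int[k x]_y f n y)).
      by move=> n; have [] := If n.
    by move=> x _; rewrite E; exact: ereal_nondecreasing_is_cvgn.
  rewrite monotone_convergence//; under eq_fun do rewrite (If _).2.
  rewrite -monotone_convergence//.
  + by apply: eq_integral => x _; rewrite E.
  + by move=> n; have [] := If n.
  + by move=> n x _; exact: integral_ge0.
Qed.

End mixture.

(** With [q = e^-c] and [p = e^-(c/2)], [q^n = p^n p^n], and [1 + x <= e^x] at [x = n c / 2] gives
    [n p^n <= 2 / c]; one geometric factor [p^n] remains. *)
Lemma cvg_natmul_expr (R : realType) (q : R) : (0 <= q < 1)%R ->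
  (n%:R * q ^+ n)%R @[n --> \oo] --> 0%R.
Proof.
move=> /andP[q0 q1]; have [->|qn0] := eqVneq q 0%R.
  apply/cvgrPdist_le => e e0; near=> n; rewrite sub0r normrN.
  have n0 : (0 < n)%N by near: n; exact: nbhs_infty_gt.
  by rewrite expr0n gtn_eqF// mulr0 normr0 ltW.
have {qn0}q0 : (0 < q)%R by rewrite lt_neqAle eq_sym qn0.
pose c : R := (- ln q)%R; have c0 : (0 < c)%R by rewrite oppr_gt0 ln_lt0// q0.
have qE : q = expR (- c) by rewrite opprK lnK.
pose p := expR (- (c / 2)) : R.
have p1 : (`|p| < 1)%R.
  by rewrite ger0_norm ?expR_ge0// expR_lt1 oppr_lt0 divr_gt0.
apply: (@squeeze_cvgr _ _ _ _ (fun=> 0%R) (geometric (2 / c)%R p)).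
- near=> n; rewrite mulr_ge0//=; last by rewrite exprn_ge0// ltW.
  have -> : q = (p * p)%R by rewrite qE -expRD; congr expR; field.
  rewrite exprMn mulrA ler_wpM2r ?exprn_ge0 ?expR_ge0//.
  rewrite /p -expRM_natl mulrN expRN -[leRHS]mulr1 ler_pdivrMr ?expR_gt0// mulr1.
  have := @expR_ge1Dx R (n%:R * (c / 2))%R.
  set E := expR _ => h; rewrite -(ler_pM2l c0).
  have -> : (c * (2 / c * E) = 2 * E)%R by field; rewrite gt_eqF.
  lra.
- exact: cvg_cst.
- exact: cvg_geometric.
Unshelve. all: by end_near. Qed.

(* The polynomials [(1 - y^n)^N] with [N = n a^-n + O(1)] have a threshold at [a]:
   [N y^n] tends to [0] or to infinity according as [y < a] or [y >= a]. *)
Definition threshold_exponent (R : realType) (a : R) (n : nat) : nat :=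
  (truncn (n%:R * a ^- n)%R).+1.

Lemma bernoulli_ineq (R : realType) (x : R) (n : nat) :
  (0 <= x <= 1)%R -> (1 - n%:R * x <= (1 - x) ^+ n)%R.
Proof.
move=> /andP[x0 x1]; elim: n => [|n IH]; first by rewrite mul0r subr0 expr0.
rewrite exprSr; apply: (@le_trans _ _ ((1 - n%:R * x) * (1 - x))%R).
  have : (0 <= n%:R * x * x)%R by rewrite !mulr_ge0.
  rewrite -natr1; nra.
by rewrite ler_wpM2r// subr_ge0.
Qed.

(** Let [N] be the exponent. Below [a], Bernoulli's inequality leaves an error of at most
    [N y^n <= n (y / a)^n + y^n]. At or above [a], [1 - y^n <= e^(- y^n)] and [N >= n a^-n] bound
    the power by [e^-n]; hence the strict inequality in the limit. *)
Lemma threshold_cvg (R : realType) (a y : R) : (0 < a <= 1)%R -> (0 <= y <= 1)%R ->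
  ((1 - y ^+ n) ^+ threshold_exponent a n)%R @[n --> \oo] --> ((y < a)%R%:R : R).
Proof.
move=> /andP[a0 a1] /andP[y0 y1].
have yn n : (0 <= y ^+ n <= 1)%R by rewrite exprn_ge0// exprn_ile1.
have f01 n : (0 <= (1 - y ^+ n) ^+ threshold_exponent a n <= 1)%R.
  have /andP[? ?] := yn n.
  by rewrite exprn_ge0 ?subr_ge0// exprn_ile1 ?subr_ge0// lerBlDr lerDl.
have an n : (0 < a ^+ n)%R by rewrite exprn_gt0.
case: ltP => ya.
  pose q := (y / a)%R.
  have q01 : (0 <= q < 1)%R by rewrite divr_ge0 ?(ltW a0)//= ltr_pdivrMr// mul1r.
  apply: (@squeeze_cvgr _ _ _ _ (fun n => 1 - (n%:R * q ^+ n + y ^+ n))%R (fun=> 1%R)).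
  - near=> n; have /andP[_ ->] := f01 n; rewrite andbT.
    apply: le_trans (bernoulli_ineq _ (yn n)); rewrite lerD2l lerN2.
    have -> : (n%:R * q ^+ n + y ^+ n = (n%:R * a ^- n + 1) * y ^+ n :> R)%R.
      by rewrite expr_div_n mulrDl mul1r mulrA mulrAC.
    rewrite ler_wpM2r//; first by have /andP[] := yn n.
    rewrite /threshold_exponent -natr1 lerD2r truncn_le.
    by rewrite mulr_ge0// invr_ge0 ltW.
  - rewrite -[X in _ --> X]subr0 -[X in (_ - X)%R]addr0.
    apply: cvgB; first exact: cvg_cst.
    apply: cvgD; first exact: cvg_natmul_expr.
    by apply: cvg_expr; rewrite ger0_norm// (lt_le_trans ya).
  - exact: cvg_cst.
apply: (@squeeze_cvgr _ _ _ _ (fun=> 0%R) (fun n => expR (- n%:R))).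
- near=> n; have /andP[-> _] := f01 n => /=.
  have /andP[yn0 yn1] := yn n.
  apply: (@le_trans _ _ (expR (- y ^+ n) ^+ threshold_exponent a n)%R).
    by rewrite lerXn2r ?nnegrE ?subr_ge0 ?expR_ge0// expR_ge1Dx.
  rewrite -expRM_natl ler_expR mulrN lerN2.
  apply: (@le_trans _ _ (n%:R * a ^- n * a ^+ n)%R).
    by rewrite mulfVK// gt_eqF.
  apply: ler_pM => //; first by rewrite mulr_ge0// invr_ge0 ltW.
  - exact: ltW.
  - exact/ltW/truncnS_gt.
  - by rewrite lerXn2r ?nnegrE// ltW.
- exact: cvg_cst.
- exact: cvgn_expR.
Unshelve. all: by end_near. Qed.

(** * Uniqueness of finite measures from the moments of functions into [0, 1] *)

Section moment_uniqueness.
Context d (T : measurableType d) (R : realType).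
Variables (mu nu : {measure set T -> \bar R}).
Hypotheses (mu_fin : mu setT < +oo) (nu_fin : nu setT < +oo).
Variables (I : Type) (h : I -> T -> R).
Hypothesis mh : forall i, measurable_fun setT (h i).
Hypothesis h01 : forall i x, (0 <= h i x <= 1)%R.

Let H (l : seq I) x : R := (\prod_(i <- l) h i x)%R.

Let H01 l x : (0 <= H l x <= 1)%R.
Proof.
rewrite /H; apply/andP; split.
  by apply: prodr_ge0 => i _; have /andP[] := h01 i x.
by apply: numdomain.Num.Theory.prodr_ile1 => i _; exact: h01.
Qed.

Let mH l : measurable_fun setT (H l).
Proof.
rewrite /H; elim: l => [|i l IH].
  by under eq_fun do rewrite big_nil; exact: measurable_cst.
by under eq_fun do rewrite big_cons; exact: measurable_funM.
Qed.

(** All moments over [F] are compared, not only the mass of [F], so that the property survives a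
    further intersection with a set [{h i < a}]. *)
Let same F := measurable F /\ forall l,
  \int[mu]_(x in F) (H l x)%:E = \int[nu]_(x in F) (H l x)%:E.

Let bounded_integrable (m : {measure set T -> \bar R}) F (f : T -> R) :
  m setT < +oo -> measurable F -> measurable_fun setT f ->
  (forall x, `|f x| <= 1)%R -> m.-integrable F (EFin \o f).
Proof.
move=> mfin mF mf f1; apply: measurable_bounded_integrable => //.
- by apply: le_lt_trans mfin; apply: le_measure => //; rewrite inE.
- exact: measurable_funTS.
- exists 1%R; split => // M M1 x _ /=; exact: le_trans (f1 x) (ltW M1).
Qed.

(** Multiplying by [h i ^+ k] prepends [k] copies of [i] to the list, so a polynomial in [h i] times
    a product is a combination of products. *)
Let same_poly F l i (p : {poly R}) : same F ->
  \int[mu]_(x in F) (p.[h i x] * H l x)%:E = \int[nu]_(x in F) (p.[h i x] * H l x)%:E.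
Proof.
move=> [mF sF].
have E (m : {measure set T -> \bar R}) : m setT < +oo ->
    \int[m]_(x in F) (p.[h i x] * H l x)%:E =
    \sum_(k < size p) (p`_k)%:E * \int[m]_(x in F) (H (nseq k i ++ l) x)%:E.
  move=> mfin; have intH l' : m.-integrable F (EFin \o H l').
    apply: bounded_integrable => // x; have /andP[? ?] := H01 l' x.
    by rewrite ger0_norm.
  under eq_integral => x _.
    rewrite horner_coef mulr_suml -sumEFin.
    under eq_bigr => k _.
      rewrite (_ : (p`_k * h i x ^+ k * H l x)%R = (p`_k * H (nseq k i ++ l) x)%R).
        rewrite EFinM; over.
      rewrite /H big_cat/= -mulrA; congr (_ * (_ * _))%R.
      by rewrite big_nseq -Monoid.iteropE.
    over.
  rewrite /= integral_sum//.
    by apply: eq_bigr => k _; rewrite integralZl//; exact: intH.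
  by move=> k; apply: integrableZl => //; exact: intH.
by rewrite !E//; apply: eq_bigr => k _; rewrite sF.
Qed.

(** The indicator of [{h i < a}] is the bounded pointwise limit of the polynomials of
    [threshold_cvg] evaluated at [h i]; for [a <= 0] the set is empty and for [a > 1] it is
    everything. *)
Let same_lt F i (a : R) : same F -> same (F `&` [set x | h i x < a]%R).
Proof.
move=> sF; have [mF eF] := sF.
have mlt : measurable [set x | h i x < a]%R.
  rewrite (_ : mkset _ = h i @^-1` `]-oo, a[); last first.
    by apply/seteqP; split => x /=; rewrite in_itv.
  by rewrite -[X in measurable X]setTI; exact: mh.
split; first exact: measurableI.
move=> l; have [a0|a0] := leP a 0%R.
  rewrite (_ : [set x | _] = set0) ?setI0 ?integral_set0//.
  rewrite -subset0 => x /=; have /andP[h0 _] := h01 i x.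
  by move=> /lt_le_trans /(_ a0); rewrite ltNge h0.
have [a1|a1] := ltP 1%R a.
  rewrite (_ : [set x | _] = setT) ?setIT//.
  rewrite -subTset => x _ /=; have /andP[_ h1] := h01 i x; exact: le_lt_trans a1.
pose p n : {poly R} := ((1 - 'X^n) ^+ threshold_exponent a n)%R.
have pE n x : ((p n).[h i x] = (1 - h i x ^+ n) ^+ threshold_exponent a n)%R.
  by rewrite /p !hornerE.
suff C (m : {measure set T -> \bar R}) : m setT < +oo ->
    \int[m]_(x in F) ((p n).[h i x] * H l x)%:E @[n --> \oo] -->
    \int[m]_(x in F `&` [set x | h i x < a]%R) (H l x)%:E.
  apply: (cvg_unique _ (C mu mu_fin)) => //.
  by have := C nu nu_fin; under eq_fun do rewrite -same_poly//.
move=> mfin; rewrite integral_mkcondr.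
have p01 n x : (0 <= (p n).[h i x] <= 1)%R.
  have /andP[? ?] := h01 i x.
  by rewrite pE exprn_ge0 ?exprn_ile1 ?subr_ge0 ?exprn_ile1// lerBlDr lerDl exprn_ge0.
have mp n : measurable_fun setT (fun x => (p n).[h i x] * H l x)%R.
  apply: measurable_funM => //; under eq_fun do rewrite pE.
  by apply: measurable_funX; apply: measurable_funB => //; exact: measurable_funX.
have [] // := @dominated_convergence _ _ _ m F mF
  (fun n x => ((p n).[h i x] * H l x)%:E)
  ((fun x => (H l x)%:E) \_ [set x | h i x < a]%R) (cst 1).
- by move=> n; apply/measurable_EFinP; exact: measurable_funTS.
- apply/measurable_funTS/(measurable_restrictT _ _).1 => //.
  exact/measurable_EFinP/measurable_funTS.
- apply: aeW => x Fx; rewrite patchE.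
  have -> : (if x \in [set x | (h i x < a)%R] then (H l x)%:E else 0) =
      ((h i x < a)%R%:R * H l x)%:E.
    case: ltP => xa; first by rewrite mem_set// mul1r.
    by rewrite memNset ?mul0r//= ltNge xa.
  apply: cvg_EFin; first exact: nearW.
  apply: cvgMl; under eq_fun do rewrite /= pE.
  by apply: threshold_cvg => //; rewrite a0.
- by apply: (bounded_integrable (m := m) (f := cst 1%R)) => // x; rewrite normr1.
- apply: aeW => x n Fx; have /andP[? ?] := p01 n x; have /andP[? ?] := H01 l x.
  by rewrite gee0_abs ?lee_fin ?mulr_ge0// mulr_ile1.
Qed.

Let G := [set F | exists l : seq (I * R), F = \big[setI/setT]_(i <- l) [set x | h i.1 x < i.2]%R].

Let G_same F : G F -> (forall l, \int[mu]_x (H l x)%:E = \int[nu]_x (H l x)%:E) -> same F.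
Proof.
move=> [l ->] E; elim: l => [|[i a] l IH]; first by rewrite big_nil.
by rewrite big_cons setIC; exact: same_lt.
Qed.

(** The sets cut out by finitely many inequalities [h i < a] form a pi-system generating the
    sigma-algebra of the [h i], and the empty product recovers their masses. Lists may repeat
    indices; with a single function this is the uniqueness part of the Hausdorff moment problem. *)
Lemma moment_unique :
  (forall l : seq I, \int[mu]_x (\prod_(i <- l) h i x)%:E =
                     \int[nu]_x (\prod_(i <- l) h i x)%:E) ->
  forall A, <<s [set B | exists i (C : set R), measurable C /\ B = h i @^-1` C] >> A ->
  mu A = nu A.
Proof.
move=> E.
have Gs F : G F -> same F by move=> GF; exact: G_same.
have eqG F : <<s G >> F -> mu F = nu F.
  apply: (@g_sigma_algebra_measure_unique _ _ _ G _ (fun=> setT)) => //.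
  - by move=> F' /Gs[].
  - by move=> _; exists [::]; rewrite big_nil.
  - by rewrite -subTset => x _; exists 0%N.
  - by move=> _ _ [l1 ->] [l2 ->]; exists (l1 ++ l2); rewrite big_cat.
  - move=> F' /Gs[mF' /(_ [::])]; rewrite /H.
    under eq_integral do rewrite big_nil.
    under [RHS]eq_integral do rewrite big_nil.
    by rewrite !integral_cst// !mul1e.
move=> A sA; apply: eqG; apply: smallest_sub sA; first exact: smallest_sigma_algebra.
move=> _ [i [C [mC ->]]].
pose GT := g_sigma_algebraType G.
suff : measurable_fun setT (h i : GT -> R).
  by move=> /(_ measurableT C mC); rewrite setTI.
apply: (measurability _ (RGenInftyO.measurableE R)) => _ [_ [a ->] <-].
apply: sub_sigma_algebra; exists [:: (i, a)]; rewrite big_seq1 setTI.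
by apply/seteqP; split => x /=; rewrite in_itv.
Qed.

End moment_uniqueness.

(** * Poisson random measures *)

(* [expN y = e^-y] on [0, +oo], with [e^-oo = 0]; the absolute value keeps it
   bounded by 1 everywhere. *)
Definition expN (R : realType) (y : \bar R) : R :=
  if `|y| == +oo then 0%R else expR (- fine `|y|).

Section expN.
Context (R : realType).
Implicit Types x y : \bar R.

Lemma expN_EFin (r : R) : (0 <= r)%R -> expN r%:E = expR (- r).
Proof. by move=> r0; rewrite /expN /= ger0_norm. Qed.

Lemma expNy : expN (+oo : \bar R) = 0%R.
Proof. by rewrite /expN. Qed.

Lemma expN0 : expN (0 : \bar R) = 1%R.
Proof. by rewrite expN_EFin// oppr0 expR0. Qed.

Lemma expN_ge0 y : (0 <= expN y)%R.
Proof. by rewrite /expN; case: ifP => // _; exact: expR_ge0. Qed.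

Lemma expN_le1 y : (expN y <= 1)%R.
Proof. by rewrite /expN; case: ifP => // _; rewrite expR_le1 oppr_le0 fine_ge0. Qed.

Lemma expN01 y : (0 <= expN y <= 1)%R.
Proof. by rewrite expN_ge0 expN_le1. Qed.

Lemma expND x y : 0 <= x -> 0 <= y -> expN (x + y) = (expN x * expN y)%R.
Proof.
case: x => [r| |]//; case: y => [s| |]//= r0 s0; rewrite ?expNy ?mulr0 ?mul0r//.
rewrite !lee_fin in r0 s0; rewrite -EFinD !expN_EFin ?addr_ge0//.
by rewrite opprD expRD.
Qed.

Lemma expN_sum (I : Type) (s : seq I) (f : I -> \bar R) : (forall i, 0 <= f i) ->
  expN (\sum_(i <- s) f i) = (\prod_(i <- s) expN (f i))%R.
Proof.
move=> f0; elim: s => [|i s IH]; first by rewrite !big_nil expN0.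
by rewrite !big_cons expND ?IH// sume_ge0.
Qed.

Lemma expN_natmul (n : nat) x : 0 <= x -> expN (n%:R%:E * x) = (expN x ^+ n)%R.
Proof.
move=> x0; elim: n => [|n IH]; first by rewrite mul0e expN0.
by rewrite -natr1 EFinD ge0_muleDl// mul1e expND ?mule_ge0// IH exprSr.
Qed.

Lemma expN_nincr x y : 0 <= x -> x <= y -> (expN y <= expN x)%R.
Proof.
move=> x0 xy; case: y xy => [s| |]; last by case: x x0.
  case: x x0 => [r| |]// r0; rewrite lee_fin => rs; rewrite lee_fin in r0.
  by rewrite !expN_EFin ?(le_trans r0 rs)// ler_expR lerN2.
by rewrite expNy expN_ge0.
Qed.

Lemma expN_ge1B x : 0 <= x -> 1 - x <= (expN x)%:E.
Proof.
case: x => [r| |] r0; rewrite ?expNy ?leNye//.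
rewrite lee_fin in r0; rewrite expN_EFin// -EFinB lee_fin.
exact: expR_ge1Dx.
Qed.

Lemma measurable_expN : measurable_fun setT (@expN R).
Proof.
rewrite /expN; apply: measurable_fun_ifT => //.
  by apply: measurable_fun_eqe => //; exact: abse_measurable.
apply: measurableT_comp => //; apply: measurableT_comp => //.
by apply: measurableT_comp => //; exact: abse_measurable.
Qed.

Lemma expN_cvg (u : (\bar R)^nat) y : (forall n, 0 <= u n) -> u @ \oo --> y ->
  expN (u n) @[n --> \oo] --> expN y.
Proof.
move=> u0 uy; have y0 : 0 <= y.
  have <- : limn u = y by exact/cvg_lim.
  by apply: lime_ge; [apply/cvg_ex; exists y|exact: nearW].
case: y uy y0 => [r| |]// uy y0.
  have /fine_cvgP[fu fuy] := uy.
  have : (expR (- fine (u n)) @[n --> \oo] --> expR (- r))%R.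
    apply: (cvg_comp (fine \o u) (fun x : R => expR (- x)) fuy).
    by apply: continuous_comp; [exact: opp_continuous|exact: continuous_expR].
  rewrite expN_EFin//; apply: cvg_trans; apply: near_eq_cvg.
  near=> n; have fun_ : u n \is a fin_num by near: n.
  by rewrite -[in RHS](fineK fun_) expN_EFin// fine_ge0.
rewrite expNy; apply/cvgrPdist_le => e e0.
pose A := Num.max 0%R (- ln e)%R.
have A0 : (0 <= A)%R by rewrite le_max lexx.
have Ae : (expR (- A) <= e)%R.
  by rewrite -[leRHS]lnK ?posrE// ler_expR lerNl le_max lexx orbT.
have /cvgeyPge uA := uy; near=> n.
rewrite sub0r normrN ger0_norm ?expN_ge0//.
rewrite (le_trans _ Ae)// -expN_EFin// expN_nincr ?lee_fin//.
by near: n; exact: uA.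
Unshelve. all: by end_near. Qed.

End expN.

(** Inverse of [expN] on [[0, +oo]]: events of an extended variable can be recovered from its
    [expN]. *)
Definition lnN (R : realType) (y : R) : \bar R := if y == 0%R then +oo else (- ln y)%:E.

Lemma measurable_lnN (R : realType) : measurable_fun setT (@lnN R).
Proof.
apply: measurable_fun_ifT => //; first exact: measurable_fun_eqr.
by apply/measurable_EFinP; apply: measurableT_comp => //; exact: measurable_ln.
Qed.

Lemma expNK (R : realType) (y : \bar R) : 0 <= y -> lnN (expN y) = y.
Proof.
case: y => [y| |]// y0; rewrite /lnN ?expNy ?eqxx//.
by rewrite expN_EFin// gt_eqF ?expR_gt0// expRK opprK.
Qed.

(** [e^(-l Y)] vanishes where [Y] is infinite and is at most 1 elsewhere, hence
    [P (Y < oo) >= 1 - C l] for every [l > 0]. *)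
Lemma laplace_finite d (Omega : measurableType d) (R : realType) (P : probability Omega R)
    (Y : Omega -> \bar R) (C : R) : (0 <= C)%R ->
  measurable_fun setT Y ->
  (forall l, (0 < l)%R -> (1 - C * l)%:E <= \int[P]_w (expN (l%:E * Y w))%:E) ->
  P [set w | Y w < +oo] = 1.
Proof.
move=> C0 mY H; pose A := [set w | Y w < +oo].
have mA : measurable A.
  rewrite (_ : A = Y @^-1` (~` [set +oo])); last first.
    by apply/seteqP; split => w /=; rewrite /A /= ltey => /eqP.
  rewrite -[X in measurable X]setTI; apply: mY => //.
  exact/measurableC/emeasurable_set1.
apply/eqP; rewrite eq_le probability_le1//=.
have PA (l : R) : (0 < l)%R -> (1 - C * l)%:E <= P A.
  move=> l0; apply: le_trans (H l l0) _.
  rewrite -[leRHS](_ : \int[P]_w (\1_A w)%:E = _); last by rewrite integral_indic// setIT.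
  apply: ge0_le_integral => //.
  - by move=> w _; rewrite lee_fin expN_ge0.
  - apply/measurable_EFinP; apply: (measurableT_comp (@measurable_expN R)).
    exact: measurable_funeM.
  - by apply/measurable_EFinP; exact: measurable_indic.
  - move=> w _; rewrite lee_fin indicE; have [wA|wA] := pselect (A w).
      by rewrite mem_set// expN_le1.
    rewrite memNset//; have -> : Y w = +oo.
      by apply/eqP; rewrite -leye_eq leNgt; apply/negP.
    by rewrite gt0_muley ?lte_fin// expNy.
apply/lee_addgt0Pr => e e0.
have C1 : (0 < C + 1)%R by rewrite ltr_wpDl.
(* [C + 1] instead of [C] covers [C = 0]; the error is [C e / (C + 1) <= e]. *)
have := PA (e / (C + 1))%R (divr_gt0 e0 C1).
move=> h; apply: (@le_trans _ _ ((1 - C * (e / (C + 1)))%:E + e%:E)); last by rewrite leeD2r.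
rewrite -EFinD lee_fin -addrA lerDl addrC subr_ge0 mulrA ler_pdivrMr// mulrC.
by rewrite ler_pM2l// lerDl.
Qed.

Section poisson_laplace.
Context d d' (R : realType) (Omega : measurableType d) (P : probability Omega R)
  (E : measurableType d') (S : set E) (mS : measurable S).
Variables (mu : {measure set E -> \bar R}) (N : R.-ker Omega ~> E).
Hypothesis hN : poisson_random_measure P S mu N.

Let mNB B : measurable B -> measurable_fun setT (fun w => N w B).
Proof. by move=> mB; exact: measurable_kernel. Qed.

Let mpreN B C : measurable B -> measurable C -> measurable [set w | C (N w B)].
Proof.
by move=> mB mC; rewrite -[X in measurable X]setTI; exact: (mNB mB measurableT mC).
Qed.

Let P_indic A : measurable A -> \int[P]_w (\1_A w)%:E = P A.
Proof. by move=> mA; rewrite integral_indic// setIT. Qed.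

Let poisson_mass_sum (r : R) : (0 <= r)%R ->
  \sum_(k <oo) poisson_prob r 0 [set k] = 1.
Proof.
move=> r0; rewrite -(@probability_setT _ _ _ (poisson_prob r 0%N)).
rewrite -(_ : \bigcup_k [set k] = [set: nat]); last first.
  by rewrite -subTset => k _; exists k.
rewrite measure_bigcup//.
  by apply: eq_eseriesl => k; rewrite in_setT.
by apply/trivIsetP => i j _ _ ij; apply/seteqP; split => // k [/= -> /eqP]; rewrite (negbTE ij).
Qed.

(* Exponential tilting: [e^(-a k)] times the Poisson mass of rate [r] is, up to a
   constant, the Poisson mass of rate [r e^-a]. *)
Let poisson_tilt (r a : R) k : (0 <= r)%R ->
  (expR (- (k%:R * a)))%:E * poisson_prob r 0 [set k] =
  (expR (- (1 - expR (- a)) * r))%:E * poisson_prob (r * expR (- a)) 0 [set k].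
Proof.
rewrite le_eqVlt => /predU1P[<-|r0].
  rewrite /poisson_prob mul0r ltxx mulr0 expR0 mul1e diracE.
  case: k => [|k]; first by rewrite mul0r oppr0 expR0 mul1e.
  by rewrite memNset ?mule0.
rewrite /poisson_prob r0 mulr_gt0 ?expR_gt0// !esum_set1 ?lee_fin ?poisson_pmf_ge0//.
rewrite /poisson_pmf r0 mulr_gt0 ?expR_gt0// -!EFinM; congr EFin.
rewrite exprMn -expRM_natl mulrN.
have -> : (expR (- (1 - expR (- a)) * r) =
    expR (- r) * expR (r * expR (- a)) :> R)%R by rewrite -expRD; congr expR; ring.
have := expRxMexpNx_1 (r * expR (- a))%R.
set X := expR (r * _)%R; set Y := expR (- (r * _))%R => XY.
transitivity (expR (- (k%:R * a)) * (r ^+ k * k`!%:R^-1 * expR (- r)) * (X * Y))%R.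
  by rewrite XY mulr1.
ring.
Qed.

(** For finite [mu B], split over the events [{N B = k}], which exhaust [Omega] up to a null event,
    and tilt: the tilted masses sum to 1 again. For infinite [mu B] the count is almost surely
    infinite and both sides vanish, except at [a = 0], where [0 * oo = 0] makes both equal to 1. *)
Lemma poisson_laplace_count (B : set E) (a : R) : measurable B -> B `<=` S -> (0 <= a)%R ->
  \int[P]_w (expN (a%:E * N w B))%:E = (expN ((1 - expR (- a))%:E * mu B))%:E.
Proof.
move=> mB BS a0; have [_ Hfin Hinf _] := hN.
have mf : measurable_fun setT (fun w => (expN (a%:E * N w B))%:E).
  apply/measurable_EFinP/(measurableT_comp (@measurable_expN R)).
  by apply: measurable_funeM; exact: mNB.
have [muB|muB] := eqVneq (mu B) +oo.
  have : (0 <= 1 - expR (- a))%R by rewrite subr_ge0 expR_le1 oppr_le0.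
  move: a0; rewrite le_eqVlt => /predU1P[<- _|a0 _].
    under eq_integral do rewrite mul0e expN0.
    rewrite integral_cst// oppr0 expR0 subrr mul0e expN0.
    rewrite mul1e.
    exact: probability_setT.
  rewrite muB gt0_muley ?lte_fin ?subr_gt0 ?expR_lt1 ?oppr_lt0// expNy.
  have m1 : measurable [set w | N w B = +oo].
    exact: (mpreN mB (emeasurable_set1 _)).
  rewrite (ge0_ae_eq_integral (g := cst 0))//.
  - by rewrite integral0.
  - by move=> w _; rewrite lee_fin expN_ge0.
  - exists (~` [set w | N w B = +oo]); split; first exact: measurableC.
      by apply: probability_compl_null => //; exact: Hinf.
    move=> w /= h Nw; apply: h => _; by rewrite Nw gt0_muley ?lte_fin// expNy.
have muBfin : mu B < +oo by rewrite lt_neqAle muB leey.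
pose r := fine (mu B); have r0 : (0 <= r)%R by exact: fine_ge0.
have -> : mu B = r%:E by rewrite fineK// ge0_fin_numE.
pose F k := [set w | N w B = k%:R%:E].
have mF k : measurable (F k).
  exact: (mpreN mB (emeasurable_set1 _)).
have tF : trivIset setT F.
  apply/trivIsetP => i j _ _ ij; apply/seteqP; split => // w [].
  by rewrite /F /= => -> /eqP; rewrite eqe eqr_nat (negbTE ij).
have PF k : P (F k) = poisson_prob r 0 [set k] by exact: Hfin.
have mUF : measurable (\bigcup_k F k) by exact: bigcup_measurable.
have PUF : P (\bigcup_k F k) = 1.
  rewrite measure_bigcup//= -(poisson_mass_sum r0).
  rewrite (@eq_eseriesl _ _ xpredT); last by move=> k; rewrite in_setT.
  by apply: eq_eseriesr => k _; rewrite -PF.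
transitivity (\int[P]_(w in \bigcup_k F k) (expN (a%:E * N w B))%:E).
  rewrite [RHS]integral_mkcond; apply: ge0_ae_eq_integral => //.
  - apply/(measurable_restrictT _ _).1 => //; exact: measurable_funTS.
  - by move=> w _; rewrite lee_fin expN_ge0.
  - by move=> w _; apply: erestrict_ge0 => x _; rewrite lee_fin expN_ge0.
  - exists (~` \bigcup_k F k); split; first exact: measurableC.
      exact: probability_compl_null.
    by move=> w /= h Uw; apply: h => _; rewrite patchE mem_set.
rewrite ge0_integral_bigcup//; last 2 first.
- exact: measurable_funTS.
- by move=> w _; rewrite lee_fin expN_ge0.
under eq_eseriesr => k _.
  under eq_integral.
    move=> w; rewrite inE => ->.
    rewrite -EFinM expN_EFin ?mulr_ge0// mulrC.
    over.
  rewrite integral_cst//= PF poisson_tilt//.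
  over.
rewrite nneseriesZl; last by move=> k _; exact: measure_ge0.
rewrite poisson_mass_sum ?mulr_ge0 ?expR_ge0// mule1.
have q0 : (0 <= 1 - expR (- a))%R by rewrite subr_ge0 expR_le1 oppr_le0.
by rewrite -EFinM expN_EFin ?mulr_ge0// mulNr.
Qed.

(** Extends a factorisation known for indicators of events of [Y] to nonnegative functions of [Y].
    Taking [C = setT] in its hypothesis shows that [k] is the expectation of the cofactor [U]. *)
Let indep_step (Y : Omega -> \bar R) (U : Omega -> R) (k : R) :
  measurable_fun setT Y -> measurable_fun setT U -> (forall w, 0 <= U w)%R ->
  (0 <= k)%R ->
  (forall C, measurable C ->
    \int[P]_w (\1_C (Y w) * U w)%:E = k%:E * P (Y @^-1` C)) ->
  forall f : \bar R -> \bar R, measurable_fun setT f -> (forall y, 0 <= f y) ->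
  \int[P]_w (f (Y w) * (U w)%:E) = k%:E * \int[P]_w f (Y w).
Proof.
move=> mY mU U0 k0 H.
have mfY (f : \bar R -> \bar R) : measurable_fun setT f ->
    measurable_fun setT (fun w => f (Y w)) by move=> mf; exact: measurableT_comp.
have mUE : measurable_fun setT (EFin \o U) by exact/measurable_EFinP.
have U0E w : 0 <= (U w)%:E by rewrite lee_fin.
apply: ge0_measurable_ind.
- move=> C mC; under eq_integral do rewrite -EFinM; rewrite H//; congr (_ * _).
  have mYC : measurable (Y @^-1` C) by rewrite -[X in measurable X]setTI; exact: mY.
  by rewrite -P_indic.
- move=> r f r0 mf f0 IH; under eq_integral do rewrite -muleA.
  rewrite ge0_integralZl_EFin//; last 2 first.
    by move=> w _; rewrite mule_ge0.
    by apply: emeasurable_funM => //; exact: mfY.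
  by rewrite IH ge0_integralZl_EFin//; [rewrite muleCA|exact: mfY].
- move=> f g mf f0 mg g0 IHf IHg.
  under eq_integral do rewrite ge0_muleDl//.
  rewrite ge0_integralD//; last 4 first.
  + by move=> w _; rewrite mule_ge0.
  + by apply: emeasurable_funM => //; exact: mfY.
  + by move=> w _; rewrite mule_ge0.
  + by apply: emeasurable_funM => //; exact: mfY.
  rewrite IHf IHg ge0_integralD//; [|exact: mfY|exact: mfY].
  by rewrite [RHS]ge0_muleDr//; exact: integral_ge0.
- move=> f mf f0 ndf IH.
  transitivity (\int[P]_w limn (fun n => f n (Y w) * (U w)%:E)).
    apply: eq_integral => w _; rewrite limeMr//.
    by apply: ereal_nondecreasing_is_cvgn; exact: ndf.
  rewrite monotone_convergence//; last 3 first.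
  + by move=> n; apply: emeasurable_funM => //; exact: mfY.
  + by move=> n w _; rewrite mule_ge0.
  + by move=> w _ a b ab; rewrite lee_wpmul2r//; exact: ndf.
  under eq_fun do rewrite IH.
  rewrite limeMl//; last first.
    apply: ereal_nondecreasing_is_cvgn => a b ab; apply: ge0_le_integral => //.
    + exact: mfY.
    + exact: mfY.
    + by move=> w _; exact: ndf.
  congr (_ * _); rewrite monotone_convergence//.
  + by move=> n; exact: mfY.
Qed.

Lemma poisson_indep_prod (n : nat) (B : 'I_n -> set E) (g : 'I_n -> \bar R -> R) :
  (forall i, measurable (B i) /\ B i `<=` S) -> trivIset setT B ->
  (forall i, measurable_fun setT (g i)) -> (forall i y, 0 <= g i y <= 1)%R ->
  \int[P]_w (\prod_(i < n) g i (N w (B i)))%:E =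
  \prod_(i < n) \int[P]_w (g i (N w (B i)))%:E.
Proof.
move=> hB tB; have [_ _ _ Hind] := hN.
(* The independence clause of the definition is about indicators. They are replaced one coordinate
   at a time: at stage [j] the functions of index at least [j] are still indicators, and [j = n] is
   the claim. *)
suff H : forall j, (j <= n)%N -> forall g : 'I_n -> \bar R -> R,
  (forall i, measurable_fun setT (g i)) -> (forall i y, 0 <= g i y <= 1)%R ->
  (forall i : 'I_n, (j <= i)%N -> exists2 C, measurable C & g i = \1_C) ->
  \int[P]_w (\prod_(i < n) g i (N w (B i)))%:E =
  \prod_(i < n) \int[P]_w (g i (N w (B i)))%:E.
  move=> mg g01; apply: (H n) => // i; by rewrite leqNgt ltn_ord.
have mNi i : measurable_fun setT (fun w => N w (B i)) by apply: mNB; have [] := hB i.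
elim => [_|j IH jn] {}g mg g01 gC.
  have /choice[C HC] : forall i : 'I_n, exists C, measurable C /\ g i = \1_C.
    by move=> i; have [//|C mC gE] := gC i; exists C.
  have mpre i : measurable [set w | C i (N w (B i))].
    by rewrite -[X in measurable X]setTI; apply: (mNi i) => //; have [] := HC i.
  transitivity (P (\bigcap_(i in [set: 'I_n]) [set w | C i (N w (B i))])).
    have mcap : measurable (\bigcap_(i in [set: 'I_n]) [set w | C i (N w (B i))]).
      by apply: fin_bigcap_measurable => //; exact: finite_finset.
    rewrite -(P_indic mcap); apply: eq_integral => w _; congr EFin.
    rewrite indicE; have [inC|ninC] := pselect (forall i, C i (N w (B i))).
      rewrite mem_set//; last by move=> i _; exact: inC.
      by rewrite big1// => i _; have [_ ->] := HC i; rewrite indicE mem_set.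
    rewrite memNset; last by move=> h; apply: ninC => i; exact: h.
    have /existsNP[i ni] := ninC.
    rewrite (bigD1 i)//=; have [_ ->] := HC i.
    by rewrite indicE memNset// mul0r.
  rewrite Hind//; last by move=> i; have [] := HC i.
  apply: eq_bigr => i _; have [_ ->] := HC i.
  by rewrite -(P_indic (mpre i)).
pose i0 := Ordinal jn.
pose U w := (\prod_(i < n | i != i0) g i (N w (B i)))%R.
have mU : measurable_fun setT U.
  rewrite /U; elim: (index_enum _) => [|i s IHs].
    by under eq_fun do rewrite big_nil; exact: measurable_cst.
  have [ii|ii] := boolP (i != i0); last first.
    by under eq_fun do rewrite big_cons (negbTE ii); exact: IHs.
  under eq_fun do rewrite big_cons ii; apply: measurable_funM => //.
  exact: measurableT_comp.
have U0 w : (0 <= U w)%R by apply: prodr_ge0 => i _; have /andP[] := g01 i (N w (B i)).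
have I01 i : 0 <= \int[P]_w (g i (N w (B i)))%:E <= 1.
  apply/andP; split.
    by apply: integral_ge0 => w _; rewrite lee_fin; have /andP[] := g01 i (N w (B i)).
  rewrite -(@probability_setT _ _ _ P) -[leRHS]mul1e -integral_cst//; apply: ge0_le_integral => //.
  - by move=> w _; rewrite lee_fin; have /andP[] := g01 i (N w (B i)).
  - by apply/measurable_EFinP; exact: measurableT_comp.
  - by move=> w _; rewrite lee_fin; have /andP[] := g01 i (N w (B i)).
have If i : \int[P]_w (g i (N w (B i)))%:E \is a fin_num.
  have /andP[? ?] := I01 i; rewrite ge0_fin_numE//; exact: le_lt_trans (ltry 1%R).
pose k := (\prod_(i < n | i != i0) fine (\int[P]_w (g i (N w (B i)))%:E))%R.
have k0 : (0 <= k)%R by apply: prodr_ge0 => i _; apply: fine_ge0; have /andP[] := I01 i.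
have kE : k%:E = \prod_(i < n | i != i0) \int[P]_w (g i (N w (B i)))%:E.
  rewrite /k; elim: (index_enum _) => [|i s IHs]; first by rewrite !big_nil.
  by rewrite !big_cons; case: ifP => // _; rewrite EFinM IHs fineK.
rewrite [RHS](bigD1 i0)//= -kE muleC.
under eq_integral do rewrite (bigD1 i0)//= EFinM.
apply: (indep_step (mNi i0) mU U0 k0 _ (f := EFin \o g i0)) => //; last 2 first.
- exact/measurable_EFinP.
- by move=> y; rewrite lee_fin; have /andP[] := g01 i0 y.
move=> C mC.
pose g' i := if i == i0 then \1_C else g i.
have g'E i : i != i0 -> g' i = g i by rewrite /g' => /negbTE ->.
have g'0 : g' i0 = \1_C by rewrite /g' eqxx.
have := IH (ltnW jn) g'; rewrite (bigD1 i0)//= g'0.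
under eq_integral do rewrite (bigD1 i0)//= g'0.
have -> : P ((fun w => N w (B i0)) @^-1` C) = \int[P]_w (\1_C (N w (B i0)))%:E.
  have mpre : measurable ((fun w => N w (B i0)) @^-1` C).
    by rewrite -[X in measurable X]setTI; exact: mNi.
  by rewrite -(P_indic mpre).
move=> IHg; rewrite kE [RHS]muleC.
transitivity (\int[P]_w (\1_C (N w (B i0)) *
    \prod_(i < n | i != i0) g' i (N w (B i)))%:E).
  apply: eq_integral => w _; congr (_ * _)%:E; apply: eq_bigr => i ii.
  by rewrite g'E.
rewrite IHg.
- by congr (_ * _); apply: eq_bigr => i ii; rewrite g'E.
- by move=> i; rewrite /g'; case: ifP => // _; exact: measurable_indic.
- move=> i y; rewrite /g'; case: ifP => // _.
  by rewrite indicE; case: (_ \in _); rewrite ?lexx ?ler01.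
- move=> i; rewrite leq_eqVlt => /predU1P[ji|ji].
    by exists C => //; rewrite /g' ifT//; apply/eqP/val_inj.
  by rewrite g'E//; [exact: gC|rewrite -val_eqE/= gtn_eqF].
Qed.

End poisson_laplace.

Section integral_comp_nnsfun.
Context d (T : measurableType d) (R : realType).
Import HBNNSimple.

(** Used for each [N w] with the identity and for [mu] with [r |-> 1 - e^-r], over the same level
    sets; this matches the two sides of the Laplace functional factor by factor. *)
Lemma integral_comp_nnsfun (m : {measure set T -> \bar R}) (S : set T)
    (f : {nnsfun T >-> R}) (phi : R -> R) (s := finmap.enum_fset (fset_set (range f))) :
  measurable S -> (forall r, (0 <= r)%R -> (0 <= phi r)%R) ->
  \int[m]_(x in S) (phi (f x))%:E =
  \sum_(i < size s) (phi (nth 0%R s i))%:E * m (f @^-1` [set nth 0%R s i] `&` S).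
Proof.
move=> mS phi0.
have s_uniq : uniq s by exact: finmap.fset_uniq.
have s_ge0 i : (0 <= nth 0%R s i)%R.
  have [si|si] := ltnP i (size s); last by rewrite nth_default.
  have : nth 0%R s i \in s by exact: mem_nth.
  rewrite in_fset_set// inE => -[x _ <-]; exact: fun_ge0.
transitivity (\int[m]_(x in S) \sum_(i < size s)
    ((phi (nth 0%R s i))%:E * (\1_(f @^-1` [set nth 0%R s i]) x)%:E)).
  apply: eq_integral => x _.
  have fs : f x \in s by rewrite in_fset_set// inE; exists x.
  have si : (index (f x) s < size s)%N by rewrite index_mem.
  rewrite (bigD1 (Ordinal si))//= nth_index// indicE mem_set// mule1 big1 ?adde0//.
  move=> i ii; rewrite indicE memNset ?mule0//= => fx.
  move/eqP : ii; apply; apply/val_inj => /=.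
  by rewrite fx index_uniq.
rewrite ge0_integral_sum//; last 2 first.
- by move=> i; apply/measurable_funeM/measurable_EFinP/measurable_indic.
- by move=> i x _; rewrite mule_ge0// lee_fin// phi0.
apply: eq_bigr => i _; rewrite ge0_integralZl_EFin//.
- by rewrite integral_indic.
- by apply/measurable_EFinP; exact: measurable_indic.
- exact: phi0.
Qed.

End integral_comp_nnsfun.

Section poisson_laplace.
Context d d' (R : realType) (Omega : measurableType d) (P : probability Omega R)
  (E : measurableType d') (S : set E) (mS : measurable S).
Variables (mu : {measure set E -> \bar R}) (N : R.-ker Omega ~> E).
Hypothesis hN : poisson_random_measure P S mu N.
Import HBNNSimple.

Lemma measurable_kernel_integral (D : set E) (f : E -> \bar R) : measurable D ->
  measurable_fun setT f -> (forall x, 0 <= f x) ->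
  measurable_fun setT (fun w => \int[N w]_(x in D) f x).
Proof.
move=> mD mf f0; under eq_fun do rewrite integral_mkcond.
apply: measurable_fun_integral_kernel.
- by move=> U mU; exact: measurable_kernel.
- by move=> x; apply: erestrict_ge0.
- by apply/(measurable_restrictT _ _).1 => //; exact: measurable_funTS.
Qed.

Let poisson_laplace_nnsfun (f : {nnsfun E >-> R}) :
  \int[P]_w (expN (\int[N w]_(x in S) (f x)%:E))%:E =
  (expN (\int[mu]_(x in S) (1 - expN (f x)%:E)%:E))%:E.
Proof.
rewrite (@integral_comp_nnsfun _ _ _ mu S f (fun r => 1 - expN r%:E)%R)//; last first.
  by move=> r r0; rewrite subr_ge0 expN_le1.
under eq_integral do rewrite (@integral_comp_nnsfun _ _ _ _ S f id)//.
set s := finmap.enum_fset _.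
have s_uniq : uniq s by exact: finmap.fset_uniq.
have s_ge0 i : (0 <= nth 0%R s i)%R.
  have [si|si] := ltnP i (size s); last by rewrite nth_default.
  have : nth 0%R s i \in s by exact: mem_nth.
  rewrite in_fset_set// inE => -[x _ <-]; exact: fun_ge0.
pose B (i : 'I_(size s)) := f @^-1` [set nth 0%R s i] `&` S.
have hB i : measurable (B i) /\ B i `<=` S.
  by split; [exact: measurableI|exact: subIsetr].
have tB : trivIset setT B.
  apply/trivIsetP => i j _ _ ij; apply/seteqP; split => // x [[/= fi _] [fj _]].
  move/eqP : ij; apply; apply/val_inj => /=; apply/eqP.
  by rewrite -(nth_uniq 0%R _ _ s_uniq) ?ltn_ord// -fi -fj.
pose g (i : 'I_(size s)) y : R := expN ((nth 0%R s i)%:E * y).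
have mg i : measurable_fun setT (g i).
  apply: measurableT_comp; first exact: measurable_expN.
  exact: measurable_funeM.
transitivity (\int[P]_w (\prod_(i < size s) g i (N w (B i)))%:E).
  apply: eq_integral => w _; rewrite expN_sum// => i.
  by rewrite mule_ge0// lee_fin s_ge0.
rewrite (poisson_indep_prod hN hB tB mg); last by move=> i y; exact: expN01.
rewrite expN_sum; last first.
  by move=> i; rewrite mule_ge0// lee_fin subr_ge0 expN_le1.
rewrite -prodEFin; apply: eq_bigr => i _.
have [mBi BiS] := hB i.
rewrite (poisson_laplace_count hN mBi BiS (s_ge0 i)) expN_EFin//.
Qed.

(** For simple functions this is independence over the disjoint level sets. Along an increasing
    approximation the left side converges by dominated convergence, the exponent on the right by
    monotone convergence. Infinite integrals are covered because [expN] sends them to 0. *)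
Lemma poisson_laplace (f : E -> \bar R) :
  measurable_fun setT f -> (forall x, 0 <= f x) ->
  \int[P]_w (expN (\int[N w]_(x in S) f x))%:E =
  (expN (\int[mu]_(x in S) (1 - expN (f x))%:E))%:E.
Proof.
move=> mf f0; pose g := nnsfun_approx measurableT mf.
have gf x : (g n x)%:E @[n --> \oo] --> f x by exact: cvg_nnsfun_approx.
have ndg x : {homo (fun n => g n x) : a b / (a <= b)%N >-> (a <= b)%R}.
  by move=> a b ab; exact/lefP/nd_nnsfun_approx.
have mNg n : measurable_fun setT (fun w => \int[N w]_(x in S) (g n x)%:E).
  apply: measurable_kernel_integral => //; first exact/measurable_EFinP.
  by move=> x; rewrite lee_fin.
have L : \int[P]_w (expN (\int[N w]_(x in S) (g n x)%:E))%:E @[n --> \oo] -->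
    \int[P]_w (expN (\int[N w]_(x in S) f x))%:E.
  have [] // := @dominated_convergence _ _ _ P setT measurableT
    (fun n w => (expN (\int[N w]_(x in S) (g n x)%:E))%:E)
    (fun w => (expN (\int[N w]_(x in S) f x))%:E) (cst 1).
  - move=> n; apply/measurable_EFinP; apply: measurableT_comp (mNg n).
    exact: measurable_expN.
  - apply/measurable_EFinP; apply: (measurableT_comp (@measurable_expN R)).
    exact: measurable_kernel_integral.
  - apply: aeW => w _; apply: cvg_EFin; first exact: nearW.
    apply: (expN_cvg (u := fun n => \int[N w]_(x in S) (g n x)%:E)).
      by move=> n; apply: integral_ge0 => x _; rewrite lee_fin.
    under eq_integral => x _ do rewrite -(cvg_lim _ (gf x))//.
    apply: cvg_monotone_convergence => //.
    + by move=> n; apply/measurable_EFinP; exact: measurable_funTS.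
    + by move=> n x _; rewrite lee_fin.
    + by move=> x _ a b ab; rewrite lee_fin; exact: ndg.
  - apply/integrableP; split => //.
    by rewrite integral_cst//= normr1 mul1e (@probability_setT _ _ _ P) ltry.
  - by apply: aeW => w n _; rewrite gee0_abs lee_fin ?expN_ge0 ?expN_le1.
suff L' : \int[P]_w (expN (\int[N w]_(x in S) (g n x)%:E))%:E @[n --> \oo] -->
    (expN (\int[mu]_(x in S) (1 - expN (f x))%:E))%:E by exact: (cvg_unique _ L L').
under eq_fun do rewrite poisson_laplace_nnsfun.
apply: cvg_EFin; first exact: nearW.
apply: (expN_cvg (u := fun n => \int[mu]_(x in S) (1 - expN (g n x)%:E)%:E)).
  by move=> n; apply: integral_ge0 => x _; rewrite lee_fin subr_ge0 expN_le1.
have fE x : (1 - expN (g n x)%:E)%:E @[n --> \oo] --> (1 - expN (f x))%:E.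
  apply: cvg_EFin; first exact: nearW.
  apply: cvgB; first exact: cvg_cst.
  by apply: (expN_cvg (u := fun n => (g n x)%:E)) => // n; rewrite lee_fin.
under [X in _ --> X]eq_integral => x _ do rewrite -(cvg_lim _ (fE x))//.
apply: cvg_monotone_convergence => //.
+ move=> n; apply/measurable_EFinP; apply: measurable_funTS.
  apply: measurable_funB => //; apply: (measurableT_comp (@measurable_expN R)).
  exact/measurable_EFinP.
+ by move=> n x _; rewrite lee_fin subr_ge0 expN_le1.
+ move=> x _ a b ab; rewrite lee_fin lerD2l lerN2 expN_nincr ?lee_fin//.
  exact: ndg.
Qed.

End poisson_laplace.

(** * The branching mechanism and its flow *)

(** The Laplace exponent of the driftless subordinator with jump measure [m]. *)
Definition jump_exponent (R : realType)
    (m : {measure set (measurableTypeR R) -> \bar R}) (a : R) : R :=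
  (\int[m]_(u in `]0%R, +oo[) (1 - expR (- (a * u))))%R.

Section mechanism.
Context (R : realType) (b c : R) (m : {measure set (measurableTypeR R) -> \bar R}).
Hypothesis hphi : branching_parameters b c m.
Variable delta : R.
Hypothesis hdelta : derive1 (branching_mechanism b c m) x @[x --> +oo%R] --> delta.

Local Notation J := (`]0%R, +oo[%classic : set (measurableTypeR R)).

Let mJ : measurable J. Proof. exact: measurable_itv. Qed.

Let Jgt0 u : J u -> (0 < u)%R. Proof. by rewrite /= in_itv/= andbT. Qed.

Let expB_le (x : R) : (0 <= x)%R -> (1 - expR (- x) <= x)%R.
Proof. by move=> x0; have := expR_ge1Dx (- x); lra. Qed.

Let expB_ge0 (x : R) : (0 <= x)%R -> (0 <= 1 - expR (- x))%R.
Proof. by move=> x0; rewrite subr_ge0 expR_le1 oppr_le0. Qed.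

Let expBD_le (x : R) : (0 <= x)%R -> (expR (- x) - 1 + x <= x ^+ 2)%R.
Proof.
move=> x0; rewrite expRN.
have x1 : (0 < 1 + x)%R by rewrite ltr_wpDr.
have : ((expR x)^-1 <= (1 + x)^-1)%R by rewrite lef_pV2 ?posrE ?expR_gt0// expR_ge1Dx.
suff : ((1 + x)^-1 <= 1 - x + x ^+ 2)%R by lra.
rewrite -[leLHS]mul1r ler_pdivrMr//.
have : (0 <= x ^+ 3)%R by rewrite exprn_ge0.
lra.
Qed.

Let minuu (u : R) : R := (minr u (u ^+ 2))%R.

Let minuu_ge0 u : J u -> (0 <= minuu u)%R.
Proof. by move=> /Jgt0 u0; rewrite le_min (ltW u0) exprn_ge0// ltW. Qed.

Let mminuu : measurable_fun setT minuu.
Proof. by apply: measurable_minr => //; exact: exprn_measurable. Qed.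

Let minuu_int (k : R) : (0 <= k)%R -> m.-integrable J (fun u => (k * minuu u)%:E).
Proof.
move=> k0; have [_ _ h] := hphi.
suff H : m.-integrable J (EFin \o minuu) by exact: (integrableZl mJ k H).
apply/integrableP; split; first by apply/measurable_EFinP; exact: measurable_funTS.
under eq_integral => u uJ.
  rewrite gee0_abs; last by rewrite lee_fin minuu_ge0// -inE.
  over.
exact: h.
Qed.

Let mexp (x : R) : measurable_fun setT (fun u : R => expR (- (x * u)))%R.
Proof.
apply: measurableT_comp; first exact: measurable_expR.
by apply: measurableT_comp => //; exact: measurable_funM.
Qed.

(** Until [finite_drift] is available, domination by a multiple of [min(u, u^2)] is the only source
    of integrability. *)
Let int_le (f : R -> R) (k : R) : (0 <= k)%R -> measurable_fun setT f ->
  (forall u, (0 < u)%R -> `|f u| <= k * minuu u)%R -> m.-integrable J (EFin \o f).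
Proof.
move=> k0 mf fle; apply: (le_integrable _ _ _ (minuu_int k0)) => //.
- by apply/measurable_EFinP; exact: measurable_funTS.
- move=> u uJ; rewrite /= lee_fin (le_trans (fle u (Jgt0 uJ)))//.
  exact: ler_norm.
Qed.

Let phi_integrable (z : R) : (0 <= z)%R ->
  m.-integrable J (fun u => (expR (- (z * u)) - 1 + z * u)%:E).
Proof.
move=> z0; apply: (@int_le _ (z + z ^+ 2)%R) => /=.
- by rewrite addr_ge0// exprn_ge0.
- apply: measurable_funD; first exact: measurable_funB.
  exact: measurable_funM.
- move=> u u0; have zu : (0 <= z * u)%R by rewrite mulr_ge0// ltW.
  have h1 : (0 <= expR (- (z * u)) - 1 + z * u)%R by have := expB_le zu; lra.
  rewrite ger0_norm//.
  have h2 := expBD_le zu; have h3 := expB_ge0 zu.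
  rewrite /minuu minr_pMr ?addr_ge0 ?exprn_ge0// le_min; apply/andP; split.
    have : (0 <= z ^+ 2 * u)%R by rewrite mulr_ge0 ?exprn_ge0// ltW.
    lra.
  have : (0 <= z * u ^+ 2)%R by rewrite mulr_ge0 ?sqr_ge0.
  by rewrite mulrDl -exprMn => h4; rewrite (le_trans h2)// lerDr.
Qed.

Let dphi_le (z u : R) : (0 <= z)%R -> (0 < u)%R ->
  (0 <= u * (1 - expR (- (z * u))) <= (1 + z) * minuu u)%R.
Proof.
move=> z0 u0; have zu : (0 <= z * u)%R by rewrite mulr_ge0// ltW.
have h1 := expB_ge0 zu; have h2 := expB_le zu.
rewrite mulr_ge0 ?(ltW u0)//= /minuu minr_pMr ?addr_ge0// le_min.
have e0 := expR_ge0 (- (z * u))%R.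
have zzu : (0 <= z * u ^+ 2)%R by rewrite mulr_ge0 ?sqr_ge0.
apply/andP; split; first by nra.
apply: (@le_trans _ _ (u * (z * u))%R); first by rewrite ler_wpM2l// ltW.
have := sqr_ge0 u.
lra.
Qed.

Let dphi_integrable (z : R) : (0 <= z)%R ->
  m.-integrable J (fun u => (u * (1 - expR (- (z * u))))%:E).
Proof.
move=> z0; apply: (@int_le _ (1 + z)%R) => /=.
- by rewrite addr_ge0.
- by apply: measurable_funM => //; exact: measurable_funB.
- by move=> u u0; have /andP[? ?] := dphi_le z0 u0; rewrite ger0_norm.
Qed.

Let dphiE (a : R) : (0 < a)%R ->
  (derive1 (branching_mechanism b c m) a =
   b + 2 * c * a + \int[m]_(u in J) (u * (1 - expR (- (a * u)))))%R.
Proof.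
move=> a0.
pose f (x u : R) := (expR (- (x * u)) - 1 + x * u)%R.
have df (x u : R) : is_derive x (1%R : R) (f ^~ u) (u * (1 - expR (- (x * u))))%R.
  rewrite /f; apply: is_derive_eq.
  rewrite /GRing.scale/=; ring.
(* On [0 < x < a + 1] the derivative [u (1 - e^(-x u))] is at most [(1 + x) min(u, u^2)], whence
   [a + 2]; the absolute value keeps the bound nonnegative at every real [u]. *)
pose G u := ((a + 2) * `|minuu u|)%R.
have G0 u : (0 <= G u)%R by rewrite mulr_ge0// addr_ge0// ltW.
have Ia : (`]0%R, (a + 1)%R[%classic : set R) a by rewrite /= in_itv/= a0 ltrDl ltr01.
have Ix x : (`]0%R, (a + 1)%R[%classic : set R) x -> (0 < x < a + 1)%R by rewrite /= in_itv.
have intf x : (`]0%R, (a + 1)%R[%classic : set R) x -> m.-integrable J (EFin \o f x).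
  by move=> /Ix/andP[x0 _]; apply: phi_integrable; exact: ltW.
have derf x u : (`]0%R, (a + 1)%R[%classic : set R) x -> J u -> derivable (f ^~ u) x 1%R.
  by move=> _ _; have [] := df x u.
have iG : m.-integrable J (EFin \o G).
  apply: (@int_le _ (a + 2)%R); first by rewrite addr_ge0// ltW.
    by apply: measurable_funM => //; exact: measurableT_comp.
  move=> u u0; rewrite ger0_norm// /G ger0_norm// minuu_ge0//=.
  by rewrite in_itv/= u0.
have G_ub x u : (`]0%R, (a + 1)%R[%classic : set R) x -> J u ->
    (`|partial1of2 f x u| <= G u)%R.
  move=> /Ix/andP[x0 xa] Ju; rewrite partial1of2E (@derive_val _ _ _ _ _ _ _ (df x u)).
  have /andP[h1 h2] := dphi_le (ltW x0) (Jgt0 Ju).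
  rewrite ger0_norm// (le_trans h2)// /G ger0_norm ?minuu_ge0//.
  rewrite ler_wpM2r ?minuu_ge0//; lra.
have F'E := differentiation_under_integral mJ Ia intf derf G0 iG G_ub.
have dF := derivable_under_integral mJ Ia intf derf G0 iG G_ub.
rewrite derive1E in F'E.
have E : (\int[m]_(u in J) partial1of2 f a u =
    \int[m]_(u in J) (u * (1 - expR (- (a * u)))))%R.
  apply: eq_Rintegral => u _; rewrite partial1of2E.
  exact: (@derive_val _ _ _ _ _ _ _ (df a u)).
rewrite /= in F'E dF E.
rewrite derive1E /branching_mechanism.
have DF := DeriveDef dF F'E.
rewrite E in DF.
have -> : (fun z : R => (b * z + c * z ^+ 2 +
    \int[m]_(u in J) (expR (- (z * u)) - 1 + z * u))%R) =
   ((fun z => b * z + c * z ^+ 2) + (fun z : R => \int[m]_(u in J) f z u))%R by [].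
rewrite derive_val.
by congr (_ + _)%R; rewrite /GRing.scale/=; ring.
Qed.

(** [phi'(n + 1) = b + 2 c (n + 1) + I n] converges while [I n >= 0], which excludes [c > 0]. Then
    [I n] tends to [delta - b], and it increases to the mean of [m] by monotone convergence. *)
Lemma finite_drift :
  c = 0%R /\ \int[m]_(u in J) u%:E = (delta - b)%:E.
Proof.
have [c0 _ _] := hphi.
pose I n : R := (\int[m]_(u in J) (u * (1 - expR (- (n.+1%:R * u)))))%R.
have IE n : (I n)%:E = \int[m]_(u in J) (u * (1 - expR (- (n.+1%:R * u))))%:E.
  by rewrite /I /Rintegral fineK//; apply: integrable_fin_num => //; exact: dphi_integrable.
have I0 n : (0 <= I n)%R.
  rewrite /I; apply: Rintegral_ge0 => u /Jgt0 u0.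
  by have /andP[] := dphi_le (ler0n _ n.+1) u0.
have hn : (b + 2 * c * n.+1%:R + I n)%R @[n --> \oo] --> delta.
  under eq_fun do rewrite -dphiE//.
  apply: (cvg_comp (fun n : nat => n.+1%:R : R) _ _ hdelta).
  rewrite (cvg_shiftS (fun n : nat => n%:R : R)); exact: cvgr_idn.
have c_eq0 : c = 0%R.
  apply/eqP; rewrite eq_le c0 andbT leNgt; apply/negP => cgt0.
  have /cvgrPdist_lt /(_ 1%R ltr01) hn1 := hn.
  near \oo => n.
  have : (`|delta - (b + 2 * c * n.+1%:R + I n)| < 1)%R by near: n.
  rewrite ltr_norml => /andP[h1 _].
  (* From this size of [n] on, [b + 2 c n] alone exceeds the limit by 1. *)
  have : ((delta + 1 - b) / (2 * c) <= n%:R)%R by near: n; exact: nbhs_infty_ger.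
  rewrite ler_pdivrMr ?mulr_gt0// => h2; have := I0 n.
  rewrite -natr1 in h1; nra.
split => //; rewrite c_eq0 in hn.
have hI : (I n)%:E @[n --> \oo] --> (delta - b)%:E.
  apply: cvg_EFin; first exact: nearW.
  rewrite (_ : I = fun n => (b + 2 * 0 * n.+1%:R + I n - b)%R); last first.
    by apply/funext => n; ring.
  by apply: cvgB => //; exact: cvg_cst.
suff L : (I n)%:E @[n --> \oo] --> \int[m]_(u in J) u%:E by exact: (cvg_unique _ L hI).
under eq_fun do rewrite IE.
have uE u : J u -> (u * (1 - expR (- (n.+1%:R * u))))%:E @[n --> \oo] --> u%:E.
  move=> /Jgt0 u0; apply: cvg_EFin; first exact: nearW.
  rewrite -[X in _ --> X]mulr1; apply: cvgM; first exact: cvg_cst.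
  rewrite -[X in _ --> X]subr0; apply: cvgB; first exact: cvg_cst.
  rewrite (cvg_shiftS (fun n : nat => expR (- (n%:R * u)))).
  under eq_fun do rewrite -mulrN expRM_natl.
  by apply: cvg_expr; rewrite ger0_norm ?expR_ge0// expR_lt1 oppr_lt0.
have -> : \int[m]_(u in J) u%:E =
    \int[m]_(u in J) limn (fun n => (u * (1 - expR (- (n.+1%:R * u))))%:E).
  apply: eq_integral => u uJ; apply/esym/cvg_lim => //; apply: uE.
  by rewrite -inE.
apply: cvg_monotone_convergence => //.
- move=> n; apply/measurable_EFinP/measurable_funTS/measurable_funM => //.
  by apply: measurable_funB => //; exact: mexp.
- by move=> n u /Jgt0 u0; rewrite lee_fin; have /andP[] := dphi_le (ler0n _ n.+1) u0.
- move=> u /Jgt0 u0 k l kl; rewrite lee_fin ler_wpM2l ?(ltW u0)//.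
  by rewrite lerD2l lerN2 ler_expR lerN2 ler_wpM2r ?(ltW u0)// ler_nat.
Unshelve. all: by end_near. Qed.

Let M := (delta - b)%R.

Let id_integrable : m.-integrable J (EFin \o id).
Proof.
apply/integrableP; split; first by apply/measurable_EFinP; exact: measurable_funTS.
under eq_integral => u uJ.
  rewrite gee0_abs; last by rewrite lee_fin ltW// Jgt0// -inE.
  over.
by rewrite /= finite_drift.2 ltry.
Qed.

Let lin_integrable (k : R) : m.-integrable J (fun u => (k * u)%:E).
Proof. exact: (integrableZl mJ k id_integrable). Qed.

Let lin_integral (k : R) : (\int[m]_(u in J) (k * u) = k * M)%R.
Proof. by rewrite RintegralZl//; congr (_ * _)%R; rewrite /Rintegral finite_drift.2. Qed.

Lemma jump_integrable (a : R) : (0 <= a)%R ->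
  m.-integrable J (fun u => (1 - expR (- (a * u)))%:E).
Proof.
move=> a0; apply: (le_integrable _ _ _ (lin_integrable a)) => //.
- by apply/measurable_EFinP; apply: measurable_funTS; apply: measurable_funB => //; exact: mexp.
- move=> u /Jgt0 u0; have au : (0 <= a * u)%R by rewrite mulr_ge0// ltW.
  by rewrite lee_fin !ger0_norm ?expB_ge0 ?expB_le.
Qed.

Lemma jump_exponentE (a : R) : (0 <= a)%R ->
  (jump_exponent m a)%:E = \int[m]_(u in J) (1 - expR (- (a * u)))%:E.
Proof.
move=> a0; rewrite /jump_exponent /Rintegral fineK//.
by apply: integrable_fin_num => //; exact: jump_integrable.
Qed.

Lemma jump_exponent_ge0 (a : R) : (0 <= a)%R -> (0 <= jump_exponent m a)%R.
Proof.
move=> a0; apply: Rintegral_ge0 => u /Jgt0 u0.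
by rewrite expB_ge0// mulr_ge0// ltW.
Qed.

Lemma jump_exponent0 : jump_exponent m 0%R = 0%R.
Proof.
rewrite /jump_exponent; under eq_Rintegral do rewrite mul0r oppr0 expR0 subrr.
by rewrite /Rintegral integral0.
Qed.

(** The increment of the integrand is [e^(-a u) (1 - e^(-(a' - a) u))], between 0 and [(a' - a) u];
    the mean of [m] is the Lipschitz constant. *)
Lemma jump_exponent_lip (a a' : R) : (0 <= a)%R -> (a <= a')%R ->
  (jump_exponent m a <= jump_exponent m a' <=
   jump_exponent m a + (delta - b) * (a' - a))%R.
Proof.
move=> a0 aa'; have a'0 := le_trans a0 aa'.
apply/andP; split.
  apply: le_Rintegral => //; [exact: jump_integrable|exact: jump_integrable|].
  move=> u /Jgt0 u0.
  by rewrite lerD2l lerN2 ler_expR lerN2 ler_wpM2r// ltW.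
rewrite [X in (_ + X)%R]mulrC -(lin_integral (a' - a)) /jump_exponent.
rewrite -RintegralD; [|by []|exact: jump_integrable|exact: lin_integrable].
apply: le_Rintegral => //; first exact: jump_integrable.
  by apply: (integrableD mJ (jump_integrable a0) (lin_integrable (a' - a))).
move=> u /Jgt0 u0.
have h : (0 <= (a' - a) * u)%R by rewrite mulr_ge0 ?subr_ge0// ltW.
have := expB_le h.
have -> : (expR (- (a' * u)) = expR (- (a * u)) * expR (- ((a' - a) * u)) :> R)%R.
  by rewrite -expRD; congr expR; ring.
have : (expR (- (a * u)) <= 1)%R by rewrite expR_le1 oppr_le0 mulr_ge0// ltW.
have := expR_ge0 (- (a * u))%R; have := expB_ge0 h; nra.
Qed.

Lemma drift_ge0 : (0 <= delta - b)%R.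
Proof.
rewrite -lee_fin -finite_drift.2; apply: integral_ge0 => u /Jgt0 u0.
by rewrite lee_fin ltW.
Qed.

(** A finite mean allows the compensator [z u] to be integrated separately; it adds [delta - b] to
    the drift [b]. *)
Lemma mechanismE (z : R) : (0 <= z)%R ->
  (branching_mechanism b c m z = delta * z - jump_exponent m z)%R.
Proof.
move=> z0; rewrite /branching_mechanism finite_drift.1 mul0r addr0.
suff -> : (\int[m]_(u in J) (expR (- (z * u)) - 1 + z * u) =
    z * M - jump_exponent m z)%R by rewrite /M; ring.
rewrite -(lin_integral z) /jump_exponent -RintegralB;
  [|by []|exact: lin_integrable|exact: jump_integrable].
by apply: eq_Rintegral => u _; ring.
Qed.

(** Markov's inequality for the mean of [m]; it will make the path measure sigma-finite. *)
Lemma jump_tail_finite (e : R) : (0 < e)%R -> m `[e, +oo[%classic < +oo.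
Proof.
move=> e0; have sJ : (`[e, +oo[%classic : set (measurableTypeR R)) `<=` J.
  by move=> u /=; rewrite !in_itv/= !andbT; exact: lt_le_trans.
have : e%:E * m `[e, +oo[%classic <= (delta - b)%:E.
  rewrite -finite_drift.2 -integral_cst//.
  apply: (@le_trans _ _ (\int[m]_(u in `[e, +oo[) u%:E)).
    apply: ge0_le_integral => //.
    - by move=> u _; rewrite lee_fin ltW.
    - by move=> u /=; rewrite in_itv/= andbT lee_fin.
  apply: ge0_subset_integral => //.
  by move=> u /Jgt0 u0; rewrite lee_fin ltW.
by case: (m _) => [r| |]//; rewrite ?ltry// gt0_muley ?lte_fin.
Qed.

End mechanism.

(** * The cumulant semigroup as a flow: continuity, derivative and Lipschitz bounds *)

Section cumulant_flow.
Context (R : realType) (phi : R -> R) (v : R -> R -> R) (b K : R).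
Hypothesis hv : cumulant_semigroup phi v.
Hypothesis phi0 : phi 0%R = 0%R.
Hypothesis hphi : forall z z' : R, (0 <= z)%R -> (z <= z')%R ->
  (b * (z' - z) <= phi z' - phi z <= K * (z' - z))%R.
Hypothesis v_mono : forall t l l' : R, (0 <= t)%R -> (0 <= l)%R -> (l <= l')%R ->
  (v t l <= v t l')%R.
Hypothesis v_zero : forall t : R, (0 <= t)%R -> v t 0%R = 0%R.

Local Notation mu := (@lebesgue_measure R).

Let L := (`|b| + `|K| + 1)%R.

Let L_gt0 : (0 < L)%R. Proof. by rewrite ltr_wpDl// addr_ge0. Qed.

Let phi_lip z z' : (0 <= z)%R -> (0 <= z')%R -> (`|phi z - phi z'| <= L * `|z - z'|)%R.
Proof.
wlog zz' : z z' / (z <= z')%R.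
  move=> H z0 z'0; have [zz'|/ltW z'z] := leP z z'; first exact: H.
  by rewrite distrC [X in (_ * X)%R]distrC; exact: H.
move=> z0 z'0; have /andP[h1 h2] := hphi z0 zz'.
rewrite distrC [X in (_ * X)%R]distrC (@ger0_norm _ (z' - z)%R) ?subr_ge0//.
have d0 : (0 <= z' - z)%R by rewrite subr_ge0.
rewrite ler_norml; apply/andP; split.
  apply: le_trans h1; rewrite -mulNr ler_wpM2r// /L.
  have := ler_norm (- b); rewrite normrN; have := normr_ge0 K; lra.
apply: le_trans h2 _; rewrite ler_wpM2r// /L.
have := ler_norm K; have := normr_ge0 b; lra.
Qed.

Lemma v_ge0 (t l : R) : (0 <= t)%R -> (0 <= l)%R -> (0 <= v t l)%R.
Proof. by move=> t0 l0; have [] := hv t0 l0. Qed.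

Lemma v_time0 (l : R) : (0 <= l)%R -> v 0%R l = l.
Proof.
by move=> l0; have [_ _ ->] := hv (lexx 0%R) l0; rewrite set_itv1 Rintegral_set1 subr0.
Qed.

(* The flow frozen at its initial value at negative times, so that it is
   continuous on the whole line. *)
Definition flow (l t : R) : R := v (maxr t 0%R) l.

Lemma flowE (l t : R) : (0 <= t)%R -> flow l t = v t l.
Proof. by move=> t0; rewrite /flow max_l. Qed.

Lemma flow_ge0 (l t : R) : (0 <= l)%R -> (0 <= flow l t)%R.
Proof. by move=> l0; apply: v_ge0 => //; rewrite le_max lexx orbT. Qed.

Section fixed_initial_value.
Variables (l : R) (l0 : (0 <= l)%R).

Let f s := phi (flow l s).

Let f_int t : mu.-integrable `[0%R, t] (EFin \o f).
Proof.
have [t0|t0] := leP 0%R t; last first.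
  by rewrite set_itv_ge ?bnd_simp -?ltNge//; exact: integrable_set0.
have [_ + _] := hv t0 l0; apply: eq_integrable => // s; rewrite inE/= in_itv/= => /andP[s0 _].
by rewrite /f flowE.
Qed.

Let flow_integral t : flow l t = (l - \int[mu]_(s in `[0%R, t]) f s)%R.
Proof.
have [t0|t0] := leP 0%R t; last first.
  rewrite set_itv_ge ?bnd_simp -?ltNge// Rintegral_set0 subr0.
  by rewrite /flow max_r ?v_time0// ltW.
have [_ _ h] := hv t0 l0; rewrite flowE// h; congr (_ - _)%R.
apply: eq_Rintegral => s; rewrite inE/= in_itv/= => /andP[s0 _].
by rewrite /f flowE.
Qed.

(** The flow is [l] minus the integral of [phi (flow l s)], cut off to [s >= 0] and started from a
    negative point [a], so that every [t], 0 included, is interior to the interval of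
    integration. *)
Lemma flow_continuous : continuous (flow l).
Proof.
move=> t; pose a := (- (`|t| + 1))%R; pose d := (`|t| + 1)%R.
have tad : t \in `]a, d[.
  rewrite in_itv/= /a /d; have := ler_norm t; have := ler_norm (- t); rewrite normrN.
  by move=> h1 h2; apply/andP; split; lra.
have a0 : (a <= 0)%R by rewrite oppr_le0 addr_ge0.
have ad : (a < d)%R by move: tad; rewrite in_itv/= => /andP[]; exact: lt_trans.
have capE x : `[a, x] `&` `[0%R, +oo[ = `[0%R, x]%classic.
  apply/seteqP; split => y /=; rewrite !in_itv/= andbT.
    by move=> [/andP[_ ->] ->].
  by move=> /andP[y0 ->]; rewrite y0 (le_trans a0 y0).
have -> : flow l = (fun x => l - parameterized_integral mu a x (f \_ `[0%R, +oo[))%R.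
  apply/funext => x; rewrite flow_integral; congr (_ - _)%R.
  by rewrite /parameterized_integral -Rintegral_mkcondr capE.
have fi : mu.-integrable `[a, d] (EFin \o (f \_ `[0%R, +oo[)).
  by rewrite -restrict_EFin; apply/integrable_restrict => //; rewrite capE.
have := parameterized_integral_continuous (ltW ad) fi.
move=> /(continuous_within_itvP _ ad)[+ _ _] => /(_ t tad) h.
by apply: cvgB => //; exact: cvg_cst.
Qed.

Let f_continuous : continuous f.
Proof.
move=> t; apply/cvgrPdist_le => e e0.
have /cvgrPdist_le /(_ (e / L)%R) h := @flow_continuous t.
near=> s; rewrite (le_trans (phi_lip (flow_ge0 _ l0) (flow_ge0 _ l0)))//.
rewrite mulrC -ler_pdivlMr//; near: s; apply: h; exact: divr_gt0.
Unshelve. all: by end_near. Qed.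

Lemma flow_derive (t : R) : (0 < t)%R -> is_derive t (1%R : R) (flow l) (- phi (flow l t))%R.
Proof.
move=> t0; have tt : (t < t + 1)%R by rewrite ltrDl.
have [h1 h2] := continuous_FTC1_closed tt (f_int (t + 1)) t0 (@f_continuous t).
rewrite derive1E in h2.
have D := DeriveDef h1 h2.
have -> : (- phi (flow l t) = 0 - f t)%R by rewrite sub0r.
rewrite (_ : flow l = (cst l - (fun x => \int[mu]_(s in `[0%R, x]) f s))%R); last first.
  by apply/funext => x; rewrite flow_integral.
exact: is_deriveB.
Qed.

End fixed_initial_value.

(* Gronwall: [e^(b t) (v_t l' - v_t l)] is nonincreasing. *)
Lemma v_lip_init (t l l' : R) : (0 <= t)%R -> (0 <= l)%R -> (l <= l')%R ->
  (v t l' - v t l <= expR (- (b * t)) * (l' - l))%R.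
Proof.
move=> t0 l0 ll'; have l'0 := le_trans l0 ll'.
pose g (s : R) := (expR (b * s) * (flow l' s - flow l s))%R.
have dg (s : R) : (0 < s)%R -> is_derive s (1%R : R) g
    (expR (b * s) * (b * (flow l' s - flow l s) - (phi (flow l' s) - phi (flow l s))))%R.
  move=> s0; have D1 := flow_derive l0 s0; have D2 := flow_derive l'0 s0.
  rewrite /g; apply: is_derive_eq; rewrite /GRing.scale/=; ring.
have cg : continuous g.
  move=> s; apply: cvgM; last first.
    by apply: cvgB; exact: flow_continuous.
  apply: continuous_comp; last exact: continuous_expR.
  by apply: cvgM; [exact: cvg_cst|exact: cvg_id].
have [->|tn0] := eqVneq t 0%R.
  by rewrite !v_time0// mulr0 oppr0 expR0 mul1r.
have tp : (0 < t)%R by rewrite lt_neqAle eq_sym tn0.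
have : (g t <= g 0)%R.
  have dg1 s : s \in `]0%R, t[ -> derivable g s 1%R.
    by rewrite in_itv/= => /andP[s0 _]; have [] := dg s s0.
  have dg0 s : s \in `]0%R, t[ -> (g^`()%classic s <= 0)%R.
    rewrite in_itv/= => /andP[s0 _]; have D := dg s s0.
    rewrite derive1E derive_val pmulr_rle0 ?expR_gt0// subr_le0.
    (* The two solutions stay ordered, which lets the lower bound on the increments of [phi]
       apply. *)
    have ff : (flow l s <= flow l' s)%R.
      by rewrite !flowE ?(ltW s0)//; apply: v_mono => //; exact: ltW.
    by have /andP[] := hphi (flow_ge0 s l0) ff.
  apply: (ler0_derive1_le_cc dg1 dg0 (continuous_subspaceT cg)) => //.
    by rewrite in_itv/= lexx t0.
  by rewrite in_itv/= lexx t0.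
rewrite /g mulr0 expR0 mul1r !flowE// !v_time0// expRN => h.
by rewrite -ler_pdivrMl ?invr_gt0 ?expR_gt0// invrK.
Qed.

Lemma v_le (t l : R) : (0 <= t)%R -> (0 <= l)%R -> (v t l <= expR (- (b * t)) * l)%R.
Proof.
move=> t0 l0; have := v_lip_init t0 (lexx 0%R) l0.
by rewrite v_zero// !subr0.
Qed.

Lemma v_lip_time (T l : R) : (0 <= T)%R -> (0 <= l)%R -> exists C : R, (0 <= C)%R /\
  forall s t : R, (0 <= s)%R -> (s <= t)%R -> (t <= T)%R ->
  (`|v t l - v s l| <= C * (t - s))%R.
Proof.
move=> T0 l0; pose B := (expR (`|b| * T) * l)%R.
have B0 : (0 <= B)%R by rewrite mulr_ge0 ?expR_ge0.
exists (L * B)%R; split; first by rewrite mulr_ge0// ltW.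
move=> s t s0 st tT.
have D (x : R) : x \in `]s, t[ -> is_derive x (1%R : R) (flow l) (- phi (flow l x))%R.
  by rewrite in_itv/= => /andP[sx _]; apply: flow_derive => //; exact: le_lt_trans sx.
have [x xst E] := MVT_segment st D (continuous_subspaceT (flow_continuous l0)).
rewrite -!(flowE l) ?(le_trans s0 st)// E normrM normrN (@ger0_norm _ (t - s)%R) ?subr_ge0//.
rewrite ler_wpM2r ?subr_ge0//.
move: xst; rewrite in_itv/= => /andP[sx xt].
have x0 := le_trans s0 sx.
have := @phi_lip (flow l x) 0%R (flow_ge0 _ l0) (lexx _).
rewrite phi0 !subr0 => /le_trans; apply; rewrite ler_wpM2l ?(ltW L_gt0)//.
rewrite ger0_norm ?flow_ge0// flowE//.
apply: le_trans (v_le x0 l0) _; rewrite /B ler_wpM2r// ler_expR.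
apply: (@le_trans _ _ (`|b| * x)%R); last by rewrite ler_wpM2l// (le_trans xt).
by rewrite -mulNr ler_wpM2r// -normrN ler_norm.
Qed.

End cumulant_flow.

Section CB_cumulant.
Context (R : realType) (v : R -> R -> R).
Variable Q : R -> R.-pker (measurableTypeR R) ~> (measurableTypeR R).
Hypothesis hQ : CB_semigroup v Q.

Local Notation J0 := (`[0%R, +oo[%classic : set (measurableTypeR R)).

(** Read off the Laplace transforms of [Q t] from the starting point 1 rather than from a comparison
    of solutions of the integral equation. *)
Lemma CB_cumulant_mono (t l l' : R) : (0 <= t)%R -> (0 <= l)%R -> (l <= l')%R ->
  (v t l <= v t l')%R.
Proof.
move=> t0 l0 ll'; have l'0 := le_trans l0 ll'.
have [_ h] := hQ; have E1 := h t 1%R l t0 ler01 l0; have E2 := h t 1%R l' t0 ler01 l'0.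
suff : (expR (- (1 * v t l')))%:E <= (expR (- (1 * v t l)))%:E.
  by rewrite lee_fin ler_expR lerN2 !mul1r.
have me (a : R) : measurable_fun J0 (fun y : R => (expR (- (a * y)))%:E).
  apply/measurable_EFinP/measurable_funTS.
  apply: measurableT_comp; first exact: measurable_expR.
  by apply: measurableT_comp => //; exact: measurable_funM.
rewrite -E1 -E2; apply: ge0_le_integral => //.
move=> y; rewrite /= in_itv/= andbT => y0.
by rewrite lee_fin ler_expR lerN2 ler_wpM2r.
Qed.

Lemma CB_cumulant_zero (t : R) : (0 <= t)%R -> v t 0%R = 0%R.
Proof.
move=> t0; have [[h1 _ _] h] := hQ; have := h t 1%R 0%R t0 ler01 (lexx _).
under eq_integral do rewrite mul0r oppr0 expR0.
rewrite integral_cst// mul1e h1// mul1r => -[] /esym/eqP.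
by rewrite -expR0 (inj_eq (@expR_inj R)) oppr_eq0 => /eqP.
Qed.

End CB_cumulant.

Section immigration_balance.
Context (R : realType) (b c : R) (m : {measure set (measurableTypeR R) -> \bar R}).
Hypothesis hphi : branching_parameters b c m.
Variable delta : R.
Hypothesis hdelta : derive1 (branching_mechanism b c m) x @[x --> +oo%R] --> delta.
Variable v : R -> R -> R.
Hypothesis hv : cumulant_semigroup (branching_mechanism b c m) v.
Variable Q : R -> R.-pker (measurableTypeR R) ~> (measurableTypeR R).
Hypothesis hQ : CB_semigroup v Q.

Local Notation phi := (branching_mechanism b c m).
Local Notation Psi := (jump_exponent m).

Lemma mechanism0 : phi 0%R = 0%R.
Proof. by rewrite (mechanismE hphi hdelta)// jump_exponent0 mulr0 subr0. Qed.

Lemma mechanism_lip (z z' : R) : (0 <= z)%R -> (z <= z')%R ->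
  (b * (z' - z) <= phi z' - phi z <= delta * (z' - z))%R.
Proof.
move=> z0 zz'; have z'0 := le_trans z0 zz'.
rewrite !(mechanismE hphi hdelta)//.
have /andP[h1 h2] := jump_exponent_lip hphi hdelta z0 zz'.
move: h1 h2; move: (Psi z) (Psi z') => p p' h1 h2.
by apply/andP; split; lra.
Qed.

Lemma CB_flow_continuous (l : R) : (0 <= l)%R -> continuous (flow v l).
Proof. by move=> l0; exact: (flow_continuous hv l0). Qed.

Lemma CB_cumulant_lip_init (t l l' : R) : (0 <= t)%R -> (0 <= l)%R -> (l <= l')%R ->
  (v t l' - v t l <= expR (- (b * t)) * (l' - l))%R.
Proof.
exact: (v_lip_init hv mechanism_lip (CB_cumulant_mono hQ)).
Qed.

Lemma CB_cumulant_lip_time (T l : R) : (0 <= T)%R -> (0 <= l)%R -> exists C : R, (0 <= C)%R /\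
  forall s t : R, (0 <= s)%R -> (s <= t)%R -> (t <= T)%R ->
  (`|v t l - v s l| <= C * (t - s))%R.
Proof.
exact: (v_lip_time hv mechanism0 mechanism_lip (CB_cumulant_mono hQ)
  (CB_cumulant_zero hQ)).
Qed.

Lemma CB_cumulant_le (t l : R) : (0 <= t)%R -> (0 <= l)%R ->
  (v t l <= expR (- (b * t)) * l)%R.
Proof.
exact: (v_le hv mechanism_lip (CB_cumulant_mono hQ) (CB_cumulant_zero hQ)).
Qed.

Lemma jump_exponent_dist (z z' : R) : (0 <= z)%R -> (0 <= z')%R ->
  (`|Psi z - Psi z'| <= (delta - b) * `|z - z'|)%R.
Proof.
wlog zz' : z z' / (z <= z')%R.
  move=> H z0 z'0; have [zz'|/ltW z'z] := leP z z'; first exact: H.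
  by rewrite distrC [X in (_ * X)%R]distrC; exact: H.
move=> z0 z'0; have /andP[h1 h2] := jump_exponent_lip hphi hdelta z0 zz'.
rewrite distrC [X in (_ * X)%R]distrC !ger0_norm ?subr_ge0//.
by rewrite lerBlDl.
Qed.

(** The discount cancels the linear part of [phi]: the derivative of [- e^(-delta r) v_(s+t-r)(l)]
    is [e^(-delta r) (delta v - phi(v))], that is [e^(-delta r) Psi(v)]. This is what ties the decay
    of the immigration rate to [delta]. *)
Lemma immigration_balance (s t l : R) : (0 <= t)%R -> (0 <= l)%R ->
  \int[@lebesgue_measure R]_(r in `[s, (s + t)%R])
    (expR (- (delta * r)) * Psi (v (s + t - r) l))%:E =
  (expR (- (delta * s)) * v t l - expR (- (delta * (s + t))) * l)%:E.
Proof.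
move=> t0 l0; have [tz|tn0] := eqVneq t 0%R.
  by rewrite tz addr0 set_itv1 integral_set1 (v_time0 hv)// subrr.
have tp : (0 < t)%R by rewrite lt_neqAle eq_sym tn0.
have st : (s < s + t)%R by rewrite ltrDl.
pose V := flow v l.
pose f r := (expR (- (delta * r)) * Psi (V (s + t - r)))%R.
pose F r := (- (expR (- (delta * r)) * V (s + t - r)))%R.
have cV : continuous (fun r : R => V (s + t - r))%R.
  move=> r; apply: (continuous_comp (f := fun r : R => (s + t - r)%R) (g := V)).
    by apply: cvgB; [exact: cvg_cst|exact: cvg_id].
  exact: CB_flow_continuous.
have cE : continuous (fun r : R => expR (- (delta * r)))%R.
  move=> r; apply: (continuous_comp (f := fun r : R => (- (delta * r))%R) (g := expR)).
    by apply: cvgN; apply: cvgM; [exact: cvg_cst|exact: cvg_id].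
  exact: continuous_expR.
have V0 r : (0 <= V r)%R by exact: (flow_ge0 hv).
have cP : continuous (fun r : R => Psi (V (s + t - r)))%R.
  move=> r; apply/cvgrPdist_le => e e0.
  (* Adding 1 keeps the divisor positive when [m] has mean 0. *)
  have M1 : (0 < delta - b + 1)%R by rewrite ltr_wpDl// (drift_ge0 hphi hdelta).
  have /cvgrPdist_le /(_ (e / (delta - b + 1))%R) h := cV r.
  near=> x; rewrite (le_trans (jump_exponent_dist (V0 _) (V0 _)))//.
  apply: (@le_trans _ _ ((delta - b + 1) * `|V (s + t - r) - V (s + t - x)|)%R).
    by rewrite ler_wpM2r// lerDl.
  rewrite mulrC -ler_pdivlMr//; near: x; apply: h; exact: divr_gt0.
have cf : continuous f by move=> r; apply: cvgM; [exact: cE|exact: cP].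
have cF : continuous F by move=> r; apply: cvgN; apply: cvgM; [exact: cE|exact: cV].
have dF (r : R) : r \in `]s, (s + t)%R[ -> is_derive r (1%R : R) F (f r).
  rewrite in_itv/= => /andP[_ rst].
  have u0 : (0 < s + t - r)%R by rewrite subr_gt0.
  have D := flow_derive hv mechanism_lip l0 u0.
  have D2 : is_derive r (1%R : R) (fun x : R => (s + t - x)%R) (-1)%R.
    apply: is_derive_eq.
    by rewrite add0r mul1r.
  have D3 : is_derive r (1%R : R) (fun x : R => V (s + t - x)%R)
      (- phi (V (s + t - r)) * -1)%R.
    exact: (@is_derive1_comp _ V (fun x : R => (s + t - x)%R) r _ _ D D2).
  have D4 : is_derive r (1%R : R) (fun x : R => expR (- (delta * x)))%R
      (- (delta * expR (- (delta * r))))%R.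
    by apply: is_derive_eq; rewrite /GRing.scale/=; ring.
  rewrite /F; apply: is_derive_eq.
  rewrite (mechanismE hphi hdelta (V0 _)) /f /GRing.scale/=; ring.
transitivity (\int[@lebesgue_measure R]_(r in `[s, (s + t)%R]) (f r)%:E).
  apply: eq_integral => r; rewrite inE/= in_itv/= => /andP[_ rst].
  by rewrite /f /V flowE// subr_ge0.
rewrite (continuous_FTC2 st (continuous_subspaceT cf) (F := F)).
- rewrite /F -EFinB; congr EFin.
  rewrite (_ : s + t - s = t)%R; last by ring.
  rewrite subrr /V !flowE// (v_time0 hv)//; ring.
- split.
  + by move=> r rst; have [] := dF r rst.
  + by apply: cvg_at_right_filter; exact: cF.
  + by apply: cvg_at_left_filter; exact: cF.
- by move=> r rst; rewrite derive1E; have D := dF r rst; rewrite derive_val.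
Unshelve. all: by end_near. Qed.

End immigration_balance.

(** * Path laws and the intensity *)

Definition path_generators (R : realType) (I : set R) : set (set (cadlag_path R)) :=
  \bigcup_(s in I) preimage_set_system [set: cadlag_path R] (coordinate s)
    (@measurable _ (measurableTypeR R)).

Lemma path_filtration_mono (R : realType) (s t : R) : (s <= t)%R ->
  path_filtration s `<=` path_filtration t.
Proof.
move=> st; apply: sub_sigma_algebra2; apply: bigcup_subset => r /=.
by rewrite !in_itv/= => /andP[-> rs]; exact: le_trans rs st.
Qed.

Lemma path_filtration_measurable (R : realType) (t : R) :
  path_filtration t `<=` @measurable _ (cadlag_path R).
Proof.
apply: sub_sigma_algebra2; apply: bigcup_subset => r /=.
by rewrite !in_itv/= => /andP[->].
Qed.

Lemma measurable_coordinate_filtration (R : realType) (s t : R) : (0 <= s)%R -> (s <= t)%R ->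
  measurable_fun setT
    (coordinate s : g_sigma_algebraType (path_generators `[0%R, t]) -> measurableTypeR R).
Proof.
move=> s0 st _ B mB; apply: sub_sigma_algebra; exists s; first by rewrite /= in_itv/= s0.
by exists B.
Qed.

Lemma path_filtration_measurable_fun (R : realType) (t : R) d' (Y : measurableType d')
    (f : cadlag_path R -> Y) :
  measurable_fun setT (f : g_sigma_algebraType (path_generators `[0%R, t]) -> Y) ->
  measurable_fun setT f.
Proof.
move=> mf mT B mB; apply: (@path_filtration_measurable _ t); exact: (mf measurableT B mB).
Qed.

Lemma measurable_coordinate (R : realType) (t : R) :
  measurable_fun setT (coordinate t : cadlag_path R -> measurableTypeR R).
Proof.
have [t0|t0] := leP 0%R t.
  apply: (@path_filtration_measurable_fun _ t).
  exact: measurable_coordinate_filtration.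
rewrite (_ : coordinate t = cst 0%R); first exact: measurable_cst.
by apply/funext => w; exact: path_neg.
Qed.

Section path_law.
Context (R : realType) (v : R -> R -> R).
Variable Q : R -> R.-pker (measurableTypeR R) ~> (measurableTypeR R).
Hypothesis hQ : CB_semigroup v Q.
Variables (x : R) (P : probability (cadlag_path R) R).
Hypothesis x0 : (0 <= x)%R.
Hypothesis hP : CB_law Q x P.

Let mF (s : R) F : (0 <= s)%R -> path_filtration s F -> measurable F.
Proof. by move=> _; exact: path_filtration_measurable. Qed.

(** [markov_process] speaks of probabilities of sets. The two sides are integrals of [g] against two
    mixtures over [F], of Dirac masses at [w (s + t)] and of the kernels [Q t (w s)], and these
    agree on every measurable set. *)
Lemma path_markov (s t : R) F (g : R -> \bar R) : (0 <= s)%R -> (0 <= t)%R ->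
  path_filtration s F -> measurable_fun setT (g : measurableTypeR R -> _) ->
  (forall y, 0 <= g y) ->
  \int[P]_(w in F) g (w (s + t)%R) = \int[P]_(w in F) \int[Q t (w s)]_y g y.
Proof.
move=> s0 t0 sF mg g0; have [[_ [_ _ hM]] _] := hP.
have mFF := mF s0 sF.
have mk1 B : measurable B -> measurable_fun F (fun w : cadlag_path R => Q t (w s) B).
  move=> mB; apply: measurable_funTS.
  by apply: (measurableT_comp (measurable_kernel (Q t) B mB)); exact: measurable_coordinate.
pose dir (w : cadlag_path R) : {measure set (measurableTypeR R) -> \bar R} :=
  @dirac _ (measurableTypeR R) (w (s + t)%R) R.
have mk2 (B : set (measurableTypeR R)) : measurable B -> measurable_fun F (fun w => dir w B).
  move=> mB; apply: measurable_funTS; apply/measurable_EFinP.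
  have mi : measurable_fun setT (\1_B : measurableTypeR R -> R) by exact: measurable_indic.
  exact: (measurableT_comp mi (@measurable_coordinate R (s + t)%R)).
have [nu1 [nu1E _ nu1I]] := mixture_exists P mFF mk1.
have [nu2 [nu2E _ nu2I]] := mixture_exists P mFF mk2.
have E (B : set (measurableTypeR R)) : measurable B -> B `<=` setT -> nu1 B = nu2 B.
  move=> mB _; rewrite nu1E nu2E.
  have [_ /(_ F sF) <-] := hM s t B s0 t0 mB.
  have mpre : measurable (coordinate (s + t) @^-1` B).
    by rewrite -[X in measurable X]setTI; exact: measurable_coordinate.
  by rewrite -integral_indic.
rewrite -nu1I// (eq_measure_integral nu2)// nu2I//.
by apply: eq_integral => w _; rewrite integral_dirac// diracT mul1e.
Qed.

Lemma path_initial (g : R -> \bar R) : measurable_fun setT (g : measurableTypeR R -> _) ->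
  (forall y, 0 <= g y) -> \int[P]_w g (w 0%R) = g x.
Proof.
move=> mg g0; have [_ P1] := hP.
have m1 : measurable [set w : cadlag_path R | coordinate 0%R w = x].
  rewrite -[X in measurable X]setTI.
  exact: (measurable_coordinate 0%R measurableT (measurable_set1 x)).
have mg0 : measurable_fun setT (fun w : cadlag_path R => g (w 0%R)).
  exact: (measurableT_comp mg (@measurable_coordinate _ 0%R)).
rewrite (ge0_ae_eq_integral (g := cst (g x)))//.
  exact: integral_cst_probability.
  by move=> w _; exact: g0.
exists (~` [set w : cadlag_path R | coordinate 0%R w = x]); split; first exact: measurableC.
  exact: probability_compl_null.
by move=> w /= h wx; apply: h => _; move: wx; rewrite /coordinate => ->.
Qed.

Lemma transition_compl_null (t y : R) : (0 <= t)%R -> (0 <= y)%R ->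
  Q t y (~` `[0%R, +oo[%classic) = 0.
Proof.
move=> t0 y0; have [[h1 _ _] _] := hQ.
pose A : set (measurableTypeR R) := `[0%R, +oo[%classic.
have mA : measurable A by exact: measurable_itv.
have hA : Q t y A = 1 := h1 t y t0 y0.
have E : Q t y A + Q t y (~` A) = 1.
  rewrite -measureU ?setICr//; last exact: measurableC.
  by rewrite setUv; exact: prob_kernel.
change (Q t y (~` A) = 0); move: E; rewrite hA.
case: (Q t y (~` A)) => [q| |]// [] /eqP.
by rewrite -[X in _ == X]addr0 (inj_eq (addrI _)) => /eqP ->.
Qed.

(** The integral may run over the whole line: the negative half-line carries no mass, and [expN]
    stays bounded there. *)
Lemma transition_laplace (t l y : R) : (0 <= t)%R -> (0 <= l)%R -> (0 <= y)%R ->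
  \int[Q t y]_u (expN (l * u)%:E)%:E = (expN (y * v t l)%:E)%:E.
Proof.
move=> t0 l0 y0; have [[h1 _ _] h] := hQ.
have vge0 : (0 <= v t l)%R.
  by rewrite -(CB_cumulant_zero hQ t0); exact: (CB_cumulant_mono hQ).
rewrite expN_EFin ?mulr_ge0// -h//.
have mJ : measurable (`[0%R, +oo[%classic : set (measurableTypeR R)) by exact: measurable_itv.
have me : measurable_fun setT (fun u : measurableTypeR R => (expN (l * u)%:E)%:E : \bar R).
  apply/measurable_EFinP; apply: (measurableT_comp (@measurable_expN R)).
  by apply/measurable_EFinP; exact: measurable_funM.
transitivity (\int[Q t y]_(u in `[0%R, +oo[) (expN (l * u)%:E)%:E).
  rewrite [RHS]integral_mkcond; apply: ge0_ae_eq_integral => //.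
  - by apply/(measurable_restrictT _ _).1 => //; exact: measurable_funTS.
  - by move=> u _; rewrite lee_fin expN_ge0.
  - by move=> u _; apply: erestrict_ge0 => z _; rewrite lee_fin expN_ge0.
  exists (~` `[0%R, +oo[%classic); split; first exact: measurableC.
    exact: transition_compl_null.
  by move=> u /= H Ju; apply: H => _; rewrite patchE mem_set.
apply: eq_integral => u; rewrite inE/= in_itv/= andbT => u0.
by rewrite expN_EFin// mulr_ge0.
Qed.

(** The weight [G] is any nonnegative function of the path up to time [s]; later it carries the
    counts, or the reading of the path at its sampling age. *)
Lemma path_laplace_markov (s t l : R) : (0 <= s)%R -> (0 <= t)%R -> (0 <= l)%R ->
  forall G : cadlag_path R -> \bar R,
  measurable_fun setT (G : g_sigma_algebraType (path_generators `[0%R, s]) -> \bar R) ->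
  (forall w, 0 <= G w) ->
  \int[P]_w (G w * (expN (l * w (s + t)%R)%:E)%:E) =
  \int[P]_w (G w * (expN (v t l * w s)%:E)%:E).
Proof.
move=> s0 t0 l0.
have mU (a r : R) : measurable_fun setT (fun w : cadlag_path R => (expN (a * w r)%:E)%:E).
  apply/measurable_EFinP; apply: (measurableT_comp (@measurable_expN R)).
  by apply/measurable_EFinP; apply: measurable_funM => //; exact: measurable_coordinate.
have sub G : measurable_fun setT (G : g_sigma_algebraType (path_generators `[0%R, s]) -> \bar R) ->
    measurable_fun setT (G : cadlag_path R -> \bar R).
  exact: path_filtration_measurable_fun.
have U0 (a r : R) (w : cadlag_path R) : 0 <= (expN (a * w r)%:E)%:E.
  by rewrite lee_fin expN_ge0.
apply: (@ge0_measurable_ind _ (g_sigma_algebraType (path_generators `[0%R, s])) R).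
- move=> A sA.
  have mA : measurable (A : set (cadlag_path R)) by exact: mF s0 sA.
  have E (h : cadlag_path R -> \bar R) : \int[P]_w ((\1_A w)%:E * h w) = \int[P]_(w in A) h w.
    rewrite [RHS]integral_mkcond; apply: eq_integral => w _.
    rewrite patchE indicE; case: ifPn => wA; first by rewrite mul1e.
    by rewrite mul0e.
  rewrite !E (@path_markov s t A (fun y => (expN (l * y)%:E)%:E))//.
  + apply: eq_integral => w _; rewrite transition_laplace ?path_ge0//.
    by rewrite mulrC.
  + apply/measurable_EFinP; apply: (measurableT_comp (@measurable_expN R)).
    by apply/measurable_EFinP; exact: measurable_funM.
  + by move=> y; rewrite lee_fin expN_ge0.
- move=> k G k0 /sub mG G0 IH.
  have Z (a r : R) : \int[P]_w (k%:E * G w * (expN (a * w r)%:E)%:E) =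
      k%:E * \int[P]_w (G w * (expN (a * w r)%:E)%:E).
    rewrite -(@ge0_integralZl_EFin _ _ _ P setT measurableT
      (fun w : cadlag_path R => G w * (expN (a * w r)%:E)%:E) _ _ k k0).
    - by apply: eq_integral => w _; rewrite muleA.
    - by move=> w _; rewrite mule_ge0.
    - exact: (emeasurable_funM mG (mU a r)).
  by rewrite (Z l (s + t)%R) (Z (v t l) s) IH.
- move=> G H /sub mG G0 /sub mH H0 IHG IHH.
  have Z (a r : R) : \int[P]_w ((G w + H w) * (expN (a * w r)%:E)%:E) =
      \int[P]_w (G w * (expN (a * w r)%:E)%:E) +
      \int[P]_w (H w * (expN (a * w r)%:E)%:E).
    rewrite -(@ge0_integralD _ _ _ P setT measurableT
      (fun w : cadlag_path R => G w * (expN (a * w r)%:E)%:E)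
      (fun w : cadlag_path R => H w * (expN (a * w r)%:E)%:E)).
    - by apply: eq_integral => w _; rewrite ge0_muleDl.
    - by move=> w _; rewrite mule_ge0.
    - exact: (emeasurable_funM mG (mU a r)).
    - by move=> w _; rewrite mule_ge0.
    - exact: (emeasurable_funM mH (mU a r)).
  by rewrite (Z l (s + t)%R) (Z (v t l) s) IHG IHH.
- move=> G mG G0 ndG IH.
  have E (a r : R) : \int[P]_w (limn (G ^~ w) * (expN (a * w r)%:E)%:E) =
      limn (fun n => \int[P]_w (G n w * (expN (a * w r)%:E)%:E)).
    rewrite -monotone_convergence//.
    + apply: eq_integral => w _; rewrite limeMr//.
      by apply: ereal_nondecreasing_is_cvgn; exact: ndG.
    + by move=> n; apply: emeasurable_funM => //; apply: sub; exact: mG.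
    + by move=> n w _; rewrite mule_ge0.
    + by move=> w _ i j ij; rewrite lee_wpmul2r//; exact: ndG.
  by rewrite !E; apply: congr_lim; apply/funext => n; exact: IH.
Qed.

Lemma path_laplace (t l : R) : (0 <= t)%R -> (0 <= l)%R ->
  \int[P]_w (expN (l * w t)%:E)%:E = (expN (x * v t l)%:E)%:E.
Proof.
move=> t0 l0.
have := @path_laplace_markov 0%R t l (lexx _) t0 l0 (cst 1) (measurable_cst _) _.
under eq_integral do rewrite mul1e add0r.
under [in RHS]eq_integral do rewrite mul1e.
move=> -> //; rewrite (@path_initial (fun y => (expN (v t l * y)%:E)%:E)).
- by rewrite mulrC.
- apply/measurable_EFinP; apply: (measurableT_comp (@measurable_expN R)).
  by apply/measurable_EFinP; exact: measurable_funM.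
- by move=> y; rewrite lee_fin expN_ge0.
Qed.

End path_law.

Section path_kernel.
Context (R : realType).
Variable Q : R -> R.-pker (measurableTypeR R) ~> (measurableTypeR R).
Variable Qx : R -> probability (cadlag_path R) R.
Hypothesis hQx : forall x : R, (0 <= x)%R -> CB_law Q x (Qx x).

Local Notation J := (`]0%R, +oo[%classic : set (measurableTypeR R)).

Let mJ : measurable J. Proof. exact: measurable_itv. Qed.

Let Jge0 x : J x -> (0 <= x)%R.
Proof. by rewrite /= in_itv/= andbT => /ltW. Qed.

(** Indexing the constraints by the time itself makes repetitions and the order of [s] harmless, so
    times can be sorted and lists concatenated. *)
Let cyl (s : seq R) (B : R -> set (measurableTypeR R)) : set (cadlag_path R) :=
  [set w | forall t, t \in s -> B t (w t)].

Let cyl_filtration (s : seq R) B t : (forall u, measurable (B u)) ->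
  (forall u, u \in s -> (0 <= u <= t)%R) -> path_filtration t (cyl s B).
Proof.
move=> mB; elim: s => [|u s IH] st.
  rewrite (_ : cyl [::] B = setT); last by apply/seteqP; split.
  exact: (@measurableT _ (g_sigma_algebraType (path_generators `[0%R, t]))).
rewrite (_ : cyl (u :: s) B = coordinate u @^-1` (B u) `&` cyl s B).
  apply: (@measurableI _ (g_sigma_algebraType (path_generators `[0%R, t]))).
    have /andP[u0 ut] : (0 <= u <= t)%R by apply: st; rewrite inE eqxx.
    have := measurable_coordinate_filtration u0 ut measurableT (mB u).
    by rewrite setTI.
  by apply: IH => r rs; apply: st; rewrite inE rs orbT.
apply/seteqP; split => w /=.
  by move=> H; split => [|r rs]; apply: H; rewrite inE ?eqxx// rs orbT.
by move=> [H1 H2] r; rewrite inE => /predU1P[->|]//; exact: H2.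
Qed.

(* By the Markov property at the last but one time, the last time of a cylinder
   is integrated out against the transition kernel. *)
Let cyl_measurable (s : seq R) B : (forall u, measurable (B u)) ->
  path <=%R 0%R s ->
  (forall u, u \in s -> (0 <= u <= last 0%R s)%R) /\
  forall g : R -> \bar R, measurable_fun setT (g : measurableTypeR R -> \bar R) ->
  (forall y, 0 <= g y) ->
  measurable_fun J (fun x => \int[Qx x]_(w in cyl s B) g (w (last 0%R s))).
Proof.
move=> mB; elim/last_ind: s => [_|s t IH].
  split => // g mg g0; apply: (eq_measurable_fun g); last exact: measurable_funTS.
  move=> x; rewrite inE => Jx.
  rewrite (_ : cyl [::] B = setT); last by apply/seteqP; split.
  by rewrite (path_initial (hQx (Jge0 Jx))).
rewrite rcons_path last_rcons => /andP[/IH{IH}[sle IH] st].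
have last0 : (0 <= last 0%R s)%R.
  case: (s) sle => [//|u s' H]; have := H (last u s').
  by rewrite mem_last => /(_ isT)/andP[].
split.
  move=> u; rewrite mem_rcons inE => /predU1P[->|/sle/andP[-> ul]].
    by rewrite lexx (le_trans last0 st).
  exact: le_trans ul st.
move=> g mg g0.
pose h y := \int[Q (t - last 0 s)%R y]_z (g \_ (B t)) z.
have mgB : measurable_fun setT (g \_ (B t) : measurableTypeR R -> \bar R).
  by apply/(measurable_restrictT _ _).1 => //; exact: measurable_funTS.
have gB0 y : 0 <= (g \_ (B t)) y by apply: erestrict_ge0.
have mh : measurable_fun setT (h : measurableTypeR R -> \bar R).
  apply: measurable_fun_integral_kernel => // U mU.
  exact: measurable_kernel.
have h0 y : 0 <= h y by exact: integral_ge0.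
apply: (eq_measurable_fun (fun x => \int[Qx x]_(w in cyl s B) h (w (last 0%R s)))); last exact: IH.
move=> x; rewrite inE => Jx.
have dt : (0 <= t - last 0 s)%R by rewrite subr_ge0.
have Fs : path_filtration (last 0%R s) (cyl s B) by exact: cyl_filtration.
rewrite -(path_markov (hQx (Jge0 Jx)) last0 dt Fs mgB gB0) addrC subrK.
have -> : cyl (rcons s t) B = cyl s B `&` (coordinate t @^-1` (B t)).
  apply/seteqP; split => w /=.
    move=> H; split => [r rs|]; apply: H; rewrite mem_rcons inE ?eqxx//.
    by rewrite rs orbT.
  by move=> [H1 H2] r; rewrite mem_rcons inE => /predU1P[->|]//; exact: H1.
by rewrite integral_mkcondr; apply: eq_integral => w _.
Qed.

(** [Qx] is a bare family of laws, so measurability in [x] has to come from the kernels [Q t]. It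
    holds on cylinders once their times are sorted; cylinders form a pi-system, and the good sets a
    Dynkin system. *)
Lemma path_kernel_measurable (A : set (cadlag_path R)) : measurable A ->
  measurable_fun J (fun x => Qx x A).
Proof.
pose G := [set A | exists s B, [/\ forall u : R, measurable (B u),
  forall u, u \in s -> (0 <= u)%R & A = cyl s B]].
have GE : @measurable _ (cadlag_path R) = <<s G>>.
  apply/seteqP; split.
    apply: sub_sigma_algebra2 => _ [u u0 [B mB <-]].
    exists [:: u], (fun=> B); split => //.
      by move=> r; rewrite inE => /eqP ->; move: u0; rewrite /= in_itv/= andbT.
    rewrite setTI; apply/seteqP; split => w /=.
      by move=> H r; rewrite inE => /eqP ->.
    by apply; rewrite inE.
  apply: smallest_sub; first exact: sigma_algebra_measurable.
  move=> _ [s [B [mB s0 ->]]].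
  (* Any common bound of the times would do; for nonnegative times their sum is one. *)
  apply: (@path_filtration_measurable _ (\sum_(u <- s) u)%R).
  apply: cyl_filtration => // u us; rewrite s0//=.
  rewrite (big_rem u us)/= lerDl big_seq; apply: sumr_ge0 => r /mem_rem rs.
  exact: s0.
move=> mA; have sA : <<s G>> A by rewrite -GE.
apply: (dynkin_induction (P := [set A | measurable_fun J (fun x => Qx x A)]) GE _ _ _ _ _ sA).
- move=> _ _ [s1 [B1 [mB1 s10 ->]]] [s2 [B2 [mB2 s20 ->]]].
  exists (s1 ++ s2), (fun u => (if u \in s1 then B1 u else setT) `&`
                               (if u \in s2 then B2 u else setT)); split.
  + by move=> u; apply: measurableI; case: ifP.
  + by move=> u; rewrite mem_cat => /orP[/s10|/s20].
  + apply/seteqP; split => w /=.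
      by move=> [H1 H2] u us; split; case: ifP => // ?; [exact: H1|exact: H2].
    move=> H; split => u us; have := H u; rewrite mem_cat us ?orbT => /(_ isT)[h1 h2].
      exact: h1.
    exact: h2.
- apply: (eq_measurable_fun (cst 1)) => // x _ /=.
  by apply/esym; exact: probability_setT.
- move=> _ [s [B [mB s0 ->]]] /=.
  have E : cyl s B = cyl (sort <=%R s) B.
    by apply/seteqP; split => w /= H u us; apply: H; rewrite mem_sort in us *.
  have srt : path <=%R 0%R (sort <=%R s).
    rewrite path_min_sorted ?sort_le_sorted//.
    by apply/allP => u; rewrite mem_sort => /s0.
  have [_ /(_ (cst 1) (measurable_cst _) _) M] := cyl_measurable mB srt.
  rewrite E; apply: (eq_measurable_fun _ _ (M _)) => // x _.
  rewrite integral_cst ?mul1e//.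
  apply: (@path_filtration_measurable _ (\sum_(u <- s) u)%R).
  apply: cyl_filtration => // u; rewrite mem_sort => us; rewrite s0//=.
  rewrite (big_rem u us)/= lerDl big_seq; apply: sumr_ge0 => r /mem_rem rs.
  exact: s0.
- move=> S mS /= PS; apply: (eq_measurable_fun (fun x => 1 - Qx x S)).
    by move=> x _; rewrite probability_setC.
  by apply: emeasurable_funB => //; exact: measurable_cst.
- move=> F mF tF /= PF.
  apply: (eq_measurable_fun (fun x => \sum_(k <oo) Qx x (F k))).
    move=> x _; rewrite measure_bigcup//; apply: eq_eseriesl => k.
    by rewrite in_setT.
  by apply: ge0_emeasurable_sum => [k x _ _|k _]; [exact: measure_ge0|exact: PF].
Qed.

End path_kernel.

Section evaluation.
Context (R : realType).

Lemma path_right_cvg (w : cadlag_path R) (t : R) : w s @[s --> t^'+] --> w t.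
Proof.
have [t0|t0] := leP 0%R t; first by have [+ _] := path_cadlag w; exact.
rewrite (path_neg w t0); apply: cvg_near_cst.
near=> s; rewrite path_neg//; near: s; exact: nbhs_right_lt.
Unshelve. all: by end_near. Qed.

(* By right continuity [w r] is the limit of [w] along these points, which decrease
   to [r]. *)
Let grid (n : nat) (r : R) : R := ((Num.floor (n.+1%:R * r) + 1)%:~R / n.+1%:R)%R.

Let grid_bounds n r : (r < grid n r <= r + n.+1%:R^-1)%R.
Proof.
have n0 : (0 < n.+1%:R :> R)%R by [].
rewrite /grid ltr_pdivlMr// ler_pdivrMr// mulrDl mulVf ?gt_eqF//.
rewrite [X in (X < _)%R]mulrC [X in (_ <= X + _)%R]mulrC floorD1_gt//=.
by rewrite intrD lerD2r floor_le.
Qed.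

Let grid_cvg r : grid n r @[n --> \oo] --> r.
Proof.
apply: (@squeeze_cvgr _ _ _ _ (fun=> r) (fun n => r + n.+1%:R^-1)%R).
- by apply: nearW => n; have /andP[/ltW -> ->] := grid_bounds n r.
- exact: cvg_cst.
- by rewrite -[X in _ --> X]addr0; apply: cvgD; [exact: cvg_cst|exact: cvg_harmonic].
Qed.

(** The path sampled at the grid point to the right of [r] has preimages that are countable unions
    of rectangles; right continuity passes measurability to the limit. *)
Lemma measurable_evaluation :
  measurable_fun setT (fun p : measurableTypeR R * cadlag_path R => p.2 p.1).
Proof.
apply: (measurable_fun_cvg (h := fun n (p : measurableTypeR R * cadlag_path R) =>
    p.2 (grid n p.1) : R)); last first.
  move=> p _; have /cvg_at_rightP := @path_right_cvg p.2 p.1; apply; split => //.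
  by move=> n; have /andP[] := grid_bounds n p.1.
move=> n _ B mB; rewrite setTI.
rewrite (_ : _ @^-1` B = \bigcup_(k : int) (`[(k%:~R / n.+1%:R)%R, ((k + 1)%:~R / n.+1%:R)%R[ `*`
    (coordinate ((k + 1)%:~R / n.+1%:R) @^-1` B))).
  apply: countable_bigcupT_measurable => // k; apply: measurableX => //.
  by have := @measurable_coordinate R ((k + 1)%:~R / n.+1%:R)%R measurableT B mB; rewrite setTI.
have n0 : (0 < n.+1%:R :> R)%R by [].
apply/seteqP; split => -[r w] /=.
  move=> wB; exists (Num.floor (n.+1%:R * r)) => //; split => //=.
  rewrite in_itv/= ler_pdivrMr// ltr_pdivlMr// mulrC floorD1_gt// andbT.
  exact: floor_le.
move=> [k _ [/=]]; rewrite in_itv/= ler_pdivrMr// ltr_pdivlMr// mulrC => /andP[k1 k2].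
by rewrite /grid (_ : Num.floor _ = k)//; apply/floor_def; rewrite k1 k2.
Qed.

End evaluation.

Section intensity.
Context (R : realType) (b c : R) (m : {measure set (measurableTypeR R) -> \bar R}).
Hypothesis hphi : branching_parameters b c m.
Variable delta : R.
Hypothesis hdelta : derive1 (branching_mechanism b c m) x @[x --> +oo%R] --> delta.
Variable Q : R -> R.-pker (measurableTypeR R) ~> (measurableTypeR R).
Variable Qx : R -> probability (cadlag_path R) R.
Hypothesis hQx : forall x : R, (0 <= x)%R -> CB_law Q x (Qx x).
Variable z : R.
Hypothesis z_gt0 : (0 < z)%R.

Local Notation J := (`]0%R, +oo[%classic : set (measurableTypeR R)).
Local Notation leb := (@lebesgue_measure R).
Local Notation E := (measurableTypeR R * cadlag_path R)%type.
Local Notation S := (J `*` [set: cadlag_path R]).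

Let mJ : measurable J. Proof. exact: measurable_itv. Qed.

(** Sigma-finiteness is what makes the mass of a section of a measurable set a measurable function
    of the entry time. *)
Lemma path_mixture_exists : exists Nm : {sigma_finite_measure set (cadlag_path R) -> \bar R},
  (forall A, measurable A -> Nm A = path_mixture m Qx A) /\
  (forall f, measurable_fun setT f -> (forall y, 0 <= f y) ->
    measurable_fun J (fun x => \int[Qx x]_w f w) /\
    \int[Nm]_w f w = \int[m]_(x in J) \int[Qx x]_w f w).
Proof.
have [nu [nuE nuM nuI]] := mixture_exists m mJ (path_kernel_measurable hQx).
suff sf : sigma_finite setT nu.
  pose H1 := isSFinite.Build _ _ _ _ (sfinite_measure_sigma_finite sf).
  pose H2 := isSigmaFinite.Build _ _ _ _ sf.
  pose nu' : {sigma_finite_measure set (cadlag_path R) -> \bar R} :=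
    HB.pack_for (SigmaFiniteMeasure.type (cadlag_path R) R) (Measure.sort nu) H1 H2.
  have nuE' : forall f, \int[nu']_w f w = \int[nu]_w f w.
    by move=> f; apply: eq_measure_integral => A mA _.
  exists nu'; split; first by move=> A mA; exact: nuE.
  by move=> f mf f0; split; [exact: nuM|rewrite nuE' nuI].
(* Paths are sorted by initial value. Those starting at 0 can join every piece, as [m] is only
   integrated over [x > 0]; the mass of [D n] is that of [[1/(n+1), oo)] under [m]. *)
pose D n := (coordinate 0%R : cadlag_path R -> R) @^-1` `[n.+1%:R^-1%R, +oo[ `|`
            (coordinate 0%R : cadlag_path R -> R) @^-1` [set 0%R].
have mc (B : set (measurableTypeR R)) : measurable B ->
    measurable (coordinate 0%R @^-1` B : set (cadlag_path R)).
  move=> mB; rewrite -[X in measurable X]setTI.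
  exact: (measurable_coordinate 0%R measurableT mB).
have n0 n : (0 < n.+1%:R^-1 :> R)%R by [].
have mD n : measurable (D n).
  by apply: measurableU; apply: mc; [exact: measurable_itv|exact: measurable_set1].
exists D.
  apply/seteqP; split => // w _.
  have := path_ge0 w 0%R; rewrite le_eqVlt => /predU1P[w0|w0].
    by exists 0%N => //; right.
  exists (truncn (w 0%R)^-1) => //; left; rewrite /= in_itv/= andbT /coordinate.
  by rewrite -[leRHS]invrK lef_pV2 ?posrE ?invr_gt0// ltW// truncnS_gt.
move=> n; split; first exact: mD.
rewrite nuE; apply: (@le_lt_trans _ _
  (m (`[n.+1%:R^-1%R, +oo[%classic : set (measurableTypeR R)))); last first.
  exact: (jump_tail_finite hphi hdelta).
have sJ : (`[n.+1%:R^-1%R, +oo[%classic : set (measurableTypeR R)) `<=` J.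
  by move=> u /=; rewrite !in_itv/= !andbT; exact: lt_le_trans.
rewrite -(setIidl sJ) -integral_indic//.
rewrite le_eqVlt; apply/orP; left; apply/eqP.
apply: eq_integral => x; rewrite inE/= => Jx.
have x0 : (0 < x)%R by move: Jx; rewrite in_itv/= andbT.
rewrite -[Qx x (D n)]mul1e -integral_cst//.
transitivity (\int[Qx x]_w (\1_(`[n.+1%:R^-1%R, +oo[ `|` [set 0%R]) (w 0%R) : R)%:E).
  rewrite integral_mkcond; apply: eq_integral => w _.
  rewrite patchE indicE; have [wD|wD] := pselect (D n w).
    by rewrite mem_set// mem_set.
  by rewrite memNset// memNset.
have mU : measurable (`[n.+1%:R^-1%R, +oo[%classic `|` [set 0%R] : set (measurableTypeR R)).
  by apply: measurableU; [exact: measurable_itv|exact: measurable_set1].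
rewrite (path_initial (hQx (ltW x0))
  (g := fun y => (\1_(`[n.+1%:R^-1%R, +oo[ `|` [set 0%R]) y : R)%:E)).
- rewrite !indicE; have [h|h] := pselect ((`[n.+1%:R^-1%R, +oo[%classic : set R) x).
    by rewrite !mem_set//; left.
  rewrite !memNset//; case=> // /= xx; by rewrite xx ltxx in x0.
- by apply/measurable_EFinP; exact: measurable_indic.
- by move=> y; rewrite lee_fin.
Qed.

Let g (s : R) := (z * expR (- (delta * s)))%R.

Let g_ge0 s : (0 <= g s)%R. Proof. by rewrite mulr_ge0 ?expR_ge0// ltW. Qed.

Let mg : measurable_fun setT g.
Proof.
apply: measurable_funM => //; apply: measurableT_comp; first exact: measurable_expR.
by apply: measurableT_comp => //; exact: measurable_funM.
Qed.

(** The intensity is given set by set, through its sections. It is realised as the mixture over [s]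
    of the images of the path measure under [w |-> (s, w)], scaled by the rate; this yields the
    iterated integral on which the later computations rest. *)
Lemma intensity_exists : exists mu : {measure set E -> \bar R},
  (forall B, measurable B -> mu B = immigration_intensity z delta (path_mixture m Qx) B) /\
  (forall f : E -> \bar R, measurable_fun setT f -> (forall y, 0 <= f y) ->
    measurable_fun J (fun s => (g s)%:E * \int[m]_(x in J) \int[Qx x]_w f (s, w)) /\
    \int[mu]_(p in S) f p =
    \int[leb]_(s in J) ((g s)%:E * \int[m]_(x in J) \int[Qx x]_w f (s, w))).
Proof.
have [Nm [NmE NmI]] := path_mixture_exists.
pose dir (s : R) (w : cadlag_path R) : {measure set E -> \bar R} := @dirac _ E (s, w) R.
have mdir s B : measurable B -> measurable_fun setT (fun w => dir s w B).
  move=> mB; apply/measurable_EFinP.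
  have mi : measurable_fun setT (\1_B : E -> R) by exact: measurable_indic.
  exact: (measurableT_comp mi (@pair1_measurable _ _ (measurableTypeR R) _ s)).
have /choice[k Hk] : forall s, exists nu : {measure set E -> \bar R},
    (forall A, measurable A -> nu A = Nm (xsection A s)) /\
    (forall f, measurable_fun setT f -> (forall y, 0 <= f y) ->
      \int[nu]_y f y = \int[Nm]_w f (s, w)).
  move=> s; have [nu [nuE _ nuI]] := mixture_exists Nm measurableT (mdir s).
  exists nu; split.
    move=> A mA; rewrite nuE /=; under eq_integral do rewrite /dir diracE.
    rewrite -[RHS]mul1e -integral_cst//; last exact: measurable_xsection.
    rewrite [RHS]integral_mkcond; apply: eq_integral => w _.
    by rewrite patchE mem_xsection; case: ifP.
  move=> f mf f0; rewrite nuI//; apply: eq_integral => w _.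
  by rewrite integral_dirac// diracT mul1e.
pose K s : {measure set E -> \bar R} := mscale (NngNum (g_ge0 s)) (k s).
have KE s A : measurable A -> K s A = (g s)%:E * Nm (xsection A s).
  by move=> mA; rewrite /K /= /mscale/= (Hk s).1.
have mK A : measurable A -> measurable_fun J (fun s => K s A).
  move=> mA; apply: measurable_funTS.
  under eq_fun do rewrite KE//.
  apply: emeasurable_funM; first exact/measurable_EFinP.
  exact: (measurable_fun_xsection Nm mA).
have [mu [muE muM muI]] := mixture_exists leb mJ mK.
exists mu; split.
  move=> B mB; rewrite muE; apply: eq_integral => s _; rewrite KE// NmE//.
  exact: measurable_xsection.
have KI f s : measurable_fun setT f -> (forall y, 0 <= f y) ->
    \int[K s]_y f y = (g s)%:E * \int[m]_(x in J) \int[Qx x]_w f (s, w).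
  move=> mf f0; rewrite ge0_integral_mscale//= (Hk s).2//; congr (_ * _).
  rewrite (NmI (fun w => f (s, w)) _ _).2//.
  exact: (measurableT_comp mf (@pair1_measurable _ _ (measurableTypeR R) _ s)).
move=> f mf f0; split.
  by apply: (eq_measurable_fun _ _ (muM f mf f0)) => s _; rewrite KI.
have mS : measurable S by exact: measurableX.
have mfS : measurable_fun setT (f \_ S).
  by apply/(measurable_restrictT _ _).1 => //; exact: measurable_funTS.
have fS0 y : 0 <= (f \_ S) y by apply: erestrict_ge0.
rewrite integral_mkcond muI//; apply: eq_integral => s; rewrite inE => Js.
rewrite KI//; congr (_ * _); apply: eq_integral => x _; apply: eq_integral => w _.
by rewrite patchE mem_set.
Qed.

End intensity.

(** * The Markov property of the immigration process *)

Lemma poisson_random_measure_intensity d d' (R : realType) (Omega : measurableType d)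
    (P : probability Omega R) (E : measurableType d') (S : set E) (mu nu : set E -> \bar R)
    (N : R.-ker Omega ~> E) : (forall B, measurable B -> mu B = nu B) ->
  poisson_random_measure P S nu N -> poisson_random_measure P S mu N.
Proof.
move=> mn [h1 h2 h3 h4]; split => //.
  by move=> B mB BS; rewrite mn//; exact: h2.
by move=> B mB BS; rewrite mn//; exact: h3.
Qed.

Lemma integral_onem_probability d (T : measurableType d) (R : realType)
    (P : probability T R) (h : T -> R) :
  measurable_fun setT h -> (forall x, 0 <= h x <= 1)%R ->
  \int[P]_x (1 - h x)%:E = 1 - \int[P]_x (h x)%:E.
Proof.
move=> mh h01; rewrite integralB_EFin//.
- by rewrite (integral_cst_probability P).
- by apply: (@le1_integrable _ _ _ P (cst 1%R)) => // x; rewrite ler01 lexx.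
- exact: le1_integrable.
Qed.

(** In use [f] and [g] are the densities in the entry time of the exponents with horizons [s + t]
    and [s]: they coincide up to [s], and only [f] sees entries in [(s, s + t]]. *)
Lemma integral_window (R : realType) (s t : R) (f g : measurableTypeR R -> \bar R) :
  (0 <= s)%R -> (0 <= t)%R ->
  measurable_fun (`]0%R, +oo[%classic : set (measurableTypeR R)) f ->
  measurable_fun (`]0%R, +oo[%classic : set (measurableTypeR R)) g ->
  (forall r, 0 <= f r) -> (forall r, 0 <= g r) ->
  (forall r, (0 < r)%R -> (r <= s)%R -> f r = g r) ->
  (forall r, (s < r)%R -> g r = 0) -> (forall r, (s + t < r)%R -> f r = 0) ->
  \int[@lebesgue_measure R]_(r in `]0%R, +oo[) f r =
  \int[@lebesgue_measure R]_(r in `]0%R, +oo[) g r +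
  \int[@lebesgue_measure R]_(r in `]s, (s + t)%R]) f r.
Proof.
move=> s0 t0 mf mg f0 g0 fg gs fst.
pose A : set (measurableTypeR R) := `]0%R, s]%classic.
pose B : set (measurableTypeR R) := `]s, (s + t)%R]%classic.
pose C : set (measurableTypeR R) := `](s + t)%R, +oo[%classic.
have mA : measurable A by exact: measurable_itv.
have mB : measurable B by exact: measurable_itv.
have mC : measurable C by exact: measurable_itv.
have JE : (`]0%R, +oo[%classic : set (measurableTypeR R)) = A `|` B `|` C.
  apply/seteqP; split => r; rewrite /A /B /C /= !in_itv/= ?andbT.
    move=> r0; rewrite r0/=; case: (leP r s) => rs; first by left; left.
    by case: (leP r (s + t)%R) => rst; [left; right|right].
  move=> [[/andP[]//|/andP[sr _]]|str]; first exact: le_lt_trans sr.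
  by apply: le_lt_trans str; rewrite addr_ge0.
have dAB : [disjoint A & B].
  apply/disj_setPS => r; rewrite /A /B /= !in_itv/= => -[/andP[_ rs] /andP[sr _]].
  by move: sr; rewrite ltNge rs.
have dABC : [disjoint A `|` B & C].
  apply/disj_setPS => r; rewrite /A /B /C /= !in_itv/= andbT => -[[/andP[_ rs]|/andP[_ rst]]] str.
    by move: str; rewrite ltNge (le_trans rs)// lerDl.
  by move: str; rewrite ltNge rst.
have splitJ (h : measurableTypeR R -> \bar R) :
    measurable_fun (`]0%R, +oo[%classic : set (measurableTypeR R)) h -> (forall r, 0 <= h r) ->
    \int[@lebesgue_measure R]_(r in `]0%R, +oo[) h r =
    \int[@lebesgue_measure R]_(r in A) h r + \int[@lebesgue_measure R]_(r in B) h r +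
    \int[@lebesgue_measure R]_(r in C) h r.
  rewrite JE => mh h0; rewrite ge0_integral_setU//; last exact: measurableU.
  rewrite ge0_integral_setU//; apply: measurable_funS mh.
    by apply: measurableU => //; exact: measurableU.
  exact: subsetUl.
rewrite (splitJ f)// (splitJ g)//.
have -> : \int[@lebesgue_measure R]_(r in C) f r = 0.
  by apply: integral0_eq => r; rewrite /C /= in_itv/= andbT; exact: fst.
have -> : \int[@lebesgue_measure R]_(r in C) g r = 0.
  apply: integral0_eq => r; rewrite /C /= in_itv/= andbT => str; apply: gs.
  by apply: le_lt_trans str; rewrite lerDl.
have -> : \int[@lebesgue_measure R]_(r in B) g r = 0.
  by apply: integral0_eq => r; rewrite /B /= in_itv/= => /andP[sr _]; exact: gs.
have -> : \int[@lebesgue_measure R]_(r in A) f r = \int[@lebesgue_measure R]_(r in A) g r.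
  by apply: eq_integral => r; rewrite inE /A /= in_itv/= => /andP[r0 rs]; exact: fg.
by rewrite !adde0.
Qed.

Section immigration.
Context (R : realType) (b c : R) (m : {measure set (measurableTypeR R) -> \bar R}).
Hypothesis hphi : branching_parameters b c m.
Variable delta : R.
Hypothesis hdelta : derive1 (branching_mechanism b c m) x @[x --> +oo%R] --> delta.
Variable v : R -> R -> R.
Hypothesis hv : cumulant_semigroup (branching_mechanism b c m) v.
Variable Q : R -> R.-pker (measurableTypeR R) ~> (measurableTypeR R).
Hypothesis hQ : CB_semigroup v Q.
Variable Qx : R -> probability (cadlag_path R) R.
Hypothesis hQx : forall x : R, (0 <= x)%R -> CB_law Q x (Qx x).
Variables (d : measure_display) (Omega : measurableType d) (P : probability Omega R).
Variable z : R.
Hypothesis z_gt0 : (0 < z)%R.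

Local Notation J := (`]0%R, +oo[%classic : set (measurableTypeR R)).
Local Notation leb := (@lebesgue_measure R).
Local Notation E := (measurableTypeR R * cadlag_path R)%type.
Local Notation S := (J `*` [set: cadlag_path R]).
Local Notation Psi := (jump_exponent m).
Local Notation rate := (fun s => z * expR (- (delta * s)))%R.

Variable N : R.-ker Omega ~> E.
Variable mu : {measure set E -> \bar R}.
Hypothesis hmu : forall f : E -> \bar R, measurable_fun setT f -> (forall y, 0 <= f y) ->
  measurable_fun J (fun s => (rate s)%:E * \int[m]_(x in J) \int[Qx x]_w f (s, w)) /\
  \int[mu]_(p in S) f p =
  \int[leb]_(s in J) ((rate s)%:E * \int[m]_(x in J) \int[Qx x]_w f (s, w)).
Hypothesis hN : poisson_random_measure P S mu N.

Let mJ : measurable J. Proof. exact: measurable_itv. Qed.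
Let mS : measurable S. Proof. exact: measurableX. Qed.

Let Jgt0 x : J x -> (0 < x)%R. Proof. by rewrite /= in_itv/= andbT. Qed.

Lemma rate_ge0 s : (0 <= rate s)%R. Proof. by rewrite mulr_ge0 ?expR_ge0// ltW. Qed.

Lemma cumulant_ge0 (t l : R) : (0 <= t)%R -> (0 <= l)%R -> (0 <= v t l)%R.
Proof. exact: (v_ge0 hv). Qed.

(** Clans entering at a fixed time start from a mass distributed as [m]; a Laplace functional
    [e^(-x V)] from each [x] then integrates to [Psi V] by the very form of [Psi]. *)
Lemma jump_slice (f : cadlag_path R -> \bar R) (V : R) : (0 <= V)%R ->
  measurable_fun setT f ->
  (forall x, (0 < x)%R -> \int[Qx x]_w (expN (f w))%:E = (expN (x * V)%:E)%:E) ->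
  \int[m]_(x in J) \int[Qx x]_w (1 - expN (f w))%:E = (Psi V)%:E.
Proof.
move=> V0 mf H; rewrite (jump_exponentE hphi hdelta)//.
apply: eq_integral => x; rewrite inE => /Jgt0 x0.
have me : measurable_fun setT (fun w => expN (f w)).
  exact: (measurableT_comp (@measurable_expN R) mf).
rewrite integral_onem_probability//; last by move=> w; exact: expN01.
by rewrite H// expN_EFin ?mulr_ge0 ?(ltW x0)// mulrC.
Qed.

(* Vanishes at atoms [(s, w)] with [s > t], as paths are [0] at negative times. *)
Definition clan_mass (t : R) (p : E) : \bar R := (p.2 (t - p.1)%R)%:E.

Lemma measurable_clan_mass t : measurable_fun setT (clan_mass t).
Proof.
apply/measurable_EFinP.
have m1 : measurable_fun setT (fun p : E => ((t - p.1)%R : measurableTypeR R, p.2)).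
  apply: measurable_fun_pair => //=.
  by apply: measurable_funB => //; exact: measurable_fst.
exact: (measurableT_comp (@measurable_evaluation R) m1).
Qed.

Lemma clan_mass_ge0 t p : 0 <= clan_mass t p.
Proof. by rewrite lee_fin path_ge0. Qed.

(** The cut-off at [t] is absorbed by the convention that paths vanish at negative times; all
    horizons then share the domain [S]. *)
Lemma immigration_processE t w : immigration_process z delta N t w =
  (rate t)%:E + \int[N w]_(p in S) clan_mass t p.
Proof.
rewrite /immigration_process; congr (_ + _).
have -> : \int[N w]_(p in S) clan_mass t p =
    \int[N w]_(p in S) (clan_mass t \_ (`]-oo, t]%classic `*` [set: cadlag_path R])) p.
  apply: eq_integral => p _; rewrite patchE; case: ifPn => // /negP h.
  rewrite /clan_mass path_neg// subr_lt0 ltNge; apply/negP => pt; apply: h.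
  by apply/mem_set; split => //=; rewrite in_itv.
rewrite -integral_mkcondr; congr (integral _ _ _).
apply/seteqP; split => -[r u] /=; rewrite !in_itv/= ?andbT.
  by move=> [/andP[-> ->]].
by move=> [[-> _] [-> _]].
Qed.

Let measurable_sum_rectangles (l : seq (R * set (cadlag_path R))) :
  (forall i, List.In i l -> measurable i.2) -> measurable_fun setT
    (fun p : E => \sum_(i <- l) (\1_(`]0%R, i.1]%classic `*` i.2 : set E) p : R)%:E).
Proof.
elim: l => [_|i l IH hA].
  by under eq_fun do rewrite big_nil; exact: measurable_cst.
under eq_fun do rewrite big_cons; apply: emeasurable_funD.
  apply/measurable_EFinP/measurable_indic; apply: measurableX => //.
  by apply: hA; left.
by apply: IH => j jl; apply: hA; right.
Qed.

Section list_of_counts.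
Variable s : R.
Variable L : seq (R * set (cadlag_path R)).
Hypothesis s0 : (0 <= s)%R.
Hypothesis hL : forall i, List.In i L -> (0 <= i.1 <= s)%R /\ path_filtration (s - i.1)%R i.2.

(** Its integral against [N] is the sum of the counts in [L], so that counts and process enter one
    Laplace functional through [count_sum + l * clan_mass]. *)
Definition count_sum (p : E) : \bar R :=
  \sum_(i <- L) (\1_(`]0%R, i.1]%classic `*` i.2 : set E) p : R)%:E.

Lemma count_sum_ge0 p : 0 <= count_sum p.
Proof. by apply: sume_ge0 => i _; rewrite lee_fin. Qed.

Let mA i : List.In i L -> measurable i.2.
Proof. by move=> /hL[_ /path_filtration_measurable]. Qed.

Lemma measurable_count_sum : measurable_fun setT count_sum.
Proof. exact: measurable_sum_rectangles. Qed.

Lemma integral_count_sum w : \int[N w]_(p in S) count_sum p =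
  \sum_(i <- L) N w (`]0%R, i.1]%classic `*` i.2).
Proof.
rewrite /count_sum; elim: L mA => [_|i l IH hA].
  by rewrite big_nil; under eq_integral do rewrite big_nil; rewrite integral0.
rewrite big_cons -IH; last by move=> j jl; apply: hA; right.
have mX : measurable (`]0%R, i.1]%classic `*` i.2 : set E).
  by apply: measurableX => //; apply: hA; left.
under eq_integral do rewrite big_cons.
have ml : measurable_fun S
    (fun p : E => \sum_(j <- l) (\1_(`]0%R, j.1]%classic `*` j.2 : set E) p : R)%:E).
  apply: measurable_funTS; apply: measurable_sum_rectangles => j jl.
  by apply: hA; right.
rewrite (@ge0_integralD _ _ _ (N w) S mS
  (fun p => (\1_(`]0%R, i.1]%classic `*` i.2 : set E) p : R)%:E)
  (fun p => \sum_(j <- l) (\1_(`]0%R, j.1]%classic `*` j.2 : set E) p : R)%:E)) => //.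
- rewrite integral_indic//; congr (N w _ + _); apply/setIidl => -[r u] /=.
  by rewrite !in_itv/= => -[/andP[-> _]].
- by apply/measurable_EFinP; exact: measurable_indic.
- by move=> p _; apply: sume_ge0 => j _; rewrite lee_fin.
Qed.

(** The shape of the filtration matters here. An atom at [r <= s] is not seen by a rectangle with
    [u < r], while one with [u >= r] tests its path up to age [s - u], hence within age [s - r]. *)
Let count_slice_measurable (r : R) : (0 < r)%R -> (r <= s)%R ->
  measurable_fun setT ((fun w => count_sum (r, w)) :
    g_sigma_algebraType (path_generators `[0%R, (s - r)%R]) -> \bar R).
Proof.
move=> r0 rs; pose T := g_sigma_algebraType (path_generators `[0%R, (s - r)%R]).
rewrite /count_sum; elim: L hL => [_|i l IH hl].
  apply: (@eq_measurable_fun _ _ T _ _ (cst 0)); last exact: measurable_cst.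
  by move=> w _; rewrite big_nil.
apply: (@eq_measurable_fun _ _ T _ _ (fun w : cadlag_path R =>
  (\1_(`]0%R, i.1]%classic `*` i.2 : set E) (r, w) : R)%:E +
  \sum_(j <- l) (\1_(`]0%R, j.1]%classic `*` j.2 : set E) (r, w) : R)%:E)).
  by move=> w _; rewrite big_cons.
apply: (@emeasurable_funD _ T); last by apply: IH => j jl; apply: hl; right.
apply/measurable_EFinP; have [iu iA] := hl i (or_introl erefl).
have [ri|ri] := leP r i.1.
  rewrite (_ : (fun w => _) = (\1_(i.2) : cadlag_path R -> R)); last first.
    apply/funext => w; rewrite !indicE; congr (_%:R); congr nat_of_bool.
    apply/idP/idP => /set_mem h; apply/mem_set; first by case: h.
    by split => //=; rewrite in_itv/= r0.
  apply: (@measurable_indic _ (g_sigma_algebraType (path_generators `[0%R, (s - r)%R]))).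
  by apply: path_filtration_mono iA; rewrite lerD2l lerN2.
rewrite (_ : (fun w => _) = (cst 0%R : cadlag_path R -> R)); first exact: measurable_cst.
apply/funext => w; rewrite indicE memNset//= => -[/=].
by rewrite in_itv/= => /andP[_ h] _; rewrite leNgt ri in h.
Qed.

Let count_slice0 (r : R) w : (s < r)%R -> count_sum (r, w) = 0.
Proof.
move=> sr; rewrite /count_sum; elim: L hL => [_|i l IH hl]; first by rewrite big_nil.
rewrite big_cons IH ?adde0; last by move=> j jl; apply: hl; right.
have [/andP[_ iu] _] := hl i (or_introl erefl).
rewrite indicE memNset//= => -[/=]; rewrite in_itv/= => /andP[_ h] _.
by move: sr; rewrite ltNge (le_trans h iu).
Qed.

Let mlin (a t : R) : measurable_fun setT (fun p : E => a%:E * clan_mass t p).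
Proof. by apply: measurable_funeM; exact: measurable_clan_mass. Qed.

Let mtot (a t : R) : measurable_fun setT (fun p : E => count_sum p + a%:E * clan_mass t p).
Proof. by apply: emeasurable_funD; [exact: measurable_count_sum|exact: mlin]. Qed.

Let mexp (a t : R) : measurable_fun setT
  (fun p : E => (1 - expN (count_sum p + a%:E * clan_mass t p))%:E).
Proof.
apply/measurable_EFinP/measurable_funB => //.
exact: (measurableT_comp (@measurable_expN R) (mtot a t)).
Qed.

Let exp_ge0 (a t : R) (p : E) :
  0 <= (1 - expN (count_sum p + a%:E * clan_mass t p))%:E.
Proof. by rewrite lee_fin subr_ge0 expN_le1. Qed.

Let slice (a t r : R) := (rate r)%:E * \int[m]_(x in J) \int[Qx x]_w
  (1 - expN (count_sum (r, w) + a%:E * clan_mass t (r, w)))%:E.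

Let slice_ge0 a t r : 0 <= slice a t r.
Proof.
rewrite mule_ge0 ?lee_fin ?rate_ge0//; apply: integral_ge0 => x _.
by apply: integral_ge0 => w _; exact: exp_ge0.
Qed.

Let mslice a t : measurable_fun J (slice a t).
Proof. by have [] := hmu (mexp a t) (exp_ge0 a t). Qed.

(** The counts depend on the path up to age [s - r] only, so they serve as the weight in the Markov
    property at that age. *)
Let slice_early (t l r : R) : (0 <= t)%R -> (0 <= l)%R -> (0 < r)%R -> (r <= s)%R ->
  slice l (s + t)%R r = slice (v t l) s r.
Proof.
move=> t0 l0 r0 rs; rewrite /slice; apply: (congr1 (mule (rate r)%:E)).
apply: eq_integral => x; rewrite inE => /Jgt0 x0.
have sr0 : (0 <= s - r)%R by rewrite subr_ge0.
have ms (a u : R) : measurable_fun setT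
    (fun w => expN (count_sum (r, w) + a%:E * clan_mass u (r, w))).
  apply: (measurableT_comp (@measurable_expN R)).
  exact: (measurableT_comp (mtot a u) (@pair1_measurable _ _ (measurableTypeR R) _ r)).
have onem (a u : R) : \int[Qx x]_w (1 - expN (count_sum (r, w) + a%:E * clan_mass u (r, w)))%:E =
    1 - \int[Qx x]_w (expN (count_sum (r, w) + a%:E * clan_mass u (r, w)))%:E.
  exact: (integral_onem_probability (Qx x) (ms a u) (fun w => expN01 _)).
rewrite (onem l (s + t)%R) (onem (v t l) s); apply: (congr1 (fun y => 1 - y)).
have split_exp (a u : R) w : (0 <= a)%R ->
    (expN (count_sum (r, w) + a%:E * clan_mass u (r, w)))%:E =
    (expN (count_sum (r, w)))%:E * (expN (a * w (u - r)%R)%:E)%:E.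
  by move=> a0; rewrite expND ?count_sum_ge0 ?mule_ge0 ?clan_mass_ge0// EFinM.
under eq_integral do rewrite split_exp//.
under [RHS]eq_integral do rewrite split_exp ?cumulant_ge0//.
have := @path_laplace_markov _ v Q hQ x (Qx x) (hQx (ltW x0)) (s - r)%R t l sr0 t0 l0
  (fun w => (expN (count_sum (r, w)))%:E).
rewrite (_ : s - r + t = s + t - r)%R; last by ring.
apply.
- apply/measurable_EFinP; apply: (measurableT_comp (@measurable_expN R)).
  exact: count_slice_measurable.
- by move=> w; rewrite lee_fin expN_ge0.
Qed.

Let slice_after (a r : R) : (s < r)%R -> slice a s r = 0.
Proof.
move=> sr; rewrite /slice integral0_eq ?mule0// => x _; apply: integral0_eq => w _.
by rewrite count_slice0// /clan_mass path_neg ?subr_lt0// mule0 adde0 expN0 subrr.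
Qed.

Let slice_late (t l r : R) : (0 <= l)%R -> (s < r)%R -> (r <= s + t)%R ->
  slice l (s + t)%R r = (rate r * Psi (v (s + t - r) l))%:E.
Proof.
move=> l0 sr rst; rewrite /slice [RHS]EFinM; apply: (congr1 (mule (rate r)%:E)).
have u0 : (0 <= s + t - r)%R by rewrite subr_ge0.
apply: jump_slice; first exact: cumulant_ge0.
  exact: (measurableT_comp (mtot l (s + t)%R) (@pair1_measurable _ _ (measurableTypeR R) _ r)).
move=> x x0; rewrite -(path_laplace hQ (hQx (ltW x0)) u0 l0).
by apply: eq_integral => w _; rewrite count_slice0// add0e.
Qed.

Let slice_beyond (a t r : R) : (0 <= t)%R -> (s + t < r)%R -> slice a (s + t)%R r = 0.
Proof.
move=> t0 str; have sr : (s < r)%R by apply: le_lt_trans str; rewrite lerDl.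
rewrite /slice integral0_eq ?mule0// => x _; apply: integral0_eq => w _.
by rewrite count_slice0// /clan_mass path_neg ?subr_lt0// mule0 adde0 expN0 subrr.
Qed.

Let slice_window (t l : R) : (0 <= t)%R -> (0 <= l)%R ->
  \int[leb]_(r in `]s, (s + t)%R]) slice l (s + t)%R r =
  (z * (expR (- (delta * s)) * v t l - expR (- (delta * (s + t))) * l))%:E.
Proof.
move=> t0 l0; pose f r := (expR (- (delta * r)) * Psi (v (s + t - r) l))%R.
have sE r : (`]s, (s + t)%R]%classic : set R) r -> slice l (s + t)%R r = z%:E * (f r)%:E.
  rewrite /= in_itv/= => /andP[sr rst].
  by rewrite slice_late// -EFinM /f mulrA.
(* Measurability of [f] is inherited from the slice, which equals [z f] on this interval. *)
have mf : measurable_fun `]s, (s + t)%R] (EFin \o f).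
  apply: (@eq_measurable_fun _ _ _ _ _ (fun r => (z^-1)%:E * slice l (s + t)%R r)).
    by move=> r /set_mem sr; rewrite sE//= -EFinM mulKf// gt_eqF.
  apply: measurable_funeM; apply: measurable_funS (mslice l (s + t)%R) => //.
  by move=> r /=; rewrite !in_itv/= andbT => /andP[sr _]; exact: le_lt_trans sr.
rewrite EFinM -(immigration_balance hphi hdelta hv s t0 l0).
apply: (etrans _ (congr1 (mule z%:E) (integral_itv_obnd_cbnd mf))).
have f0 r : (`]s, (s + t)%R]%classic : set R) r -> 0 <= (EFin \o f) r.
  rewrite /= in_itv/= => /andP[sr rst]; rewrite lee_fin mulr_ge0 ?expR_ge0//.
  apply: jump_exponent_ge0; apply: cumulant_ge0 => //.
  by rewrite subr_ge0.
have mI : measurable (`]s, (s + t)%R]%classic : set (measurableTypeR R)) by exact: measurable_itv.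
apply: (etrans _ (ge0_integralZl_EFin leb mI f0 mf (ltW z_gt0))).
by apply: eq_integral => r /set_mem; exact: sE.
Qed.

(** The window contributes [z e^(-delta s) v_t(l) - z e^(-delta (s + t)) l]: the negative part
    cancels the deterministic term at time [s + t], the positive part is the one at time [s]. This
    balance dictates the deterministic part [z e^(-delta t)] of the process. *)
Lemma exponent_balance (t l : R) : (0 <= t)%R -> (0 <= l)%R ->
  (l * rate (s + t)%R)%:E +
    \int[mu]_(p in S) (1 - expN (count_sum p + l%:E * clan_mass (s + t)%R p))%:E =
  (v t l * rate s)%:E +
    \int[mu]_(p in S) (1 - expN (count_sum p + (v t l)%:E * clan_mass s p))%:E.
Proof.
move=> t0 l0.
have muE (a u : R) : \int[mu]_(p in S) (1 - expN (count_sum p + a%:E * clan_mass u p))%:E =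
    \int[leb]_(r in J) slice a u r by exact: (hmu (mexp a u) (exp_ge0 a u)).2.
have H := integral_window s0 t0 (mslice l (s + t)%R) (mslice (v t l) s)
  (slice_ge0 l (s + t)%R) (slice_ge0 (v t l) s) (fun r => @slice_early t l r t0 l0)
  (fun r => @slice_after (v t l) r) (fun r => @slice_beyond l t r t0).
have alg (I I1 I2 : \bar R) (x y k : R) : I1 = I + k%:E -> I2 = I -> (x + k = y)%R ->
    x%:E + I1 = y%:E + I2.
  by move=> -> -> <-; rewrite addeCA -EFinD addeC.
apply: (alg _ _ _ _ _ _ (etrans (muE l (s + t)%R) (etrans H (congr1 (adde _) (slice_window t0 l0))))
  (muE (v t l) s)).
ring.
Qed.

End list_of_counts.

End immigration.

(** * Joint Laplace functionals of the counts and the process *)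

Section immigration_markov.
Context (R : realType) (b c : R) (m : {measure set (measurableTypeR R) -> \bar R}).
Hypothesis hphi : branching_parameters b c m.
Variable delta : R.
Hypothesis hdelta : derive1 (branching_mechanism b c m) x @[x --> +oo%R] --> delta.
Variable v : R -> R -> R.
Hypothesis hv : cumulant_semigroup (branching_mechanism b c m) v.
Variable Q : R -> R.-pker (measurableTypeR R) ~> (measurableTypeR R).
Hypothesis hQ : CB_semigroup v Q.
Variable Qx : R -> probability (cadlag_path R) R.
Hypothesis hQx : forall x : R, (0 <= x)%R -> CB_law Q x (Qx x).
Variables (d : measure_display) (Omega : measurableType d) (P : probability Omega R).
Variable z : R.
Hypothesis z_gt0 : (0 < z)%R.

Local Notation J := (`]0%R, +oo[%classic : set (measurableTypeR R)).
Local Notation leb := (@lebesgue_measure R).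
Local Notation E := (measurableTypeR R * cadlag_path R)%type.
Local Notation S := (J `*` [set: cadlag_path R]).
Local Notation Psi := (jump_exponent m).
Local Notation rate := (fun s => z * expR (- (delta * s)))%R.

Variable N : R.-ker Omega ~> E.
Variable mu : {measure set E -> \bar R}.
Hypothesis hmu : forall f : E -> \bar R, measurable_fun setT f -> (forall y, 0 <= f y) ->
  measurable_fun J (fun s => (rate s)%:E * \int[m]_(x in J) \int[Qx x]_w f (s, w)) /\
  \int[mu]_(p in S) f p =
  \int[leb]_(s in J) ((rate s)%:E * \int[m]_(x in J) \int[Qx x]_w f (s, w)).
Hypothesis hN : poisson_random_measure P S mu N.

Let mJ : measurable J. Proof. exact: measurable_itv. Qed.
Let mS : measurable S. Proof. exact: measurableX. Qed.

Local Notation X := (immigration_process z delta N).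

Let r0 s : (0 <= rate s)%R. Proof. exact: rate_ge0. Qed.

Lemma measurable_immigration t : measurable_fun setT (X t).
Proof.
apply: (@eq_measurable_fun _ _ _ _ _
    (fun w => (rate t)%:E + \int[N w]_(p in S) clan_mass t p)).
  by move=> w _; rewrite immigration_processE.
apply: emeasurable_funD; first exact: measurable_cst.
apply: measurable_kernel_integral => //; first exact: measurable_clan_mass.
exact: clan_mass_ge0.
Qed.

Lemma immigration_ge0 t w : 0 <= X t w.
Proof.
rewrite immigration_processE adde_ge0 ?lee_fin//.
by apply: integral_ge0 => p _; exact: clan_mass_ge0.
Qed.

Definition count_test (s : R) (i : R * set (cadlag_path R)) : Prop :=
  (0 <= i.1 <= s)%R /\ path_filtration (s - i.1)%R i.2.

Definition count (i : R * set (cadlag_path R)) (w : Omega) : \bar R :=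
  N w (`]0%R, i.1]%classic `*` i.2).

Lemma count_ge0 i w : 0 <= count i w.
Proof. exact: measure_ge0. Qed.

Lemma measurable_count s i : count_test s i -> measurable_fun setT (count i).
Proof.
move=> [_ /path_filtration_measurable mA].
by apply: (measurable_kernel N); apply: measurableX.
Qed.

Lemma laplace_immigration (s a t : R) (L : seq (R * set (cadlag_path R))) :
  (0 <= a)%R -> (forall i, List.In i L -> count_test s i) ->
  \int[P]_w ((\prod_(i <- L) expN (count i w)) * expN (a%:E * X t w))%:E =
  (expN ((a * rate t)%:E +
    \int[mu]_(p in S) (1 - expN (count_sum L p + a%:E * clan_mass t p))%:E))%:E.
Proof.
move=> a0 hL.
have mL : measurable_fun setT (count_sum L) by exact: (measurable_count_sum (s := s)).
have mC : measurable_fun setT (fun p => a%:E * clan_mass t p : \bar R).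
  by apply: measurable_funeM; exact: measurable_clan_mass.
have C0 p : 0 <= a%:E * clan_mass t p by rewrite mule_ge0 ?clan_mass_ge0.
have L0 (p : E) : 0 <= count_sum L p by exact: count_sum_ge0.
have mT : measurable_fun setT (fun p : E => count_sum L p + a%:E * clan_mass t p).
  exact: emeasurable_funD.
have T0 p : 0 <= count_sum L p + a%:E * clan_mass t p by rewrite adde_ge0.
have I0 : 0 <= \int[mu]_(p in S) (1 - expN (count_sum L p + a%:E * clan_mass t p))%:E.
  by apply: integral_ge0 => p _; rewrite lee_fin subr_ge0 expN_le1.
have ar0 : 0 <= (a * rate t)%:E by rewrite lee_fin mulr_ge0.
rewrite expND// EFinM -(poisson_laplace mS hN mT T0).
have mX : measurable_fun setT
    (fun w => (expN (\int[N w]_(p in S) (count_sum L p + a%:E * clan_mass t p)))%:E : \bar R).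
  apply/measurable_EFinP; apply: (measurableT_comp (@measurable_expN R)).
  exact: measurable_kernel_integral.
rewrite -ge0_integralZl_EFin ?expN_ge0//; last by move=> w _; rewrite lee_fin expN_ge0.
apply: eq_integral => w _; rewrite -EFinM; apply: congr1.
rewrite -expN_sum; last by move=> i; exact: count_ge0.
have -> : \int[N w]_(p in S) (count_sum L p + a%:E * clan_mass t p) =
    \sum_(i <- L) count i w + a%:E * \int[N w]_(p in S) clan_mass t p.
  rewrite ge0_integralD//; last 2 first.
  - exact: measurable_funTS.
  - exact: measurable_funTS.
  rewrite (integral_count_sum N hL w) ge0_integralZl_EFin//.
  - by move=> p _; exact: clan_mass_ge0.
  - by apply: measurable_funTS; exact: measurable_clan_mass.
have K0 : 0 <= \int[N w]_(p in S) clan_mass t p.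
  by apply: integral_ge0 => p _; exact: clan_mass_ge0.
have S0 : 0 <= \sum_(i <- L) count i w by apply: sume_ge0 => i _; exact: count_ge0.
rewrite immigration_processE ge0_muleDr ?lee_fin// -EFinM.
by rewrite !expND ?mule_ge0 ?lee_fin// mulrCA.
Qed.

Lemma laplace_markov (s t l : R) (L : seq (R * set (cadlag_path R))) :
  (0 <= s)%R -> (0 <= t)%R -> (0 <= l)%R -> (forall i, List.In i L -> count_test s i) ->
  \int[P]_w ((\prod_(i <- L) expN (count i w)) * expN (l%:E * X (s + t)%R w))%:E =
  \int[P]_w ((\prod_(i <- L) expN (count i w)) * expN ((v t l)%:E * X s w))%:E.
Proof.
move=> s0 t0 l0 hL.
have vl : (0 <= v t l)%R by exact: (cumulant_ge0 hv).
rewrite (laplace_immigration (s + t) l0 hL) (laplace_immigration s vl hL).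
by rewrite (exponent_balance hphi hdelta hv hQ hQx z_gt0 hmu s0 hL t0 l0).
Qed.

Lemma laplace_immigration0 (t l : R) : (0 <= t)%R -> (0 <= l)%R ->
  \int[P]_w (expN (l%:E * X t w))%:E = (expN (v t l * z)%:E)%:E.
Proof.
move=> t0 l0.
have vl : (0 <= v t l)%R by exact: (cumulant_ge0 hv).
have := @laplace_markov 0%R t l [::] (lexx _) t0 l0 (fun i => False_ind _).
under eq_integral do rewrite big_nil mul1r add0r.
under [X in _ = X]eq_integral do rewrite big_nil mul1r.
move=> ->.
transitivity (\int[P]_w (expN (v t l * z)%:E)%:E); last exact: integral_cst_probability.
(* At time 0 no atom contributes, entry times being positive: [X_0 = z]. *)
apply: eq_integral => w _; rewrite immigration_processE.
rewrite integral0_eq; first by rewrite adde0 -EFinM mulr0 oppr0 expR0 mulr1.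
move=> -[r u] [/= ]; rewrite in_itv/= andbT => ru _.
by rewrite /clan_mass/= sub0r path_neg// oppr_lt0.
Qed.

(** [e^-y >= 1 - y] and [v_t(l) <= e^(-b t) l] bound the Laplace transform below by
    [1 - z e^(-b t) l]. *)
Lemma immigration_finite (t : R) : (0 <= t)%R -> P [set w | X t w < +oo] = 1.
Proof.
move=> t0; apply: (@laplace_finite _ _ _ P _ (z * expR (- (b * t)))%R).
- by rewrite mulr_ge0 ?expR_ge0 ?(ltW z_gt0).
- exact: measurable_immigration.
move=> l l0; rewrite (laplace_immigration0 t0 (ltW l0)).
rewrite EFinB; apply: le_trans (expN_ge1B _); last first.
  by rewrite lee_fin mulr_ge0 ?(ltW z_gt0)// (cumulant_ge0 hv)// ltW.
rewrite leeB// lee_fin [X in (X <= _)%R]mulrC -mulrA ler_wpM2l ?(ltW z_gt0)//.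
exact: (CB_cumulant_le hphi hdelta hv hQ t0 (ltW l0)).
Qed.

(** Counts take values in [[0, +oo]], while uniqueness by moments asks for functions into [[0, 1]];
    [expN] being injective on [[0, +oo]], no event is lost by passing to [expN] of the counts. *)
Lemma immigration_filtration_generated (s : R) (F : set Omega) :
  immigration_filtration N s F ->
  <<s [set B | exists (i : {i | count_test s i}) (C : set R), measurable C /\
      B = (fun w => expN (count (proj1_sig i) w)) @^-1` C] >> F.
Proof.
apply: smallest_sub; first exact: smallest_sigma_algebra.
move=> _ [u [A [C [us uA mC ->]]]]; apply: sub_sigma_algebra.
exists (exist _ (u, A) (conj us uA)), (@lnN R @^-1` C); split.
  by rewrite -[Y in measurable Y]setTI; exact: (@measurable_lnN R).
by apply/seteqP; split => w /=; rewrite expNK// count_ge0.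
Qed.

(* The measures [w |-> e^(-l X_(s+t)) dP] and [w |-> e^(-v_t(l) X_s) dP] agree on
   products of [e^(-N((0, u] x A))], hence on the generated sigma-algebra. *)
Lemma laplace_markov_filtration (s t l : R) (F : set Omega) :
  (0 <= s)%R -> (0 <= t)%R -> (0 <= l)%R -> immigration_filtration N s F ->
  \int[P]_(w in F) (expN (l%:E * X (s + t)%R w))%:E =
  \int[P]_(w in F) (expN ((v t l)%:E * X s w))%:E.
Proof.
move=> s0 t0 l0 sF.
have mexp (a u : R) : measurable_fun setT (fun w => expN (a%:E * X u w)).
  apply: (measurableT_comp (@measurable_expN R)).
  by apply: measurable_funeM; exact: measurable_immigration.
(* The measure with density [e^(-a X_u)], as a mixture of Dirac masses scaled by the density. *)
have dens (a u : R) : exists nu : {measure set Omega -> \bar R},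
    (forall A, measurable A -> nu A = \int[P]_(w in A) (expN (a%:E * X u w))%:E) /\
    (forall f : Omega -> R, measurable_fun setT f -> (forall w, 0 <= f w)%R ->
      \int[nu]_w (f w)%:E = \int[P]_w (f w * expN (a%:E * X u w))%:E).
  pose k w : {measure set Omega -> \bar R} :=
    mscale (NngNum (expN_ge0 (a%:E * X u w))) (@dirac _ Omega w R).
  have mk A : measurable A -> measurable_fun setT (fun w => k w A).
    move=> mA; rewrite /k /mscale/=; apply: emeasurable_funM.
      by apply/measurable_EFinP; exact: mexp.
    by apply/measurable_EFinP; exact: measurable_indic.
  have [nu [nuE _ nuI]] := mixture_exists P measurableT mk.
  exists nu; split.
    move=> A mA; rewrite nuE [RHS]integral_mkcond; apply: eq_integral => w _.
    have -> : k w A = (expN (a%:E * X u w))%:E * (w \in A)%:R%:E by [].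
    rewrite patchE; case: ifP => _; first by rewrite mule1.
    by rewrite mule0.
  move=> f mf f0; rewrite nuI//; last exact/measurable_EFinP.
  apply: eq_integral => w _; rewrite ge0_integral_mscale//=; last 2 first.
    exact/measurable_EFinP.
    by move=> ? _; rewrite lee_fin.
  rewrite integral_dirac//; last exact/measurable_EFinP.
  by rewrite diracT mul1e -EFinM mulrC.
have [nu1 [nu1E nu1I]] := dens l (s + t)%R.
have [nu2 [nu2E nu2I]] := dens (v t l) s.
have fin (nu : {measure set Omega -> \bar R}) (a u : R) :
    (forall A, measurable A -> nu A = \int[P]_(w in A) (expN (a%:E * X u w))%:E) ->
    nu setT < +oo.
  move=> E1; rewrite E1//; apply: (@le_lt_trans _ _ 1); last exact: ltry.
  rewrite -(integral_cst_probability P 1); apply: ge0_le_integral => //.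
  - by move=> w _; rewrite lee_fin expN_ge0.
  - by apply/measurable_EFinP; exact: mexp.
  - by move=> w _; rewrite lee_fin expN_le1.
have mF : measurable F.
  have := immigration_filtration_generated sF.
  apply: smallest_sub; first exact: sigma_algebra_measurable.
  move=> _ [i [C [mC ->]]]; rewrite -[Y in measurable Y]setTI.
  apply: (measurableT_comp (@measurable_expN R)) => //.
  exact: (measurable_count (proj2_sig i)).
rewrite -nu1E// -nu2E//.
apply: (moment_unique (fin _ _ _ nu1E) (fin _ _ _ nu2E)
  (h := fun (i : {i | count_test s i}) w => expN (count (proj1_sig i) w))).
- move=> i; apply: (measurableT_comp (@measurable_expN R)).
  exact: (measurable_count (proj2_sig i)).
- by move=> i w; exact: expN01.
- move=> L; have mp : measurable_fun setT
      (fun w => \prod_(i <- L) expN (count (proj1_sig i) w))%R.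
    elim: L => [|i L IH]; first by under eq_fun do rewrite big_nil; exact: measurable_cst.
    under eq_fun do rewrite big_cons; apply: measurable_funM => //.
    apply: (measurableT_comp (@measurable_expN R)).
    exact: (measurable_count (proj2_sig i)).
  have p0 w : (0 <= \prod_(i <- L) expN (count (proj1_sig i) w))%R.
    by apply: prodr_ge0 => i _; exact: expN_ge0.
  apply: (etrans (nu1I _ mp p0) (etrans _ (esym (nu2I _ mp p0)))).
  have hL : forall i, List.In i (map (@proj1_sig _ _) L) -> count_test s i.
    move=> i; elim: L {mp p0} => [//|j L IH] /= [<-|]; [exact: (proj2_sig j)|exact: IH].
  have := laplace_markov s0 t0 l0 hL.
  under eq_integral do rewrite big_map.
  by under [X in _ = X]eq_integral do rewrite big_map.
- exact: immigration_filtration_generated.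
Qed.

End immigration_markov.

(** * Augmentation and adaptedness *)

Lemma expN_norm (R : realType) (r : R) : expN (`|r|)%:E = expN r%:E :> R.
Proof. by rewrite /expN /= normr_id. Qed.

(** The [k]-th identity equates the [k]-th moments of [e^-y] under two finite measures on the line:
    the law of [Y] on [F], and the integral over [F] of the kernels [Q t (X w)]. Uniqueness by
    moments with one function identifies them. *)
Lemma transition_of_laplace (R : realType) (v : R -> R -> R)
    (Q : R -> R.-pker (measurableTypeR R) ~> (measurableTypeR R)) (hQ : CB_semigroup v Q)
    d (Omega : measurableType d) (P : probability Omega R) (X Y : Omega -> R)
    (F : set Omega) (t : R) :
  measurable_fun setT X -> measurable_fun setT Y ->
  (forall w, 0 <= X w)%R -> (forall w, 0 <= Y w)%R -> (0 <= t)%R -> measurable F ->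
  (forall k : nat, \int[P]_(w in F) (expN (k%:R * Y w)%:E)%:E =
     \int[P]_(w in F) (expN (v t k%:R * X w)%:E)%:E) ->
  forall B : set (measurableTypeR R), measurable B ->
  P (Y @^-1` B `&` F) = \int[P]_(w in F) Q t (X w) B.
Proof.
move=> mX mY X0 Y0 t0 mF H B mB.
pose dir (w : Omega) : {measure set (measurableTypeR R) -> \bar R} :=
  @dirac _ (measurableTypeR R) (Y w) R.
have mk1 (A : set (measurableTypeR R)) : measurable A -> measurable_fun F (fun w => dir w A).
  move=> mA; apply: measurable_funTS; apply/measurable_EFinP.
  have mi : measurable_fun setT (\1_A : measurableTypeR R -> R) by exact: measurable_indic.
  exact: (measurableT_comp mi mY).
have mk2 (A : set (measurableTypeR R)) : measurable A ->
    measurable_fun F (fun w => Q t (X w) A).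
  move=> mA; apply: measurable_funTS.
  exact: (measurableT_comp (measurable_kernel (Q t) A mA) mX).
have [nu1 [nu1E _ nu1I]] := mixture_exists P mF mk1.
have [nu2 [nu2E _ nu2I]] := mixture_exists P mF mk2.
have PF : \int[P]_(w in F) 1 < +oo.
  rewrite integral_cst// mul1e; exact: le_lt_trans (probability_le1 P mF) (ltry _).
have fin1 : nu1 setT < +oo.
  rewrite nu1E; apply: le_lt_trans PF; rewrite le_eqVlt; apply/orP; left; apply/eqP.
  by apply: eq_integral => w _; exact: diracT.
have fin2 : nu2 setT < +oo.
  rewrite nu2E; apply: le_lt_trans PF; rewrite le_eqVlt; apply/orP; left; apply/eqP.
  by apply: eq_integral => w _; exact: prob_kernel.
pose h (_ : unit) (y : measurableTypeR R) : R := expN (`|y|)%:E.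
have mh i : measurable_fun setT (h i).
  apply: (measurableT_comp (@measurable_expN R)); apply/measurable_EFinP.
  exact: normr_measurable.
have h01 i y : (0 <= h i y <= 1)%R by exact: expN01.
have hk (l : seq unit) y : (\prod_(i <- l) h i y)%R = expN ((size l)%:R * y)%:E.
  transitivity (expN (`|y|)%:E ^+ size l : R)%R.
    elim: l => [|i l IH]; first by rewrite big_nil expr0.
    by rewrite big_cons IH exprS.
  by rewrite -expN_natmul ?lee_fin// -EFinM -expN_norm -[RHS]expN_norm !normrM normr_id.
have mhk k : measurable_fun setT (fun y : measurableTypeR R => (expN (k%:R * y)%:E)%:E : \bar R).
  apply/measurable_EFinP; apply: (measurableT_comp (@measurable_expN R)).
  by apply/measurable_EFinP; exact: measurable_funM.
have E : forall l : seq unit, \int[nu1]_y (\prod_(i <- l) h i y)%:E =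
    \int[nu2]_y (\prod_(i <- l) h i y)%:E.
  move=> l; under eq_integral do rewrite hk; under [RHS]eq_integral do rewrite hk.
  have hk0 (y : measurableTypeR R) : 0 <= (expN ((size l)%:R * y)%:E)%:E.
    by rewrite lee_fin expN_ge0.
  apply: (etrans (nu1I _ (mhk _) hk0) (etrans _ (esym (nu2I _ (mhk _) hk0)))).
  transitivity (\int[P]_(w in F) (expN ((size l)%:R * Y w)%:E)%:E).
    apply: eq_integral => w _; rewrite integral_dirac//.
    have -> : dir w setT = 1 by exact: diracT.
    by rewrite mul1e.
  rewrite H; apply: eq_integral => w _.
  by rewrite (transition_laplace hQ)// mulrC.
(* [h] only sees [|y|], so uniqueness applies to the symmetric set [A], which agrees with [B] on
   [[0, oo)]. *)
pose A : set (measurableTypeR R) := normr @^-1` B.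
have sA : <<s [set B0 | exists i (C : set R), measurable C /\ B0 = h i @^-1` C] >> A.
  apply: sub_sigma_algebra; exists tt, ((fun u : R => - ln u)%R @^-1` B); split.
    rewrite -[Z in measurable Z]setTI.
    have ml : measurable_fun setT (fun u : R => - ln u)%R.
      by apply: measurableT_comp => //; exact: measurable_ln.
    exact: ml.
  apply/seteqP; split => y; rewrite /A /h /= expN_EFin//= expRK opprK//.
have mA : measurable A.
  by rewrite -[Z in measurable Z]setTI; apply: normr_measurable.
have := moment_unique fin1 fin2 mh h01 E sA.
rewrite nu1E nu2E => EA.
have mYB : measurable (Y @^-1` B) by rewrite -[Z in measurable Z]setTI; exact: mY.
rewrite -integral_indic//.
apply: (etrans (etrans _ EA)).
  apply: eq_integral => w _; have -> : dir w A = (\1_A (Y w) : R)%:E by [].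
  rewrite !indicE; apply: congr1; congr (nat_of_bool _)%:R.
  by apply/idP/idP => /set_mem h1; apply/mem_set; move: h1; rewrite /A /= ger0_norm.
apply: eq_integral => w _.
(* [A] and [B] differ at most on the negative half-line, a null set for the kernel. *)
pose D : set (measurableTypeR R) := ~` `[0%R, +oo[%classic.
have mD : measurable D by apply: measurableC; exact: measurable_itv.
have D0 : Q t (X w) D = 0 by exact: (transition_compl_null hQ).
rewrite -(measureU0 mA mD D0) -(measureU0 mB mD D0); apply: congr1.
apply/seteqP; split => y /= [h1|h1]; try by right.
  have [y0|y0] := leP 0%R y; first by left; move: h1; rewrite /A /= ger0_norm.
  by right; rewrite /D /= in_itv/= andbT; apply/negP; rewrite -ltNge.
have [y0|y0] := leP 0%R y; first by left; rewrite /A /= ger0_norm.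
by right; rewrite /D /= in_itv/= andbT; apply/negP; rewrite -ltNge.
Qed.

Section augmentation.
Context (R : realType) d (Omega : measurableType d) (P : probability Omega R).
Variable G : set (set Omega).
Hypothesis sG : sigma_algebra setT G.
Hypothesis mG : G `<=` measurable.

Lemma augmentation_sigma_algebra : sigma_algebra setT (augmentation P G).
Proof. exact: smallest_sigma_algebra. Qed.

Lemma augmentation_measurable : augmentation P G `<=` measurable.
Proof.
apply: smallest_sub; first exact: sigma_algebra_measurable.
by move=> A [/mG|[]].
Qed.

Lemma augmentation_null A : measurable A -> P A = 0 -> augmentation P G A.
Proof. by move=> mA A0; apply: sub_sigma_algebra; right. Qed.

(** The events that agree with an event of [G] off a null set form a sigma-algebra containing the
    generators of the augmentation. The Markov property is thereby reduced to events of [G]. *)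
Lemma augmentation_ae F : augmentation P G F ->
  exists F' Z, [/\ G F', measurable Z, P Z = 0 & forall w, ~ Z w -> (F w <-> F' w)].
Proof.
move=> aF; pose K := [set F : set Omega | exists F' Z,
  [/\ G F', measurable Z, P Z = 0 & forall w, ~ Z w -> (F w <-> F' w)]].
suff : K F by [].
have [G0 GC GU] := sG.
apply: smallest_sub aF; last first.
  move=> A [GA|[mA A0]].
    by exists A, set0; split => //; rewrite measure0.
  by exists set0, A; split => // w nAw; split.
split.
- by exists set0, set0; split => //; rewrite measure0.
- move=> A [A' [Z [GA' mZ Z0 AA']]]; exists (setT `\` A'), Z; split => //.
    exact: GC.
  by move=> w /AA' h /=; split => -[_ nA]; split => // ?; apply: nA; apply/h.
- move=> A /choice[A' /choice[Z hZ]].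
  exists (\bigcup_i A' i), (\bigcup_i Z i); split.
  + by apply: GU => i; have [] := hZ i.
  + by apply: bigcup_measurable => i _; have [] := hZ i.
  + apply/eqP; rewrite eq_le measure_ge0 andbT.
    have h : P (\bigcup_i Z i) <= \sum_(i <oo) P (Z i).
      apply: measure_sigma_subadditive => //.
      * by move=> i; have [] := hZ i.
      * by apply: bigcup_measurable => i _; have [] := hZ i.
    apply: le_trans h _; rewrite eseries0// => i _ _.
    by have [] := hZ i.
  + move=> w nZ; have nZi i : ~ Z i w by move=> Zi; apply: nZ; exists i.
    by split => -[i _ h]; exists i => //; have [_ _ _ hi] := hZ i; apply/(hi w (nZi i)).
Qed.

Lemma integral_augmentation F F' Z (f : Omega -> \bar R) :
  measurable F -> measurable F' -> measurable Z -> P Z = 0 ->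
  (forall w, ~ Z w -> (F w <-> F' w)) ->
  measurable_fun setT f -> (forall w, 0 <= f w) ->
  \int[P]_(w in F) f w = \int[P]_(w in F') f w.
Proof.
move=> mF mF' mZ Z0 FF' mf f0.
rewrite integral_mkcond [RHS]integral_mkcond; apply: ge0_ae_eq_integral => //.
- by apply/(measurable_restrictT _ _).1 => //; exact: measurable_funTS.
- by apply/(measurable_restrictT _ _).1 => //; exact: measurable_funTS.
- by move=> w _; apply: erestrict_ge0.
- by move=> w _; apply: erestrict_ge0.
exists Z; split => // w /= h; apply: contrapT => nZ; apply: h => _.
rewrite !patchE; have [h1 h2] := FF' w nZ.
have [Fw|nFw] := pselect (F w); first by rewrite !mem_set//; exact: h1.
by rewrite !memNset// => /h2.
Qed.

End augmentation.

Section augmentation_limit.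
Context (R : realType) d (Omega : measurableType d) (P : probability Omega R).
Variable G : set (set Omega).
Hypothesis mG : G `<=` measurable.

Local Notation GT := (g_sigma_algebraType (G `|` [set A | measurable A /\ P A = 0])).

Lemma augmentation_measurable_fun d' (T : measurableType d') (f : Omega -> T) :
  measurable_fun setT (f : GT -> T) -> measurable_fun setT f.
Proof.
move=> mf _ B mB; rewrite setTI; apply: (augmentation_measurable (P := P) mG).
by have := mf measurableT B mB; rewrite setTI.
Qed.

(** The augmentation adds null events that are measurable in [Omega], not their arbitrary subsets;
    measurability of [g] puts the part of its preimages inside [Z] among them. *)
Lemma ae_measurable_fun d' (T : measurableType d') (f g : Omega -> T) :
  measurable_fun setT (f : GT -> T) -> measurable_fun setT g ->
  {ae P, forall w, f w = g w} -> measurable_fun setT (g : GT -> T).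
Proof.
move=> mf mg [Z [mZ Z0 fg]] _ B mB; rewrite setTI.
have mgB : measurable (g @^-1` B) by rewrite -[Y in measurable Y]setTI; exact: mg.
have -> : g @^-1` B = (f @^-1` B `&` ~` Z) `|` (g @^-1` B `&` Z).
  apply/seteqP; split => w /=.
    have [Zw|nZw] := pselect (Z w); first by right.
    left; split => //; suff -> : f w = g w by [].
    by apply: contrapT => h; apply: nZw; exact: fg.
  move=> [[fB nZw]|[]//]; suff <- : f w = g w by [].
  by apply: contrapT => h; apply: nZw; exact: fg.
apply: (@measurableU _ GT).
  apply: (@measurableI _ GT).
    by have := mf measurableT B mB; rewrite setTI.
  by apply: (@measurableC _ GT); exact: augmentation_null.
apply: augmentation_null; first exact: measurableI.
apply/eqP; rewrite eq_le measure_ge0 andbT -Z0; apply: le_measure; rewrite ?inE//.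
exact: measurableI.
Qed.

(** Summable mean squares make the sum of the squared errors finite almost surely, so the sequence
    converges almost surely; its upper limit is measurable for the augmentation and equals [g] off a
    null event. *)
Lemma L2_limit_measurable (C : R) (f : nat -> Omega -> R) (g : Omega -> R) :
  (forall n, measurable_fun setT (f n : GT -> R)) -> measurable_fun setT g -> (0 <= C)%R ->
  (forall n, \int[P]_w ((f n w - g w) ^+ 2)%:E <= (C / (2 ^ n.+1)%:R)%:E) ->
  measurable_fun setT (g : GT -> R).
Proof.
move=> mf mg C0 H; pose q n w := ((f n w - g w) ^+ 2)%R.
have q0 n w : 0 <= (q n w)%:E by rewrite lee_fin sqr_ge0.
have mq n : measurable_fun setT (fun w => (q n w)%:E).
  apply/measurable_EFinP; apply: measurable_funX; apply: measurable_funB => //.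
  exact: augmentation_measurable_fun.
pose S w := \sum_(n <oo) (q n w)%:E.
have S0 w : 0 <= S w by apply: nneseries_ge0.
have mS : measurable_fun setT S by apply: ge0_emeasurable_sum.
have IS : \int[P]_w S w < +oo.
  rewrite integral_nneseries//; apply: le_lt_trans (ltry C).
  apply: le_trans (epsilon_trick0 xpredT C0).
  by apply: lee_nneseries => n *; [exact: integral_ge0|exact: H].
have iS : P.-integrable setT S.
  by apply/integrableP; split => //; under eq_integral do rewrite gee0_abs//.
pose h w := fine (limn_esup (fun n => (f n w)%:E)).
have mh : measurable_fun setT (h : GT -> R).
  apply: (@measurableT_comp _ _ _ GT _ _ (@fine R)); first exact: fine_measurable.
  by apply: (@measurable_fun_limn_esup _ GT) => n; apply/measurable_EFinP; exact: mf.
apply: ae_measurable_fun mh mg _.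
apply: filterS (integrable_ae measurableT iS) => w /(_ I) Sw.
have q0' n : (0 <= q n w)%R by exact: sqr_ge0.
have := nnseries_is_cvg q0'.
have Soo : \sum_(k <oo) (q k w)%:E < +oo by rewrite -ge0_fin_numE//; exact: S0.
move=> /(_ Soo) /cvg_series_cvg_0 /=.
move=> /(cvg_comp _ _)/(_ (@sqrt_continuous R 0%R)).
rewrite sqrtr0 => q_cvg.
have fg : f n w @[n --> \oo] --> g w.
  apply/subr_cvg0/norm_cvg0P; apply: cvg_trans q_cvg; apply: near_eq_cvg.
  by apply: nearW => n /=; rewrite sqrtr_sqr.
have fgE : (f n w)%:E @[n --> \oo] --> (g w)%:E by apply: cvg_EFin => //; exact: nearW.
by rewrite /h (cvg_limn_einf_sup fgE).2.
Qed.

End augmentation_limit.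

(** [e^-y >= e^-x e^-D >= e^-x (1 - D)]; the additive form of the gap admits infinite [x] and
    [y]. *)
Lemma expN_gap (R : realType) (x y : \bar R) (D : R) : 0 <= x -> 0 <= y -> (0 <= D)%R ->
  y <= x + D%:E -> (expN x <= expN y + D)%R.
Proof.
move=> x0 y0 D0 h; rewrite -lerBlDr.
apply: le_trans (expN_nincr y0 h); rewrite expND ?lee_fin//.
have := expN_ge1B (_ : 0 <= D%:E); rewrite lee_fin => /(_ D0).
rewrite -EFinB lee_fin => h1.
apply: (@le_trans _ _ (expN x * (1 - D))%R); last by rewrite ler_wpM2l ?expN_ge0.
by rewrite mulrBr mulr1 lerD2l lerN2 ler_piMl ?expN_le1.
Qed.

Lemma L2_of_laplace d (Omega : measurableType d) (R : realType) (P : probability Omega R)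
    (Y X : Omega -> \bar R) (e : R -> R -> R) :
  measurable_fun setT Y -> measurable_fun setT X -> (forall w, 0 <= Y w) -> (forall w, 0 <= X w) ->
  (forall a a', (0 <= a)%R -> (0 <= a')%R ->
    \int[P]_w (expN (a%:E * Y w + a'%:E * X w))%:E = (e a a')%:E) ->
  \int[P]_w ((expN (Y w) - expN (X w)) ^+ 2)%:E = (e 2 0 - 2 * e 1 1 + e 0 2)%:E.
Proof.
move=> mY mX Y0 X0 H.
have me (Z : Omega -> \bar R) : measurable_fun setT Z ->
    measurable_fun setT (fun w => expN (Z w)).
  exact: (measurableT_comp (@measurable_expN R)).
have mL (a a' : R) : measurable_fun setT (fun w => (expN (a%:E * Y w + a'%:E * X w))%:E).
  by apply/measurable_EFinP/me; apply: emeasurable_funD; exact: measurable_funeM.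
have L0 (a a' : R) w : 0 <= (expN (a%:E * Y w + a'%:E * X w))%:E.
  by rewrite lee_fin expN_ge0.
have q0 w : 0 <= ((expN (Y w) - expN (X w)) ^+ 2)%:E by rewrite lee_fin sqr_ge0.
have mq : measurable_fun setT (fun w => ((expN (Y w) - expN (X w)) ^+ 2)%:E).
  by apply/measurable_EFinP; apply: measurable_funX; apply: measurable_funB; exact: me.
(* The cross term is moved to the left, so that only nonnegative functions are integrated. *)
have E1 : \int[P]_w (((expN (Y w) - expN (X w)) ^+ 2)%:E +
      2%:E * (expN (1%:E * Y w + 1%:E * X w))%:E) =
    \int[P]_w ((expN (2%:E * Y w + 0%:E * X w))%:E + (expN (0%:E * Y w + 2%:E * X w))%:E).
  apply: eq_integral => w _; rewrite !mul1e !mul0e adde0 add0e expND//.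
  rewrite !(expN_natmul 2)// -EFinM -!EFinD; congr EFin; ring.
move: E1; rewrite ge0_integralD//; last 2 first.
- by move=> w _; rewrite mule_ge0.
- exact: measurable_funeM.
rewrite ge0_integralZl_EFin// H// ge0_integralD// !H// -EFinM -EFinD.
case: (\int[P]_w _) => [r| |]//; rewrite -EFinD => -[E1].
by congr EFin; lra.
Qed.

(** * Adaptedness by sampling paths on a grid *)

Section immigration_adapted.
Context (R : realType) (b c : R) (m : {measure set (measurableTypeR R) -> \bar R}).
Hypothesis hphi : branching_parameters b c m.
Variable delta : R.
Hypothesis hdelta : derive1 (branching_mechanism b c m) x @[x --> +oo%R] --> delta.
Variable v : R -> R -> R.
Hypothesis hv : cumulant_semigroup (branching_mechanism b c m) v.
Variable Q : R -> R.-pker (measurableTypeR R) ~> (measurableTypeR R).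
Hypothesis hQ : CB_semigroup v Q.
Variable Qx : R -> probability (cadlag_path R) R.
Hypothesis hQx : forall x : R, (0 <= x)%R -> CB_law Q x (Qx x).
Variables (d : measure_display) (Omega : measurableType d) (P : probability Omega R).
Variable z : R.
Hypothesis z_gt0 : (0 < z)%R.

Local Notation J := (`]0%R, +oo[%classic : set (measurableTypeR R)).
Local Notation leb := (@lebesgue_measure R).
Local Notation E := (measurableTypeR R * cadlag_path R)%type.
Local Notation S := (J `*` [set: cadlag_path R]).
Local Notation Psi := (jump_exponent m).
Local Notation rate := (fun s => z * expR (- (delta * s)))%R.

Variable N : R.-ker Omega ~> E.
Variable mu : {measure set E -> \bar R}.
Hypothesis hmu : forall f : E -> \bar R, measurable_fun setT f -> (forall y, 0 <= f y) ->
  measurable_fun J (fun s => (rate s)%:E * \int[m]_(x in J) \int[Qx x]_w f (s, w)) /\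
  \int[mu]_(p in S) f p =
  \int[leb]_(s in J) ((rate s)%:E * \int[m]_(x in J) \int[Qx x]_w f (s, w)).
Hypothesis hN : poisson_random_measure P S mu N.

Let mJ : measurable J. Proof. exact: measurable_itv. Qed.
Let mS : measurable S. Proof. exact: measurableX. Qed.

Local Notation X := (immigration_process z delta N).

Let Jgt0 x : J x -> (0 < x)%R. Proof. by rewrite /= in_itv/= andbT. Qed.

Let r0 s : (0 <= rate s)%R. Proof. exact: rate_ge0. Qed.

Lemma immigration_filtration_measurable (t : R) : immigration_filtration N t `<=` measurable.
Proof.
apply: smallest_sub; first exact: sigma_algebra_measurable.
move=> _ [u [A [C [_ /path_filtration_measurable mA mC ->]]]].
rewrite -[Y in measurable Y]setTI; apply: (measurable_kernel N) => //.
by apply: measurableX => //; exact: measurable_itv.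
Qed.

Variable t : R.
Hypothesis t0 : (0 <= t)%R.

Local Notation GT := (g_sigma_algebraType
  (immigration_filtration N t `|` [set A | measurable A /\ P A = 0])).
Local Notation PT r := (g_sigma_algebraType (path_generators `[0%R, r])).

Definition strip (a u : R) (g : cadlag_path R -> \bar R) (p : E) : \bar R :=
  (\1_(`]a, u]%classic : set (measurableTypeR R)) p.1 : R)%:E * g p.2.

Lemma strip_ge0 a u g p : (forall w, 0 <= g w) -> 0 <= strip a u g p.
Proof. by move=> g0; rewrite mule_ge0 ?lee_fin. Qed.

Lemma measurable_strip a u (g : cadlag_path R -> \bar R) :
  measurable_fun setT g -> measurable_fun setT (strip a u g).
Proof.
move=> mg; apply: emeasurable_funM.
  apply/measurable_EFinP; apply: (measurableT_comp _ measurable_fst).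
  by apply: measurable_indic; exact: measurable_itv.
exact: (measurableT_comp mg measurable_snd).
Qed.

(** For indicators of sets in [path_filtration (t - u)] these integrals are the counts that generate
    the filtration at [t]; the rest is approximation in [g]. *)
Lemma initial_strip_measurable (u : R) (g : cadlag_path R -> \bar R) :
  (0 <= u <= t)%R -> measurable_fun setT (g : PT (t - u)%R -> \bar R) ->
  (forall w, 0 <= g w) ->
  measurable_fun setT ((fun w => \int[N w]_(p in S) strip 0%R u g p) : GT -> \bar R).
Proof.
move=> u0t; move: g.
have mgE (f : cadlag_path R -> \bar R) :
    measurable_fun setT (f : PT (t - u)%R -> \bar R) -> measurable_fun S (strip 0%R u f).
  move=> mf; apply: measurable_funTS; apply: measurable_strip.
  exact: path_filtration_measurable_fun mf.
apply: (@ge0_measurable_ind _ (PT (t - u)%R) R (fun g => measurable_fun setT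
  ((fun w => \int[N w]_(p in S) strip 0%R u g p) : GT -> \bar R))).
- move=> A mA _ C mC; rewrite setTI; apply: sub_sigma_algebra; left.
  apply: sub_sigma_algebra; exists u, A, C; split => //.
  congr (_ @^-1` C); apply/funext => w.
  transitivity (\int[N w]_(p in S) (\1_(`]0%R, u]%classic `*` A : set E) p : R)%:E).
    apply: eq_integral => p _; rewrite /strip -EFinM; congr EFin.
    by rewrite !indicE in_setX; case: (_ \in _); rewrite ?mul1r ?mul0r.
  rewrite integral_indic//; last first.
    apply: measurableX; first exact: measurable_itv.
    by apply: (@path_filtration_measurable _ (t - u)%R); exact: mA.
  congr (N w _); apply/setIidl => -[r x] /=.
  by rewrite !in_itv/= => -[/andP[-> _]].
- move=> k f k0 mf f0 IH.
  apply: (@eq_measurable_fun _ _ GT _ _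
      (fun w => k%:E * \int[N w]_(p in S) strip 0%R u f p)).
    move=> w _; rewrite -ge0_integralZl_EFin//; last 2 first.
    + by move=> p _; exact: strip_ge0.
    + exact: mgE.
    by apply: eq_integral => p _; rewrite /strip muleCA.
  exact: (@measurable_funeM _ GT).
- move=> f g mf f0 mg g0 IHf IHg.
  apply: (@eq_measurable_fun _ _ GT _ _
      (fun w => \int[N w]_(p in S) strip 0%R u f p + \int[N w]_(p in S) strip 0%R u g p)).
    move=> w _; rewrite -ge0_integralD//.
    + by apply: eq_integral => p _; rewrite /strip ge0_muleDr.
    + by move=> p _; exact: strip_ge0.
    + exact: mgE.
    + by move=> p _; exact: strip_ge0.
    + exact: mgE.
  exact: (@emeasurable_funD _ GT).
- move=> f mf f0 ndf IH.
  apply: (@emeasurable_fun_cvg _ GT _ _ _ _ IH) => w _.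
  have -> : \int[N w]_(p in S) strip 0%R u (fun x => limn (f ^~ x)) p =
      \int[N w]_(p in S) limn (fun n => strip 0%R u (f n) p).
    apply: eq_integral => p _; rewrite /strip indicE; case: (_ \in _).
      rewrite mul1e; congr (limn _); apply/funext => n.
      by rewrite mul1e.
    rewrite mul0e; apply/esym/cvg_lim => //; apply: cvg_near_cst.
    by apply: nearW => n; rewrite mul0e.
  have nd p : nondecreasing_seq (fun n => strip 0%R u (f n) p).
    move=> i j ij; apply: lee_wpmul2l; first by rewrite lee_fin.
    exact: ndf.
  apply: cvg_monotone_convergence => //.
  + by move=> n; exact: mgE.
  + by move=> n p _; exact: strip_ge0.
Qed.

(** Counts only test entry windows that begin at 0. The window [(a, u]] is a difference of two of
    these, which is legitimate where the larger integral is finite: almost surely, hence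
    measurability for the augmentation. *)
Lemma strip_measurable (a u : R) (g : cadlag_path R -> \bar R) :
  (0 <= a)%R -> (a <= u <= t)%R -> measurable_fun setT (g : PT (t - u)%R -> \bar R) ->
  (forall w, 0 <= g w) ->
  P [set w | \int[N w]_(p in S) strip 0%R u g p < +oo] = 1 ->
  measurable_fun setT ((fun w => \int[N w]_(p in S) strip a u g p) : GT -> \bar R).
Proof.
move=> a0 /andP[au ut] mg g0 fin.
have mg' : measurable_fun setT (g : PT (t - a)%R -> \bar R).
  move=> _ B mB; rewrite setTI; have := mg measurableT B mB; rewrite setTI.
  by apply: path_filtration_mono; rewrite lerD2l lerN2.
have mgT := path_filtration_measurable_fun mg.
have mu_ : measurable_fun setT
    ((fun w => \int[N w]_(p in S) strip 0%R u g p) : GT -> \bar R).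
  by apply: initial_strip_measurable => //; rewrite ut (le_trans a0 au).
have ma_ : measurable_fun setT
    ((fun w => \int[N w]_(p in S) strip 0%R a g p) : GT -> \bar R).
  by apply: initial_strip_measurable => //; rewrite a0 (le_trans au ut).
have mstripS (x y : R) : measurable_fun S (strip x y g).
  by apply: measurable_funTS; exact: measurable_strip.
have mI (x y : R) : measurable_fun setT (fun w => \int[N w]_(p in S) strip x y g p).
  apply: measurable_kernel_integral => //; first exact: measurable_strip.
  by move=> p; exact: strip_ge0.
have splitE w : \int[N w]_(p in S) strip 0%R u g p =
    \int[N w]_(p in S) strip 0%R a g p + \int[N w]_(p in S) strip a u g p.
  rewrite -ge0_integralD//; last 2 first.
  - by move=> p _; exact: strip_ge0.
  - by move=> p _; exact: strip_ge0.
  apply: eq_integral => p _; rewrite /strip -ge0_muleDl ?lee_fin//.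
  apply: (congr1 (fun y => y * g p.2)); rewrite -EFinD; apply: congr1; rewrite !indicE.
  have -> : (p.1 \in (`]0%R, u]%classic : set (measurableTypeR R))) =
      (0 < p.1 <= u)%R by apply/idP/idP => [/set_mem|h]; [|apply/mem_set]; rewrite /= in_itv.
  have -> : (p.1 \in (`]0%R, a]%classic : set (measurableTypeR R))) =
      (0 < p.1 <= a)%R by apply/idP/idP => [/set_mem|h]; [|apply/mem_set]; rewrite /= in_itv.
  have -> : (p.1 \in (`]a, u]%classic : set (measurableTypeR R))) =
      (a < p.1 <= u)%R by apply/idP/idP => [/set_mem|h]; [|apply/mem_set]; rewrite /= in_itv.
  have [pa|pa] := leP p.1 a.
    by rewrite (le_trans pa au) andbT addr0.
  by rewrite (le_lt_trans a0 pa) andbF add0r.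
have mA : measurable [set w | \int[N w]_(p in S) strip 0%R u g p < +oo].
  rewrite (_ : [set _ | _] = (fun w => \int[N w]_(p in S) strip 0%R u g p) @^-1` (~` [set +oo])).
    rewrite -[Y in measurable Y]setTI; apply: mI => //.
    exact/measurableC/emeasurable_set1.
  by apply/seteqP; split => w /=; rewrite ltey => /eqP.
apply: (ae_measurable_fun (f := fun w : Omega => \int[N w]_(p in S) strip 0%R u g p -
    \int[N w]_(p in S) strip 0%R a g p)) => //.
  exact: (@emeasurable_funB _ GT).
exists (~` [set w | \int[N w]_(p in S) strip 0%R u g p < +oo]); split.
- exact: measurableC.
- exact: probability_compl_null.
move=> w /= neq; apply: contra_not neq => uoo; move: uoo; rewrite splitE => uoo.
have J0 x y : 0 <= \int[N w]_(p in S) strip x y g p.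
  by apply: integral_ge0 => p _; exact: strip_ge0.
rewrite addeAC subee ?add0e// ge0_fin_numE//.
by apply: le_lt_trans uoo; rewrite leeDl.
Qed.

(** On the grid, [V] will involve a chosen endpoint, so the measurability of [rate s * Psi (V s)] is
    part of the conclusion, inherited from the slices of the intensity. *)
Lemma laplace_slices (f : E -> \bar R) (V : R -> R) :
  measurable_fun setT f -> (forall p, 0 <= f p) ->
  (forall s, (0 < s)%R -> (0 <= V s)%R) ->
  (forall s x, (0 < s)%R -> (0 < x)%R ->
    \int[Qx x]_w (expN (f (s, w)))%:E = (expN (x * V s)%:E)%:E) ->
  measurable_fun J (fun s => (rate s * Psi (V s))%:E) /\
  \int[P]_w (expN (\int[N w]_(p in S) f p))%:E =
  (expN (\int[leb]_(s in J) (rate s * Psi (V s))%:E))%:E.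
Proof.
move=> mf f0 V0 H.
have me : measurable_fun setT (fun p => (1 - expN (f p))%:E).
  apply/measurable_EFinP/measurable_funB => //.
  exact: (measurableT_comp (@measurable_expN R) mf).
have e0 p : 0 <= (1 - expN (f p))%:E by rewrite lee_fin subr_ge0 expN_le1.
have sliceE s : (0 < s)%R -> (rate s)%:E * \int[m]_(x in J) \int[Qx x]_w
    (1 - expN (f (s, w)))%:E = (rate s * Psi (V s))%:E.
  move=> s0; rewrite [RHS]EFinM; apply: (congr1 (mule (rate s)%:E)).
  apply: (jump_slice hphi hdelta (V0 s s0)); last by move=> x; exact: H.
  exact: (measurableT_comp mf (@pair1_measurable _ _ (measurableTypeR R) _ s)).
have [h1 h2] := hmu me e0.
split.
  apply: (eq_measurable_fun _ _ h1) => s; rewrite inE => /Jgt0.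
  exact: sliceE.
rewrite (poisson_laplace mS hN mf f0) h2; congr (expN _)%:E.
by apply: eq_integral => s; rewrite inE => /Jgt0; exact: sliceE.
Qed.

(** On [[0, t]], [M] bounds the immigration rate and [K] the Lipschitz constant [e^(-b r)] of [v_r]
    in its initial value; [delta] and [b] may have either sign. *)
Let M : R := (z * expR (`|delta| * t))%R.
Let K : R := expR (`|b| * t).

Let M_ge0 : (0 <= M)%R. Proof. by rewrite mulr_ge0 ?expR_ge0 ?(ltW z_gt0). Qed.

Let expR_bound (a s : R) : (0 <= s <= t)%R -> (expR (- (a * s)) <= expR (`|a| * t))%R.
Proof.
move=> /andP[s0 st]; rewrite ler_expR -mulNr.
apply: (@le_trans _ _ (`|a| * s)%R); last exact: ler_wpM2l.
by apply: ler_wpM2r => //; rewrite -normrN ler_norm.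
Qed.

(** Up to [t] a gap [D] is weighted by a rate of at most [M] over a length [t]; beyond [t] there is
    no gap to pay for. *)
Lemma rate_integral_le (f1 f2 : R -> R) (D : R) : (0 <= D)%R ->
  measurable_fun J (fun s => (rate s * f1 s)%:E) ->
  measurable_fun J (fun s => (rate s * f2 s)%:E) ->
  (forall s, (0 < s)%R -> (0 <= f1 s)%R) -> (forall s, (0 < s)%R -> (0 <= f2 s)%R) ->
  (forall s, (0 < s)%R -> (s <= t)%R -> (f1 s <= f2 s + D)%R) ->
  (forall s, (t < s)%R -> (f1 s <= f2 s)%R) ->
  \int[leb]_(s in J) (rate s * f1 s)%:E <=
  \int[leb]_(s in J) (rate s * f2 s)%:E + (M * D * t)%:E.
Proof.
move=> D0 m1 m2 f10 f20 h1 h2.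
have MD0 : (0 <= M * D)%R by rewrite mulr_ge0.
pose I : set (measurableTypeR R) := `]0%R, t]%classic.
have mI : measurable I by exact: measurable_itv.
pose k (s : measurableTypeR R) : \bar R := (M * D)%:E * (\1_I s : R)%:E.
have k0 s : 0 <= k s by rewrite mule_ge0 ?lee_fin.
have mi : measurable_fun J (fun s => (\1_I s : R)%:E : \bar R).
  by apply: measurable_funTS; apply/measurable_EFinP; exact: measurable_indic.
have mk : measurable_fun J k by exact: measurable_funeM.
have <- : \int[leb]_(s in J) k s = (M * D * t)%:E.
  rewrite ge0_integralZl_EFin//.
  rewrite integral_indic// setIidl; last by move=> s; rewrite /I /= !in_itv/= andbT => /andP[].
  rewrite [RHS]EFinM; apply: (congr1 (mule (M * D)%:E)).
  apply: (etrans (@lebesgue_measure_itv R `]0%R, t])); rewrite /= lte_fin.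
  case: ifPn => [_|]; first by rewrite sube0.
  by rewrite -leNgt => tn; congr EFin; apply/eqP; rewrite eq_le t0 tn.
have p1 s : J s -> 0 <= (rate s * f1 s)%:E.
  by move=> /Jgt0 s0; rewrite lee_fin mulr_ge0// f10.
have p2 s : J s -> 0 <= (rate s * f2 s)%:E.
  by move=> /Jgt0 s0; rewrite lee_fin mulr_ge0// f20.
rewrite -ge0_integralD//.
apply: ge0_le_integral => //.
- exact: emeasurable_funD.
move=> s /Jgt0 s0; have [st|ts] := leP s t; last first.
  by apply: (@le_trans _ _ (rate s * f2 s)%:E); rewrite ?leeDl// lee_fin ler_wpM2l// h2.
rewrite /k indicE mem_set; last by rewrite /I /= in_itv/= s0 st.
rewrite mule1 -EFinD lee_fin.
apply: (@le_trans _ _ (rate s * (f2 s + D))%R); first by rewrite ler_wpM2l// h1.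
rewrite mulrDr lerD2l; apply: ler_wpM2r => //; apply: ler_wpM2l; first exact: ltW.
by apply: expR_bound; rewrite ltW.
Qed.

Let jump_exponent_gap (x y D : R) : (0 <= x)%R -> (0 <= y)%R -> (0 <= D)%R ->
  (x <= y + D)%R -> (Psi x <= Psi y + (delta - b) * D)%R.
Proof.
move=> x0 y0 D0 xyD; have d0 := drift_ge0 hphi hdelta.
have [xy|/ltW yx] := leP x y.
  have /andP[h _] := jump_exponent_lip hphi hdelta x0 xy.
  by apply: le_trans h _; rewrite lerDl mulr_ge0.
have /andP[_ h] := jump_exponent_lip hphi hdelta y0 yx.
by apply: le_trans h _; rewrite lerD2l ler_wpM2l// lerBlDl.
Qed.

Let cumulant_gap (r l l' D : R) : (0 <= r <= t)%R -> (0 <= l)%R -> (0 <= l')%R ->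
  (0 <= D)%R -> (l <= l' + D)%R -> (v r l <= v r l' + K * D)%R.
Proof.
move=> rt l0 l'0 D0 ll'; have /andP[r_ge0 _] := rt.
have [h|/ltW h] := leP l l'.
  apply: le_trans (CB_cumulant_mono hQ r_ge0 l0 h) _.
  by rewrite lerDl mulr_ge0 ?expR_ge0.
rewrite -lerBlDl.
apply: le_trans (CB_cumulant_lip_init hphi hdelta hv hQ r_ge0 l'0 h) _.
by apply: ler_pM; rewrite ?expR_ge0 ?subr_ge0// ?lerBlDl//; exact: expR_bound.
Qed.

(** The constant passed to [laplace_finite] multiplies the rate bound [M], the mean [delta - b] of
    [m], the factor [K] in [v_(t-u)(l) <= K l], and a length [t] that covers the entry window. *)
Let initial_strip_finite (u : R) : (0 <= u <= t)%R ->
  P [set w | \int[N w]_(p in S) strip 0%R u (fun w => (w (t - u)%R)%:E) p < +oo] = 1.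
Proof.
move=> ut; have /andP[u0 u_le] := ut.
have tu0 : (0 <= t - u)%R by rewrite subr_ge0.
pose g (w : cadlag_path R) : \bar R := (w (t - u)%R)%:E.
have mg : measurable_fun setT g by apply/measurable_EFinP; exact: measurable_coordinate.
have g0 w : 0 <= g w by rewrite lee_fin path_ge0.
have ms : measurable_fun setT (strip 0%R u g) by exact: measurable_strip.
have s0 p : 0 <= strip 0%R u g p by exact: strip_ge0.
have C0 : (0 <= M * (delta - b) * K * t)%R.
  by rewrite !mulr_ge0 ?expR_ge0 ?(ltW z_gt0)// (drift_ge0 hphi hdelta).
apply: (@laplace_finite _ _ _ P _ (M * (delta - b) * K * t)%R C0).
  exact: measurable_kernel_integral.
move=> l l_gt0; have l0 := ltW l_gt0.
pose f (p : E) : \bar R := l%:E * strip 0%R u g p.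
pose V (s : R) : R := if (s <= u)%R then v (t - u)%R l else 0%R.
have mf : measurable_fun setT f by exact: measurable_funeM.
have f0 p : 0 <= f p by rewrite mule_ge0.
have V0 s : (0 < s)%R -> (0 <= V s)%R.
  by move=> _; rewrite /V; case: ifP => // _; exact: (cumulant_ge0 hv).
have H s x : (0 < s)%R -> (0 < x)%R ->
    \int[Qx x]_w (expN (f (s, w)))%:E = (expN (x * V s)%:E)%:E.
  move=> s_gt0 x0; rewrite /V; have [su|us] := leP s u.
    rewrite -(path_laplace hQ (hQx (ltW x0)) tu0 l0); apply: eq_integral => w _.
    rewrite /f /strip indicE mem_set; last by rewrite /= in_itv/= s_gt0 su.
    by rewrite mul1e.
  rewrite mulr0 expN0 -[RHS](integral_cst_probability (Qx x)).
  apply: eq_integral => w _.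
  rewrite /f /strip indicE memNset; last by rewrite /= in_itv/= s_gt0/= leNgt us.
  by rewrite mul0e mule0 expN0.
have [mV L] := laplace_slices mf f0 V0 H.
have -> : \int[P]_w (expN (l%:E * \int[N w]_(p in S) strip 0%R u g p))%:E =
    \int[P]_w (expN (\int[N w]_(p in S) f p))%:E.
  apply: eq_integral => w _; rewrite ge0_integralZl_EFin//.
  exact: measurable_funTS.
rewrite L.
have I0 : 0 <= \int[leb]_(s in J) (rate s * Psi (V s))%:E.
  apply: integral_ge0 => s /Jgt0 sp; rewrite lee_fin mulr_ge0//.
  by apply: jump_exponent_ge0; exact: V0.
apply: le_trans (expN_ge1B I0); rewrite EFinB; apply: leeB => //.
have D0 : (0 <= (delta - b) * (K * l))%R.
  by rewrite !mulr_ge0 ?expR_ge0// (drift_ge0 hphi hdelta).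
have m0 : measurable_fun J (fun s => (rate s * (fun=> 0 : R) s)%:E : \bar R).
  apply: (@eq_measurable_fun _ _ _ _ _ (cst 0)); last exact: measurable_cst.
  by move=> s _; rewrite mulr0.
have := rate_integral_le D0 mV m0.
rewrite [X in _ <= X + _](_ : _ = 0); last first.
  by apply: integral0_eq => s _; rewrite mulr0.
rewrite add0e (_ : M * _ * t = M * (delta - b) * K * t * l)%R; last by ring.
apply => //.
- by move=> s sp; apply: jump_exponent_ge0; exact: V0.
- move=> s sp st; rewrite -[X in (X + _)%R](@jump_exponent0 _ m).
  apply: jump_exponent_gap; rewrite ?V0// ?mulr_ge0 ?expR_ge0//.
  rewrite add0r /V; case: ifP => _; last by rewrite mulr_ge0 ?expR_ge0.
  rewrite -[X in (_ <= X)%R]add0r -(CB_cumulant_zero hQ tu0).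
  apply: cumulant_gap => //; last by rewrite add0r.
  by rewrite tu0 gerBl.
- move=> s ts; have us := le_lt_trans u_le ts.
  by rewrite /V ifF ?jump_exponent0//; apply/negbTE; rewrite -ltNge.
Qed.

Section grid.
Variables (h : R) (n : nat).
Hypothesis h0 : (0 <= h)%R.
Hypothesis hn : (n%:R * h = t)%R.

Let node_le (k : nat) : (k <= n)%N -> (k%:R * h <= t)%R.
Proof. by move=> kn; rewrite -hn ler_wpM2r// ler_nat. Qed.

Let node_ge0 (k : nat) : (0 <= k%:R * h)%R.
Proof. by rewrite mulr_ge0. Qed.

Let node_step (k : nat) : (k.+1%:R * h = k%:R * h + h)%R.
Proof. by rewrite -natr1 mulrDl mul1r. Qed.

(* [w (t - s)] sampled at the first grid point to the left of [t - s] *)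
Definition grid (p : E) : \bar R := \sum_(k < n)
  strip (k%:R * h) (k.+1%:R * h) (fun w => (w (t - k.+1%:R * h)%R)%:E) p.

Lemma grid_ge0 p : 0 <= grid p.
Proof. by apply: sume_ge0 => k _; apply: strip_ge0 => w; rewrite lee_fin path_ge0. Qed.

Lemma measurable_grid : measurable_fun setT grid.
Proof.
apply: emeasurable_sum => k; apply: measurable_strip.
by apply/measurable_EFinP; exact: measurable_coordinate.
Qed.

(** The cell [(k h, (k + 1) h]] reads paths at age [t - (k + 1) h], the last age visible at time [t]
    for all entries up to [(k + 1) h]. *)
Lemma grid_integral_measurable :
  measurable_fun setT ((fun w => \int[N w]_(p in S) grid p) : GT -> \bar R).
Proof.
apply: (@eq_measurable_fun _ _ GT _ _ (fun w => \sum_(k < n) \int[N w]_(p in S)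
    strip (k%:R * h) (k.+1%:R * h) (fun w => (w (t - k.+1%:R * h)%R)%:E) p)).
  move=> w _; rewrite -ge0_integral_sum//.
  - move=> k; apply: measurable_funTS; apply: measurable_strip.
    by apply/measurable_EFinP; exact: measurable_coordinate.
  - by move=> k p _; apply: strip_ge0 => x; rewrite lee_fin path_ge0.
apply: (@emeasurable_sum _ GT) => k.
have kt : (k.+1%:R * h <= t)%R by apply: node_le; exact: ltn_ord.
apply: strip_measurable => //.
- by rewrite kt andbT node_step lerDl.
- apply/measurable_EFinP; apply: measurable_coordinate_filtration => //.
  by rewrite subr_ge0.
- by move=> w; rewrite lee_fin path_ge0.
- by apply: initial_strip_finite; rewrite node_ge0 kt.
Qed.

(** [u] is the right end of the grid cell that contains [s]. *)
Lemma grid_slice (s : R) : (0 < s)%R -> (s <= t)%R ->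
  exists u, [/\ (s <= u)%R, (u <= t)%R, (u - s <= h)%R &
    forall w, grid (s, w) = (w (t - u)%R)%:E].
Proof.
move=> s0 st.
have [k [kn ks sk]] : exists k, [/\ (k < n)%N, (k%:R * h < s)%R & (s <= k.+1%:R * h)%R].
  move: st; rewrite -hn; elim: n => [|j IH]; first by rewrite mul0r leNgt s0.
  move=> sj; have [/IH[k [kj h1 h2]]|h1] := leP s (j%:R * h)%R; last by exists j.
  by exists k; split => //; exact: ltnW.
exists (k.+1%:R * h)%R; split => //; first exact: node_le.
  by rewrite node_step addrAC gerDr subr_le0 ltW.
move=> w; rewrite /grid (bigD1 (Ordinal kn))//= big1 ?adde0 => [|i /eqP ik].
  by rewrite /strip indicE mem_set ?mul1e//= in_itv/= ks sk.
rewrite /strip indicE memNset ?mul0e//= in_itv/= => /andP[is_ si].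
apply: ik; apply: val_inj => /=; apply/eqP; rewrite eqn_leq.
have hp : (0 < h)%R.
  rewrite lt_neqAle h0 andbT; apply/eqP => hz.
  by move: s0; rewrite ltNge (le_trans sk)// -hz mulr0.
have := lt_le_trans is_ sk; have := lt_le_trans ks si.
by rewrite !ltr_pM2r// !ltr_nat !ltnS => -> ->.
Qed.

Lemma grid_late (s : R) w : (t < s)%R -> grid (s, w) = 0.
Proof.
move=> ts; rewrite /grid big1// => k _.
rewrite /strip indicE memNset ?mul0e//= in_itv/= => /andP[_].
by rewrite leNgt (le_lt_trans (node_le (ltn_ord k)) ts).
Qed.

End grid.

Local Notation clan_total w := (\int[N w]_(p in S) clan_mass t p).
Local Notation grid_total h n w := (\int[N w]_(p in S) grid h n p).

(** The path is read at ages [t - u] and [t - s]. The Markov property at the earlier age turns the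
    later reading of weight [a'] into one of weight [v_(u-s)(a')], and both merge into a single
    reading at age [t - u]. *)
Let laplace_pair (h : R) (n : nat) (a a' : R) (V : R -> R) :
  (0 <= h)%R -> (n%:R * h = t)%R -> (0 <= a)%R -> (0 <= a')%R ->
  (forall s, (0 < s)%R -> (0 <= V s)%R) ->
  (forall s, (t < s)%R -> V s = 0%R) ->
  (forall s, (0 < s)%R -> (s <= t)%R -> exists u, [/\ (s <= u)%R, (u <= t)%R,
    forall w, grid h n (s, w) = (w (t - u)%R)%:E & V s = v (t - u)%R (a + v (u - s)%R a')]) ->
  measurable_fun J (fun s => (rate s * Psi (V s))%:E) /\
  \int[P]_w (expN (a%:E * grid_total h n w + a'%:E * clan_total w))%:E =
  (expN (\int[leb]_(s in J) (rate s * Psi (V s))%:E))%:E.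
Proof.
move=> h0 hn a0 a'0 V0 Vt HV.
pose f (p : E) : \bar R := a%:E * grid h n p + a'%:E * clan_mass t p.
have mg : measurable_fun setT (fun p => a%:E * grid h n p : \bar R).
  by apply: measurable_funeM; exact: measurable_grid.
have mc : measurable_fun setT (fun p => a'%:E * clan_mass t p : \bar R).
  by apply: measurable_funeM; exact: measurable_clan_mass.
have mf : measurable_fun setT f by exact: emeasurable_funD.
have g0 p : 0 <= a%:E * grid h n p by rewrite mule_ge0 ?grid_ge0.
have c0 p : 0 <= a'%:E * clan_mass t p by rewrite mule_ge0 ?clan_mass_ge0.
have f0 p : 0 <= f p by rewrite adde_ge0.
have H s x : (0 < s)%R -> (0 < x)%R ->
    \int[Qx x]_w (expN (f (s, w)))%:E = (expN (x * V s)%:E)%:E.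
  move=> s0 x0; have [st|ts] := leP s t; last first.
    rewrite Vt// mulr0 expN0 -[RHS](integral_cst_probability (Qx x)).
    apply: eq_integral => w _.
    by rewrite /f grid_late// /clan_mass path_neg ?subr_lt0// !mule0 adde0 expN0.
  have [u [su ut gE ->]] := HV s s0 st.
  have tu0 : (0 <= t - u)%R by rewrite subr_ge0.
  have us0 : (0 <= u - s)%R by rewrite subr_ge0.
  have v0 : (0 <= v (u - s) a')%R by exact: (cumulant_ge0 hv).
  have av0 : (0 <= a + v (u - s) a')%R by rewrite addr_ge0.
  have hx := hQx (ltW x0).
  rewrite -(path_laplace hQ hx tu0 av0).
  transitivity (\int[Qx x]_w ((expN (a * w (t - u)%R)%:E)%:E *
      (expN (a' * w (t - u + (u - s))%R)%:E)%:E)).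
    apply: eq_integral => w _; rewrite /f gE /clan_mass /= -!EFinM.
    rewrite (_ : t - u + (u - s) = t - s)%R; last by ring.
    by rewrite expND ?lee_fin ?mulr_ge0 ?path_ge0.
  rewrite (path_laplace_markov hQ hx tu0 us0 a'0).
  - apply: eq_integral => w _; rewrite -EFinM -expND ?lee_fin ?mulr_ge0 ?path_ge0//.
    by rewrite -EFinD mulrDl.
  - apply/measurable_EFinP; apply: (measurableT_comp (@measurable_expN R)).
    apply/measurable_EFinP; apply: measurable_funM; first exact: measurable_cst.
    exact: measurable_coordinate_filtration.
  - by move=> w; rewrite lee_fin expN_ge0.
have [mV L] := laplace_slices mf f0 V0 H.
split=> //; rewrite -L; apply: eq_integral => w _; apply: congr1; apply: congr1.
rewrite /f ge0_integralD//; last 2 first.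
- exact: measurable_funTS.
- exact: measurable_funTS.
rewrite !ge0_integralZl_EFin//.
- by move=> p _; exact: clan_mass_ge0.
- by apply: measurable_funTS; exact: measurable_clan_mass.
- by move=> p _; exact: grid_ge0.
- by apply: measurable_funTS; exact: measurable_grid.
Qed.

(** The distance is [e(2,0) - 2 e(1,1) + e(0,2)], so it is enough to bound [e(2,0)] and [e(0,2)]
    above by [e(1,1)] plus an error. Over a delay [r <= h] the flow moves 1 and 2 by at most [C1 h]
    and [C2 h], which compares [1 + v_r(1)] with [2] and with [v_r(2)]. *)
Let grid_distance : exists C : R, (0 <= C)%R /\
  forall h n, (0 <= h)%R -> (n%:R * h = t)%R ->
  \int[P]_w ((expN (grid_total h n w) - expN (clan_total w)) ^+ 2)%:E <= (C * h)%:E.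
Proof.
have [C1 [C10 hC1]] := CB_cumulant_lip_time hphi hdelta hv hQ t0 (ler01 : (0 <= 1 :> R)%R).
have [C2 [C20 hC2]] := CB_cumulant_lip_time hphi hdelta hv hQ t0 (ler0n R 2).
have d0 := drift_ge0 hphi hdelta; have K0 : (0 <= K)%R by exact: expR_ge0.
have W0 x : (0 <= x)%R -> (0 <= M * ((delta - b) * (K * x)) * t)%R.
  move=> x0; apply: mulr_ge0 => //; apply: mulr_ge0; first exact: M_ge0.
  by apply: mulr_ge0 => //; exact: mulr_ge0.
exists (2 * (M * ((delta - b) * (K * (C1 + C2))) * t))%R; split.
  by apply: mulr_ge0 => //; apply: W0; exact: addr_ge0.
move=> h n h0 hn; pose CC := (C1 + C2)%R.
have CC0 : (0 <= CC * h)%R by rewrite mulr_ge0 ?addr_ge0.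
have /choice[u hu] : forall s : R, exists u : R, (0 < s)%R -> (s <= t)%R ->
    [/\ (s <= u)%R, (u <= t)%R, (u - s <= h)%R &
      forall w, grid h n (s, w) = (w (t - u)%R)%:E].
  move=> s; have [s0|s0] := ltP 0%R s; last by exists 0%R.
  have [st|ts] := leP s t; last by exists 0%R.
  by have [u hu] := grid_slice h0 hn s0 st; exists u.
pose V a a' s := if (s <= t)%R then v (t - u s)%R (a + v (u s - s)%R a') else 0%R.
have V0 a a' s : (0 <= a)%R -> (0 <= a')%R -> (0 < s)%R -> (0 <= V a a' s)%R.
  move=> a0 a'0 s0; rewrite /V; case: ifP => // st; have [su ut _ _] := hu s s0 st.
  apply: (cumulant_ge0 hv); rewrite ?subr_ge0// addr_ge0//.
  by apply: (cumulant_ge0 hv); rewrite ?subr_ge0.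
have Vlate a a' s : (t < s)%R -> V a a' s = 0%R.
  by move=> ts; rewrite /V ifF//; apply/negbTE; rewrite -ltNge.
pose I a a' := \int[leb]_(s in J) (rate s * Psi (V a a' s))%:E.
have LV a a' : (0 <= a)%R -> (0 <= a')%R ->
    measurable_fun J (fun s => (rate s * Psi (V a a' s))%:E) /\
    \int[P]_w (expN (a%:E * grid_total h n w + a'%:E * clan_total w))%:E = (expN (I a a'))%:E.
  move=> a0 a'0; apply: laplace_pair => //.
  - by move=> s s0; exact: V0.
  - by move=> s; exact: Vlate.
  - move=> s s0 st; have [su ut _ gE] := hu s s0 st.
    by exists (u s); split => //; rewrite /V st.
have I0 a a' : (0 <= a)%R -> (0 <= a')%R -> 0 <= I a a'.
  move=> a0 a'0; apply: integral_ge0 => s /Jgt0 sp; rewrite lee_fin mulr_ge0//.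
  by apply: jump_exponent_ge0; exact: V0.
have D0 : (0 <= (delta - b) * (K * (CC * h)))%R.
  by apply: mulr_ge0 => //; exact: mulr_ge0.
have gap a a' : (0 <= a)%R -> (0 <= a')%R ->
    (forall r, (0 <= r)%R -> (r <= t)%R -> (r <= h)%R ->
      (1 + v r 1 <= a + v r a' + CC * h)%R) ->
    I 1%R 1%R <= I a a' + (M * ((delta - b) * (K * (CC * h))) * t)%:E.
  move=> a0 a'0 H.
  apply: rate_integral_le.
  - exact: D0.
  - by apply LV.
  - by apply LV.
  - by move=> s s0; apply: jump_exponent_ge0; exact: V0.
  - by move=> s s0; apply: jump_exponent_ge0; exact: V0.
  - move=> s s0 st; apply: jump_exponent_gap;
      [exact: V0|exact: V0|exact: mulr_ge0|].
    have [su ut uh _] := hu s s0 st.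
    have us0 : (0 <= u s - s)%R by rewrite subr_ge0.
    rewrite /V st; apply: cumulant_gap => //.
    + by rewrite subr_ge0 ut gerBl (le_trans (ltW s0)).
    + by rewrite addr_ge0// (cumulant_ge0 hv).
    + by rewrite addr_ge0// (cumulant_ge0 hv).
    + apply: H => //; apply: le_trans ut.
      by rewrite gerBl ltW.
  - by move=> s ts; rewrite !Vlate.
have lip l C r : (forall s r, (0 <= s)%R -> (s <= r)%R -> (r <= t)%R ->
    (`|v r l - v s l| <= C * (r - s))%R) -> (0 <= C)%R -> (0 <= l)%R -> (0 <= r)%R -> (r <= t)%R ->
    (r <= h)%R -> (`|v r l - l| <= C * h)%R.
  move=> H C0 l0 r_ge0 rt rh; have := H 0%R r (lexx _) r_ge0 rt.
  by rewrite (v_time0 hv)// subr0 => /le_trans; apply; rewrite ler_wpM2l.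
have g1 : I 1%R 1%R <= I 2%R 0%R + (M * ((delta - b) * (K * (CC * h))) * t)%:E.
  apply: gap => // r r_ge0 rt rh.
  have := lip 1%R C1 r hC1 C10 ler01 r_ge0 rt rh.
  rewrite ler_norml (CB_cumulant_zero hQ)// /CC mulrDl => /andP[_ h1].
  have : (0 <= C2 * h)%R by rewrite mulr_ge0.
  by move: h1; move: (v r 1%R) (C1 * h)%R (C2 * h)%R => x y y'; lra.
have g2 : I 1%R 1%R <= I 0%R 2%R + (M * ((delta - b) * (K * (CC * h))) * t)%:E.
  apply: gap => // r r_ge0 rt rh.
  have := lip 1%R C1 r hC1 C10 ler01 r_ge0 rt rh.
  have := lip 2%R C2 r hC2 C20 (ler0n R 2) r_ge0 rt rh.
  rewrite !ler_norml /CC mulrDl => /andP[h2 _] /andP[_ h1].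
  by move: h1 h2; move: (v r 1%R) (v r 2%R) (C1 * h)%R (C2 * h)%R => x x' y y'; lra.
have mG : measurable_fun setT (fun w => grid_total h n w).
  apply: measurable_kernel_integral => //; first exact: measurable_grid.
  exact: grid_ge0.
have mX : measurable_fun setT (fun w => clan_total w).
  apply: measurable_kernel_integral => //; first exact: measurable_clan_mass.
  exact: clan_mass_ge0.
rewrite (L2_of_laplace mG mX _ _ (fun a a' a0 a'0 => (LV a a' a0 a'0).2)); last 2 first.
- by move=> w; apply: integral_ge0 => p _; exact: grid_ge0.
- by move=> w; apply: integral_ge0 => p _; exact: clan_mass_ge0.
have DD0 : (0 <= M * ((delta - b) * (K * (CC * h))) * t)%R by exact: W0.
have e1 := expN_gap (I0 2%R 0%R (ler0n R 2) (lexx _)) (I0 1%R 1%R ler01 ler01) DD0 g1.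
have e2 := expN_gap (I0 0%R 2%R (lexx _) (ler0n R 2)) (I0 1%R 1%R ler01 ler01) DD0 g2.
rewrite lee_fin (_ : 2 * _ * h = 2 * (M * ((delta - b) * (K * (CC * h))) * t))%R; last first.
  by rewrite /CC; ring.
have sum_le (x y y' k : R) : (x <= y + k -> y' <= y + k -> x - 2 * y + y' <= 2 * k)%R.
  move=> h1 h2; rewrite -subr_ge0.
  rewrite (_ : _ - _ = (y + k - x) + (y + k - y'))%R; last by ring.
  by rewrite addr_ge0 ?subr_ge0.
exact: sum_le e1 e2.
Qed.

Lemma immigration_adapted (B : set (measurableTypeR R)) : measurable B ->
  augmentation P (immigration_filtration N t)
    ((fun w => fine (immigration_process z delta N t w)) @^-1` B).
Proof.
move=> mB; have [C [C0 HC]] := grid_distance.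
have mX : measurable_fun setT (fun w => expN (clan_total w)).
  apply: (measurableT_comp (@measurable_expN R)); apply: measurable_kernel_integral => //.
    exact: measurable_clan_mass.
  exact: clan_mass_ge0.
have Ct0 : (0 <= C * t)%R by rewrite mulr_ge0.
have mXG : measurable_fun setT ((fun w => expN (clan_total w)) : GT -> R).
  (* This mesh turns a bound linear in [h] into the geometric one of [L2_limit_measurable]. *)
  pose h j : R := (t / (2 ^ j.+1)%:R)%R.
  have h0 j : (0 <= h j)%R by rewrite divr_ge0.
  have hn j : ((2 ^ j.+1)%N%:R * h j = t)%R.
    by rewrite mulrCA mulfV ?mulr1// pnatr_eq0 expn_eq0.
  apply: (L2_limit_measurable (@immigration_filtration_measurable t)
    (f := fun j w => expN (grid_total (h j) (2 ^ j.+1)%N w)) _ mX Ct0).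
  - move=> j; apply: (@measurableT_comp _ _ _ GT _ _ (@expN R)).
      exact: measurable_expN.
    exact: grid_integral_measurable.
  - by move=> j; rewrite -mulrA; exact: HC.
(* Recovers the real-valued process from [expN] of the clan total; where that total is infinite,
   both sides are 0 by [fine]. *)
pose F (y : R) : R := fine ((rate t)%:E + lnN y).
have mF : measurable_fun setT F.
  apply: (@measurableT_comp _ _ _ _ _ _ (@fine R)); first exact: fine_measurable.
  by apply: emeasurable_funD; [exact: measurable_cst|exact: measurable_lnN].
have -> : (fun w => fine (immigration_process z delta N t w)) @^-1` B =
    (fun w => expN (clan_total w)) @^-1` (F @^-1` B).
  apply/seteqP; split => w; rewrite /= /F expNK ?immigration_processE//;
    by apply: integral_ge0 => p _; exact: clan_mass_ge0.
have mFB : measurable (F @^-1` B) by rewrite -[Y in measurable Y]setTI; exact: mF.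
by have := mXG measurableT _ mFB; rewrite setTI.
Qed.

End immigration_adapted.

(** * Passage to the augmented filtration and the real-valued process *)

Lemma augmentation_mono d (Omega : measurableType d) (R : realType) (P : probability Omega R)
    (G G' : set (set Omega)) : G `<=` G' -> augmentation P G `<=` augmentation P G'.
Proof. by move=> GG'; apply: sub_sigma_algebra2; exact: setSU. Qed.

Lemma immigration_filtration_mono (R : realType) d (Omega : measurableType d)
    (N : R.-ker Omega ~> (measurableTypeR R * cadlag_path R)%type) (s t : R) :
  (s <= t)%R -> immigration_filtration N s `<=` immigration_filtration N t.
Proof.
move=> st; apply: sub_sigma_algebra2 => _ [u [A [C [/andP[u0 us] fA mC ->]]]].
exists u, A, C; split => //; first by rewrite u0 (le_trans us st).
by apply: path_filtration_mono fA; rewrite lerD2r.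
Qed.

Local Close Scope ereal_scope.

Theorem theorem6p7 (R : realType)
  (b c : R) (m : {measure set (measurableTypeR R) -> \bar R})
  (hphi : branching_parameters b c m)
  (delta : R)
  (hdelta : derive1 (branching_mechanism b c m) x @[x --> +oo] --> delta)
  (v : R -> R -> R)
  (hv : cumulant_semigroup (branching_mechanism b c m) v)
  (Q : R -> R.-pker (measurableTypeR R) ~> (measurableTypeR R))
  (hQ : CB_semigroup v Q)
  (Qx : R -> probability (cadlag_path R) R)
  (hQx : forall x : R, 0 <= x -> CB_law Q x (Qx x))
  (d : measure_display) (Omega : measurableType d) (P : probability Omega R)
  (z : R) (hz : 0 < z)
  (N : R.-ker Omega ~> (measurableTypeR R * cadlag_path R)%type)
  (hN : poisson_random_measure P
          ((`]0, +oo[%classic : set (measurableTypeR R)) `*` [set: cadlag_path R])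
          (immigration_intensity z delta (path_mixture m Qx)) N) :
  (forall t : R, 0 <= t ->
     {ae P, forall w, (immigration_process z delta N t w < +oo)%E}) /\
  CB_process P Q
    (fun t => augmentation P (immigration_filtration N t))
    (fun t w => fine (immigration_process z delta N t w)).
Proof.
have [mu [muE hmu]] := intensity_exists hphi hdelta hQx hz.
have hNmu := poisson_random_measure_intensity muE hN.
pose X := immigration_process z delta N; pose Y t w := fine (X t w).
have mX t : measurable_fun setT (X t) by exact: measurable_immigration.
have X0 t w : (0 <= X t w)%E by exact: immigration_ge0.
have mY t : measurable_fun setT (Y t).
  by apply: (@measurableT_comp _ _ _ _ _ _ (@fine R)); first exact: fine_measurable.
have Y0 t w : 0 <= Y t w by exact: fine_ge0.
have mfin t : measurable [set w | (X t w < +oo)%E].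
  rewrite (_ : [set w | _] = X t @^-1` (~` [set +oo%E])).
    by rewrite -[S in measurable S]setTI; apply: mX => //; exact/measurableC/emeasurable_set1.
  by apply/seteqP; split => w /=; rewrite ltey => /eqP.
have Xfin t : 0 <= t -> {ae P, forall w, (X t w < +oo)%E}.
  move=> t0; exists (~` [set w | (X t w < +oo)%E]); split => //; first exact: measurableC.
  apply: probability_compl_null => //.
  exact: (immigration_finite hphi hdelta hv hQ hQx hz hmu hNmu t0).
split=> //; split; first by move=> t w _; exact: Y0.
have adapted t (B : set (measurableTypeR R)) : 0 <= t -> measurable B ->
    augmentation P (immigration_filtration N t) (Y t @^-1` B).
  move=> t0; exact: (immigration_adapted hphi hdelta hv hQ hQx hz hmu hNmu t0).
have mG t := @immigration_filtration_measurable R d Omega N t.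
split => //.
- split=> [t t0|s t s0 st].
    split; first exact: augmentation_sigma_algebra.
    exact: augmentation_measurable.
  by apply: augmentation_mono; exact: immigration_filtration_mono.
- move=> s t B s0 t0 mB; split.
    (* The candidate conditional probability is a measurable function of the process at time [s], so
       its measurability is adaptedness. *)
    move=> C mC; apply: (adapted s ((fun x => Q t x B) @^-1` C) s0).
    rewrite -[S in measurable S]setTI; exact: (measurable_kernel (Q t) B mB).
  (* Off a null event [F] is an event of the original filtration, where the Laplace identity is
     known. *)
  move=> F aF; have [F' [Z [GF' mZ Z0 FF']]] := augmentation_ae (smallest_sigma_algebra _ _) aF.
  have mF : measurable F by exact: augmentation_measurable aF.
  have mF' : measurable F' by exact: mG GF'.
  apply: (@transition_of_laplace R v Q hQ d Omega P (Y s) (Y (s + t)) F t (mY s)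
    (mY (s + t)) (Y0 s) (Y0 (s + t)) t0 mF _ B mB) => k.
  (* Two changes on null events: [F'] for [F], and the extended process for its real version, in
     which [fine] puts 0 for [+oo]. *)
  have expE a u : 0 <= a -> 0 <= u -> (\int[P]_(w in F) (expN (a * Y u w)%:E)%:E =
      \int[P]_(w in F') (expN (a%:E * X u w))%:E)%E.
    move=> a0 u0.
    have me : measurable_fun setT (fun w => (expN (a%:E * X u w))%:E).
      apply/measurable_EFinP; apply: (measurableT_comp (@measurable_expN R)).
      exact: measurable_funeM.
    have me' : measurable_fun setT (fun w => (expN (a * Y u w)%:E)%:E).
      apply/measurable_EFinP; apply: (measurableT_comp (@measurable_expN R)).
      by apply/measurable_EFinP; exact: measurable_funM.
    have e0 (y : \bar R) : (0 <= (expN y)%:E)%E by rewrite lee_fin expN_ge0.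
    rewrite -(integral_augmentation mF mF' mZ Z0 FF' me)//.
    apply: ge0_ae_eq_integral => //; try exact: measurable_funTS.
    apply: filterS (Xfin u u0) => w Xw _.
    by rewrite EFinM fineK// ge0_fin_numE.
  have vk0 : 0 <= v t k%:R by exact: (cumulant_ge0 hv t0 (ler0n R k)).
  apply: (etrans (expE k%:R (s + t) (ler0n R k) (addr_ge0 s0 t0))
    (etrans _ (esym (expE (v t k%:R) s vk0 s0)))).
  exact: (laplace_markov_filtration hphi hdelta hv hQ hQx hz hmu hNmu s0 t0 (ler0n R k) GF').
Qed.
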